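(* As $X\to\infty$, the number of imaginary quadratic number fields $k$ with $|\mathrm{Disc}(k)|<X$ and $\mathrm{rk}_3\,\mathrm{Cl}(k)\geq 5$ is $\gg X^{1/30}/\log X$. Likewise, the number of real quadratic number fields $k$ with $|\mathrm{Disc}(k)|<X$ and $\mathrm{rk}_3\,\mathrm{Cl}(k)\geq 4$ is $\gg X^{1/30}/\log X$.
   Context: $\mathrm{Disc}(k)$ is the absolute discriminant of $k$ and $\mathrm{Cl}(k)$ its ideal class group. For a finite abelian group $A$ and a prime $p$, $\mathrm{rk}_p A=\dim_{\mathbb{Z}/p\mathbb{Z}} A/pA$. *)

(* Defs.v *)
From Stdlib Require Import ZArith Reals List.
Open Scope Z_scope.

(** Squarefree integers and fundamental discriminants.  Quadratic number
    fields k correspond bijectively to fundamental discriminants D = Disc(k)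
    (D <> 1); k is imaginary iff D < 0, real iff D > 0. *)
Definition squarefree (m : Z) : Prop :=
  forall n : Z, (n * n | m)%Z -> Z.abs n = 1.

Definition fundamental_disc (D : Z) : Prop :=
  D <> 1 /\
  ((D mod 4 = 1 /\ squarefree D) \/
   (exists m : Z, D = 4 * m /\ (m mod 4 = 2 \/ m mod 4 = 3) /\ squarefree m)).

(** The ring of integers O_k of k = Q(sqrt D) is Z[w], w = (D + sqrt D)/2,
    with w^2 = D w - (D^2 - D)/4.  The pair (a, b) represents a + b w. *)
Definition qelt := (Z * Z)%type.
Definition qzero : qelt := (0, 0).
Definition qadd (x y : qelt) : qelt := (fst x + fst y, snd x + snd y).
Definition qmul (D : Z) (x y : qelt) : qelt :=
  let '(a, b) := x in let '(c, d) := y in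
  (a * c - b * d * ((D * D - D) / 4), a * d + b * c + b * d * D).

Definition is_ideal (D : Z) (I : qelt -> Prop) : Prop :=
  I qzero /\
  (forall x y, I x -> I y -> I (qadd x y)) /\
  (forall r x, I x -> I (qmul D r x)).

Definition nonzero_ideal (D : Z) (I : qelt -> Prop) : Prop :=
  is_ideal D I /\ exists x, I x /\ x <> qzero.

Definition iprod (D : Z) (I J : qelt -> Prop) : qelt -> Prop :=
  fun x => forall L, is_ideal D L ->
    (forall a b, I a -> J b -> L (qmul D a b)) -> L x.

Definition unit_ideal : qelt -> Prop := fun _ => True.

Fixpoint ipow (D : Z) (I : qelt -> Prop) (n : nat) : qelt -> Prop :=
  match n with
  | O => unit_ideal
  | S n' => iprod D I (ipow D I n')
  end.

Definition principal (D : Z) (alpha : qelt) : qelt -> Prop :=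
  fun x => exists r, x = qmul D alpha r.

Definition same_class (D : Z) (I J : qelt -> Prop) : Prop :=
  exists alpha beta, alpha <> qzero /\ beta <> qzero /\
    forall x, iprod D (principal D alpha) I x <-> iprod D (principal D beta) J x.

Definition class_is_cube (D : Z) (I : qelt -> Prop) : Prop :=
  exists J, nonzero_ideal D J /\ same_class D I (ipow D J 3).

Fixpoint ideal_monomial (D : Z) (Is : list (qelt -> Prop)) (es : list nat)
  : qelt -> Prop :=
  match Is, es with
  | P :: Is', e :: es' => iprod D (ipow D P e) (ideal_monomial D Is' es')
  | _, _ => unit_ideal
  end.

(** rk_3 Cl(k) >= r, i.e. dim_{F_3} Cl(k)/3Cl(k) >= r: there are r ideal
    classes whose images in Cl(k)/3Cl(k) are F_3-linearly independent. *)
Definition rk3_cl_ge (D : Z) (r : nat) : Prop :=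
  exists Is : list (qelt -> Prop),
    length Is = r /\ Forall (nonzero_ideal D) Is /\
    forall es : list nat,
      length es = r -> Forall (fun e => (e < 3)%nat) es ->
      Exists (fun e => e <> 0%nat) es ->
      ~ class_is_cube D (ideal_monomial D Is es).

(* Main.v *)
(** For numbers a_1, ..., a_6 with sum 0 and e3(a) = c^3, the polynomial A = (X^2 + e2/3)^3 - prod (X - a_i) is a
    cubic with leading coefficient c^3, and y^3 = A(X) has the six points with X = a_i. They become integral
    points of Y^2 = N^3 + K, where K = 729 disc(A) / 4, and one relation holds between them. Hence the elements
    Y + sqrt K of five points are virtual units of Q(sqrt K): their ideals are cubes. The line
    a = (x, -x, 6s, 19s, 21s, -46s) makes K a binary form of degree 18 in (x, s). For (x, s) in one residue class,
    cubic residue characters at 7, 13, 31, 37 and 61 show that the five elements are independent modulo cubes.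
    Since the units modulo cubes have rank 0 (imaginary case) or at most 1 (real case), the 3-torsion of the
    class group has rank at least 5 or 4, and so has its quotient by cubes, the class group being finite.

    About T^2 coprime pairs (x, s) of size at most T lie in the class, with K of either sign. At most O(T^(4/3)) of
    them share a given field: on a residue class modulo M = 13^k, with M^12 larger than a constant times T^16, a
    solution of D y^2 = K(x, s) expands 13-adically in one parameter, and Siegel's lemma gives forms P, Q of
    degrees 16 and 7 with P(x, s) + y Q(x, s) = 0 for all solutions of the class (the determinant method of
    Bombieri-Pila and Heath-Brown), which leaves at most 32 of them. So there are at least c T^(2/3) fields, with
    |D| bounded by a constant times T^18, that is c X^(1/27) fields of discriminant below X. *)

Require Import Defs.
From Stdlib Require Import ZArith Reals List Lia Lra Znumtheory.
From Stdlib Require Import FunctionalExtensionality PropExtensionality ClassicalEpsilon Classical.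
From mathcomp Require Import ssreflect ssrfun ssrbool.
From mathcomp Require all_boot boolp.
Import ListNotations.
Open Scope Z_scope.

(** * Ideals of a quadratic order *)

(** That e3 is a cube gives y^3 = A(X) a rational point at infinity, hence makes it an elliptic
    curve on which the six points can be added. Two opposite numbers and four of sum 0 make e3
    independent of x, and 6, 19, 21, -46 have e3 = -27000 = (-30)^3, so the whole line qualifies.

    The square part of a value of a form of degree 18 is out of control: K(x, s) = 4 m g^2 with g
    possibly large, so distinct pairs may share a field, and the fields have to be counted through
    the curves D y^2 = K(x, s). The residue class of (x, s) is fixed once for all, so that the
    coprimality of N and Y, the residue of m modulo 4 and the values of the characters become
    numerical checks at (9, 7). It also makes s and K units modulo 13, which the 13-adic expansion
    of y requires.

    The rank is defined by Cl/3Cl, while virtual units produce 3-torsion. The two are compared by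
    counting classes in a finite set that carries no group structure; inverses are replaced by
    conjugates, or by squares modulo cubes. *)

Lemma set_ext (T : Type) (I J : T -> Prop) : (forall x, I x <-> J x) -> I = J.
Proof. move=> h; apply: functional_extensionality => x; exact/propositional_extensionality. Qed.

Lemma skolem (A B : Type) (P : A -> B -> Prop) :
  (forall a, exists b, P a b) -> exists f, forall a, P a (f a).
Proof.
move=> h; exists (fun a => proj1_sig (constructive_indefinite_description _ (h a))) => a.
exact: proj2_sig.
Qed.

Lemma sqr_divide (a b : Z) : (a * a | b * b) -> (a | b).
Proof.
move=> h.
case: (Z.eq_dec a 0) => [a0|a0]; first by case: h => k hk; exists 0; nia.
have [g0|g0] := Z.eq_dec (Z.gcd a b) 0; first by apply Z.gcd_eq_0 in g0; lia.
have gp := Z.gcd_nonneg a b.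
have [a' ha] := Z.gcd_divide_l a b; have [b' hb] := Z.gcd_divide_r a b.
set g := Z.gcd a b in g0 gp ha hb *.
have cop : Z.gcd a' b' = 1 by rewrite -(Z.gcd_div_gcd a b g g0 (eq_refl _)) ha hb !Z.div_mul.
have h2 : (a' * a' | b' * b').
  case: h => k hk; exists k.
  have : g * g * (b' * b') = g * g * (k * (a' * a')) by rewrite hb ha in hk; nia.
  by apply Z.mul_cancel_l; nia.
have rp : rel_prime a' b' by apply/Zgcd_1_rel_prime.
have d1 : (a' | b').
  by apply: (Gauss a' b' b') => //; apply: Z.divide_trans h2; exact: Z.divide_factor_l.
have : (a' | Z.gcd a' b') by apply Z.gcd_greatest; [exact: Z.divide_refl|].
rewrite cop => /Z.divide_1_r_abs a1.
rewrite ha hb; apply: Z.mul_divide_mono_r.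
by case: d1 => k ->; exists k.
Qed.

Lemma divide_mul2 (a b c d : Z) : (a | c) -> (b | d) -> (a * b | c * d).
Proof. by move=> [k ->] [l ->]; exists (k * l); ring. Qed.

Lemma gcd_decomp (a b : Z) : a <> 0 \/ b <> 0 ->
  exists g a' b', 0 < g /\ a = g * a' /\ b = g * b' /\ rel_prime a' b'.
Proof.
move=> h0; have g0 : Z.gcd a b <> 0 by move=> /Z.gcd_eq_0; lia.
have gp := Z.gcd_nonneg a b.
have [a' ha] := Z.gcd_divide_l a b; have [b' hb] := Z.gcd_divide_r a b.
exists (Z.gcd a b), a', b'; split; [lia|split; [lia|split; [lia|]]].
apply/Zgcd_1_rel_prime; move: g0 gp ha hb; set g := Z.gcd a b => g0 gp ha hb.
by rewrite -(Z.gcd_div_gcd a b g g0 (eq_refl _)) ha hb !Z.div_mul.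
Qed.

Lemma rel_prime_sqr_divide (a b c : Z) : rel_prime a b -> (a * a | c * (b * b)) -> (a * a | c).
Proof.
move=> rp h; apply: (Gauss (a * a) (b * b)); first by rewrite Z.mul_comm.
apply: rel_prime_sym; apply: rel_prime_mult; apply: rel_prime_sym; exact: rel_prime_mult.
Qed.

(** In lowest terms the square of the numerator divides [m], hence is 1, and [m * (b' * b') = 1]
    leaves only [m = 1]. *)
Lemma squarefree_nonsquare (m a b : Z) : squarefree m -> m <> 1 -> a * a = m * (b * b) ->
  a = 0 /\ b = 0.
Proof.
move=> sf m1 h.
case: (Z.eq_dec b 0) => [b0|b0]; first by split=> //; nia.
have [g [a' [b' [gp [ha [hb rp]]]]]] := gcd_decomp a b (or_intror b0).
have h' : a' * a' = m * (b' * b').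
  have : (g * g) * (a' * a') = (g * g) * (m * (b' * b')) by subst; nia.
  by apply Z.mul_cancel_l; nia.
have : (a' * a' | m).
  by apply: (rel_prime_sqr_divide a' b') => //; exists 1; lia.
move=> /sf a1; have {}a1 : a' * a' = 1 by nia.
have := Z.mul_eq_1 m (b' * b'); rewrite -h' a1 => /(_ (eq_refl _)); nia.
Qed.

Definition qone : qelt := (1, 0).
Definition qopp (x : qelt) : qelt := (- fst x, - snd x).
Definition qsub (x y : qelt) : qelt := qadd x (qopp y).
Definition qint (n : Z) : qelt := (n, 0).

Lemma qelt_ring (D : Z) : ring_theory qzero qone qadd (qmul D) qsub qopp eq.
Proof.
split; repeat (case=> ? ?) => //; rewrite /qsub /qadd /qmul /qopp /qzero /qone;
  cbn [fst snd]; try (set e := (_ / 4)); congr pair; ring.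
Qed.

Section Ideals.
Variable D : Z.
Local Notation "x *q y" := (qmul D x y) (at level 40, left associativity).
Local Notation "x +q y" := (qadd x y) (at level 50, left associativity).
Add Ring qelt_ring_D : (qelt_ring D).
Implicit Types (I J K : qelt -> Prop) (x y a b : qelt).

Lemma ideal_opp I x : is_ideal D I -> I x -> I (qopp x).
Proof. move=> [_ [_ h]] hx; have -> : qopp x = qopp qone *q x by ring. exact: h. Qed.

Lemma ideal_sub I x y : is_ideal D I -> I x -> I y -> I (qsub x y).
Proof. move=> h hx hy; case: (h) => _ [hD _]; apply: hD => //; exact: ideal_opp. Qed.

Lemma iprod_ideal I J : is_ideal D (iprod D I J).
Proof.
split; first by move=> L [].
split=> [x y hx hy L hL h|r x hx L hL h].
  by case: (hL) => _ [hD _]; apply: hD; [apply: hx|apply: hy].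
by case: (hL) => _ [_ hM]; apply: hM; apply: hx.
Qed.

Lemma iprod_in I J x y : I x -> J y -> iprod D I J (x *q y).
Proof. by move=> hx hy L _; apply. Qed.

Lemma iprodC I J : iprod D I J = iprod D J I.
Proof.
have s K K' x : iprod D K K' x -> iprod D K' K x.
  move=> h; apply: h (iprod_ideal _ _) _ => a b ha hb.
  have -> : a *q b = b *q a by ring.
  exact: iprod_in.
by apply: set_ext => x; split; apply: s.
Qed.

(** As [iprod] is an intersection of ideals, membership is used by testing it on an ideal made for
    the purpose, here the set of [a] whose product with [b] lies in the triple product. *)
Lemma iprodA_sub I J K x : iprod D (iprod D I J) K x -> iprod D I (iprod D J K) x.
Proof.
have id := iprod_ideal I (iprod D J K); case: (id) => z [ad mu].
move=> h; apply: h id _ => a b ha hb.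
apply: (ha (fun a => iprod D I (iprod D J K) (a *q b))).
  split; first by have -> : qzero *q b = qzero by ring.
  split=> [x1 y1 h1 h2|r x1 h1].
    have -> : (x1 +q y1) *q b = x1 *q b +q y1 *q b by ring.
    exact: ad.
  have -> : r *q x1 *q b = r *q (x1 *q b) by ring.
  exact: mu.
move=> a1 b1 h1 h2; have -> : a1 *q b1 *q b = a1 *q (b1 *q b) by ring.
by apply: iprod_in => //; exact: iprod_in.
Qed.

Lemma iprodA I J K : iprod D I (iprod D J K) = iprod D (iprod D I J) K.
Proof.
apply: set_ext => x; split; last exact: iprodA_sub.
rewrite (iprodC I) (iprodC J) (iprodC (iprod D I J)) (iprodC I); exact: iprodA_sub.
Qed.

Lemma iprod_prin I x y : is_ideal D I ->
  iprod D (principal D x) I y <-> exists2 z, I z & y = x *q z.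
Proof.
move=> hI; case: (hI) => z0 [ad mu]; split; last first.
  by move=> [z hz ->]; apply: iprod_in => //; exists qone; ring.
move=> h; apply: (h (fun y => exists2 z, I z & y = x *q z)) => [|a b [r ->] hb]; last first.
  by exists (r *q b); [apply: mu|ring].
split; first by exists qzero => //; ring.
split=> [_ _ [u hu ->] [v hv ->]|r _ [u hu ->]].
  by exists (u +q v); [apply: ad|ring].
by exists (r *q u); [apply: mu|ring].
Qed.

Lemma principal_ideal x : is_ideal D (principal D x).
Proof.
split; first by exists qzero; ring.
split=> [_ _ [u ->] [v ->]|r _ [u ->]].
  by exists (u +q v); ring.
by exists (r *q u); ring.
Qed.

Lemma unit_idealE : unit_ideal = principal D qone.
Proof. by apply: set_ext => x; split=> // _; exists x; ring. Qed.

Lemma unit_ideal_ideal : is_ideal D unit_ideal.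
Proof. by []. Qed.

Lemma iprod1 I : is_ideal D I -> iprod D unit_ideal I = I.
Proof.
move=> hI; apply: set_ext => y; rewrite unit_idealE iprod_prin //; split.
  by move=> [z hz ->]; have -> : qone *q z = z by ring.
by move=> hy; exists y => //; ring.
Qed.

Lemma prin_prin x y : iprod D (principal D x) (principal D y) = principal D (x *q y).
Proof.
apply: set_ext => z; rewrite iprod_prin; last exact: principal_ideal.
split=> [[_ [r ->] ->]|[r ->]]; first by exists r; ring.
by exists (y *q r); [exists r|ring].
Qed.

Lemma ipow_ideal I n : is_ideal D (ipow D I n).
Proof. by case: n => [//|n]; apply: iprod_ideal. Qed.

Lemma ipow_prin x n : ipow D (principal D x) n = principal D (Nat.iter n (qmul D x) qone).
Proof. by elim: n => [|n IH] /=; [exact: unit_idealE|rewrite IH prin_prin]. Qed.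

Lemma ipow_unit n : ipow D unit_ideal n = unit_ideal.
Proof. by elim: n => [//|n IH] /=; rewrite IH iprod1. Qed.

Lemma iprodACA I J K L :
  iprod D (iprod D I J) (iprod D K L) = iprod D (iprod D I K) (iprod D J L).
Proof. by rewrite -!iprodA (iprodA J) (iprodC J K) -!iprodA. Qed.

Lemma iprodCA I J K : iprod D I (iprod D J K) = iprod D J (iprod D I K).
Proof. by rewrite !iprodA (iprodC I). Qed.

Lemma ipow1 I : is_ideal D I -> ipow D I 1 = I.
Proof. by move=> hI; rewrite /= iprodC iprod1. Qed.

Lemma ipow_iprod I J n : ipow D (iprod D I J) n = iprod D (ipow D I n) (ipow D J n).
Proof.
elim: n => [|n IH] /=; first by rewrite iprod1 //; exact: unit_ideal_ideal.
by rewrite IH iprodACA.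
Qed.

Lemma ipow_add I n k : ipow D I (n + k) = iprod D (ipow D I n) (ipow D I k).
Proof.
elim: n => [|n IH] /=; first by rewrite iprod1 //; exact: ipow_ideal.
by rewrite IH iprodA.
Qed.

Lemma ipow_mul I n k : ipow D I (n * k) = ipow D (ipow D I k) n.
Proof. by elim: n => [//|n IH] /=; rewrite ipow_add IH. Qed.

End Ideals.

(* For D = 4m one has w = 2m + sqrt m, so (a, b) is (a + 2mb) + b sqrt m. *)
Definition qre (m : Z) (x : qelt) : Z := fst x + 2 * m * snd x.
Definition qbar (m : Z) (x : qelt) : qelt := (fst x + 4 * m * snd x, - snd x).
Definition qnorm (m : Z) (x : qelt) : Z := qre m x * qre m x - m * (snd x * snd x).
Definition qof (m a b : Z) : qelt := (a - 2 * m * b, b).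

Lemma disc_quotient m : (4 * m * (4 * m) - 4 * m) / 4 = 4 * m * m - m.
Proof. by rewrite (_ : _ - _ = (4 * m * m - m) * 4); [exact: Z.div_mul|ring]. Qed.

Section QuadraticRing.
Variable m : Z.
Local Notation D := (4 * m).
Local Notation "x *q y" := (qmul D x y) (at level 40, left associativity).
Local Notation "x +q y" := (qadd x y) (at level 50, left associativity).
Local Notation N := (qnorm m).
Local Notation bar := (qbar m).
Add Ring qelt_ring_D : (qelt_ring D).
Implicit Types (I J K : qelt -> Prop) (x y a b : qelt).

Lemma qeltE x y : qre m x = qre m y -> snd x = snd y -> x = y.
Proof. case: x y => [a b] [c d]; rewrite /qre /= => h1 h2; congr pair; nia. Qed.

Lemma qre_mul x y : qre m (x *q y) = qre m x * qre m y + m * (snd x * snd y).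
Proof. case: x y => [a b] [c d]; rewrite /qre /qmul disc_quotient; cbn [fst snd]; ring. Qed.

Lemma qim_mul x y : snd (x *q y) = qre m x * snd y + snd x * qre m y.
Proof. case: x y => [a b] [c d]; rewrite /qre /qmul; cbn [fst snd]; ring. Qed.

Lemma qre_add x y : qre m (x +q y) = qre m x + qre m y.
Proof. case: x y => [a b] [c d]; rewrite /qre /qadd; cbn [fst snd]; ring. Qed.

Lemma qim_add x y : snd (x +q y) = snd x + snd y.
Proof. by []. Qed.

Lemma qre_bar x : qre m (bar x) = qre m x.
Proof. case: x => [a b]; rewrite /qre /qbar; cbn [fst snd]; ring. Qed.

Lemma qim_bar x : snd (bar x) = - snd x.
Proof. by []. Qed.

Lemma qre_of (a b : Z) : qre m (qof m a b) = a.
Proof. rewrite /qre /qof; cbn [fst snd]; ring. Qed.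

Lemma qre_int n : qre m (qint n) = n.
Proof. rewrite /qre /qint; cbn [fst snd]; ring. Qed.

Lemma qim_int n : snd (qint n) = 0.
Proof. by []. Qed.

Lemma qim_of (a b : Z) : snd (qof m a b) = b.
Proof. by []. Qed.

Lemma qre_opp x : qre m (qopp x) = - qre m x.
Proof. case: x => [a b]; rewrite /qre /qopp; cbn [fst snd]; ring. Qed.

Lemma qnorm_mul x y : N (x *q y) = N x * N y.
Proof. rewrite /qnorm qre_mul qim_mul; ring. Qed.

Lemma qnorm_bar x : N (bar x) = N x.
Proof. rewrite /qnorm qre_bar qim_bar; ring. Qed.

Lemma mul_bar x : x *q bar x = qint (N x).
Proof.
by apply: qeltE; rewrite ?qre_mul ?qim_mul ?qre_bar ?qre_int ?qim_bar /qnorm /=; ring.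
Qed.

Lemma bar_mul x y : bar (x *q y) = bar x *q bar y.
Proof.
by apply: qeltE; rewrite ?(qre_bar, qim_bar, qre_mul, qim_mul); ring.
Qed.

Lemma bar_add x y : bar (x +q y) = bar x +q bar y.
Proof. by apply: qeltE; rewrite ?(qre_bar, qim_bar, qre_add, qim_add); ring. Qed.

Lemma bar_bar x : bar (bar x) = x.
Proof. by apply: qeltE; rewrite ?(qre_bar, qim_bar); ring. Qed.

Hypothesis sf : squarefree m.
Hypothesis m4 : m mod 4 = 2 \/ m mod 4 = 3.

Lemma m_mod4E : exists k, m = 4 * k + 2 \/ m = 4 * k + 3.
Proof. exists (m / 4); have := Z.div_mod m 4; lia. Qed.

Lemma m_neq1 : m <> 1.
Proof. by move=> h; move: m4; rewrite h; cbn; lia. Qed.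

Lemma qnorm_eq0 x : N x = 0 -> x = qzero.
Proof.
move=> h; have [h1 h2] : qre m x = 0 /\ snd x = 0.
  by apply: (squarefree_nonsquare m) => //; [exact: m_neq1|rewrite /qnorm in h; lia].
by apply: qeltE; rewrite ?h1 ?h2 /qre /qzero //=; ring.
Qed.

Lemma qmul_eq0 x y : x *q y = qzero -> x = qzero \/ y = qzero.
Proof.
move=> h; have : N x * N y = 0.
  by rewrite -qnorm_mul h /qnorm /qre /qzero; cbn [fst snd]; ring.
by case/Z.mul_eq_0 => /qnorm_eq0; [left|right].
Qed.

Lemma qmul_neq0 x y : x <> qzero -> y <> qzero -> x *q y <> qzero.
Proof. by move=> hx hy /qmul_eq0 []. Qed.

Lemma qmulI x y y' : x <> qzero -> x *q y = x *q y' -> y = y'.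
Proof.
move=> hx h; have : x *q qsub y y' = qzero.
  have -> : x *q qsub y y' = qsub (x *q y) (x *q y') by ring.
  by rewrite h; ring.
case/qmul_eq0 => // h0; have -> : y = qsub y y' +q y' by ring.
by rewrite h0; ring.
Qed.

Lemma qint_neq0 n : n <> 0 -> qint n <> qzero.
Proof. by move=> h []. Qed.

(* The hypotheses say that x / n has integral trace and norm. *)
Lemma integrally_closed n x : 0 < n -> (n | 2 * qre m x) -> (n * n | N x) ->
  exists y, x = qint n *q y.
Proof.
move=> n0 hT hN.
have [g [n' [i' [gp [hn [hi rp]]]]]] := gcd_decomp n (snd x) (or_introl (Z.neq_sym _ _ (Z.lt_neq _ _ n0))).
have n'0 : 0 < n' by nia.
have h1 : (n' * n' | 4 * m).
  apply: (rel_prime_sqr_divide n' i') => //.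
  have : (n * n | (2 * qre m x) * (2 * qre m x) - 4 * N x).
    by apply: Z.divide_sub_r; [exact: divide_mul2|exact: Z.divide_mul_r].
  rewrite /qnorm; case=> k hk; exists k.
  have : g * g * (4 * m * (i' * i')) = g * g * (k * (n' * n')) by rewrite hn hi in hk; nia.
  by apply Z.mul_cancel_l; nia.
(* [n'] is the denominator of [snd x / n]. Its square divides [4 * m], which leaves 1 or 2, and 2
   would make [m] congruent to a square modulo 4. *)
have key : n' = 1.
  have [k hk] := m_mod4E.
  have [[j hj]|[j hj]] : (exists j, n' = 2 * j) \/ (exists j, n' = 2 * j + 1).
    by case: (Z.Even_or_Odd n') => [[j ->]|[j ->]]; [left|right]; exists j.
  - have : j * j = 1.
      have /sf : (j * j | m) by case: h1 => l hl; exists l; nia.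
      by nia.
    move=> jj; have {jj}j1 : j = 1 by nia.
    have i'odd : exists l, i' = 2 * l + 1.
      case: (Z.Even_or_Odd i') => // -[l hl].
      have : (2 | 1); last by case=> ?; lia.
      by case: rp => _ _; apply; [exists j|exists l]; lia.
    have [r hr] : (g | qre m x).
      apply: sqr_divide; case: hN => l; rewrite /qnorm hi hn hj j1 => hl.
      by exists (4 * l + m * (i' * i')); nia.
    case: hN => l; rewrite /qnorm hi hn hj j1 hr => hl.
    have : g * g * (r * r - m * (i' * i')) = g * g * (4 * l) by nia.
    move/Z.mul_cancel_l => /(_ ltac:(nia)); case: i'odd => q -> {}hl.
    exfalso; case: (Z.Even_or_Odd r) => -[w hw]; subst r; case: hk => hk; rewrite hk in hl; lia.
  - have /sf : (n' * n' | m).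
      by case: h1 => l hl; exists (m - (j * j + j) * l); rewrite hj in hl *; nia.
    by nia.
rewrite key Z.mul_1_r in hn; subst g.
have [r hr] : (n | qre m x).
  apply: sqr_divide; case: hN => l; rewrite /qnorm hi => hl.
  by exists (l + m * (i' * i')); nia.
exists (qof m r i'); apply: qeltE; rewrite ?(qre_mul, qim_mul, qre_int, qre_of) /=; first by rewrite hr; ring.
by rewrite hi; ring.
Qed.

Lemma ideal_bar I : is_ideal D I -> is_ideal D (fun x => I (bar x)).
Proof.
move=> [h0 [hD hM]]; split.
  by have -> : bar qzero = qzero by apply: qeltE => //; exact: qre_bar.
split=> [x y|r x]; rewrite ?bar_add ?bar_mul; [exact: hD|exact: hM].
Qed.

Lemma qint_add (a b : Z) : qint (a + b) = qint a +q qint b.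
Proof. by []. Qed.

Lemma qint_mul (a b : Z) : qint (a * b) = qint a *q qint b.
Proof. by apply: qeltE; rewrite ?(qre_mul, qim_mul, qre_int, qim_int); ring. Qed.

Lemma trace_int x : x +q bar x = qint (2 * qre m x).
Proof. by apply: qeltE; rewrite ?(qre_add, qim_add, qre_bar, qim_bar, qre_int, qim_int); ring. Qed.

Lemma least_pos (P : Z -> Prop) : (exists n, 0 < n /\ P n) ->
  exists n, 0 < n /\ P n /\ forall k, 0 < k -> P k -> n <= k.
Proof.
move=> [n [n0 hn]]; apply: NNPP => none.
have : forall k, 0 <= k -> forall j, 0 < j -> P j -> k < j.
  apply: natlike_ind => [|k k0 IH j j0 hj]; first by lia.
  case: (Z.eq_dec j (Z.succ k)) => [jk|jk]; last by have := IH _ j0 hj; lia.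
  case: none; exists j; do 2 split=> //; move=> i i0 hi; have := IH _ i0 hi; lia.
by move/(_ n ltac:(lia) n n0 hn); lia.
Qed.

(* After Hurwitz: the least positive integer n in I * conj I is a generator, because n divides the norm of
   every element of I and every trace of a product a * conj b. *)
Lemma ideal_mul_bar I : nonzero_ideal D I ->
  exists n, 0 < n /\ iprod D I (fun x => I (bar x)) = principal D (qint n).
Proof.
move=> [hI [x [hx x0]]]; set J := fun x => I (bar x).
have hJ := ideal_bar I hI; have hP := iprod_ideal D I J.
case: (hP) => P0 [PD PM].
have normP y : I y -> iprod D I J (qint (N y)).
  by move=> hy; rewrite -mul_bar; apply: iprod_in => //; rewrite /J bar_bar.
have intN k : iprod D I J (qint k) -> iprod D I J (qint (- k)).
  by move=> /(ideal_opp _ _ _ hP).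
have [n [n0 [hn nmin]]] : exists n, 0 < n /\ iprod D I J (qint n) /\
    forall k, 0 < k -> iprod D I J (qint k) -> n <= k.
  apply: least_pos.
  have Nx : N x <> 0 by move/qnorm_eq0.
  case: (Z_lt_le_dec 0 (N x)) => h; first by exists (N x); split=> //; exact: normP.
  exists (- N x); split; [lia|apply: intN; exact: normP].
have ndiv k : iprod D I J (qint k) -> (n | k).
  move=> hk; case: (Z.eq_dec (k mod n) 0) => [|h]; first by move/Z.mod_divide; apply; lia.
  have := Z.mod_pos_bound k n n0 => hb.
  suff : n <= k mod n by lia.
  apply: nmin; first by lia.
  have -> : k mod n = k + - (k / n * n) by rewrite Z.mod_eq; lia.
  by rewrite qint_add; apply: PD => //; apply: intN; rewrite qint_mul; exact: PM.
exists n; split=> //; apply: set_ext => z; split; last first.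
  move=> [r ->]; rewrite (_ : qint n *q r = r *q qint n); last by ring.
  exact: PM.
move=> h; apply: h (principal_ideal _ _) _ => a b ha hb.
have [] // := integrally_closed n (a *q b) n0.
- apply: ndiv; rewrite -trace_int bar_mul.
  have -> : bar a *q bar b = bar b *q bar a by ring.
  by apply: PD; apply: iprod_in => //; rewrite /J bar_bar.
- rewrite qnorm_mul; apply: divide_mul2; apply: ndiv; first exact: normP.
  by rewrite -qnorm_bar; exact: normP.
- by move=> y ->; exists y.
Qed.

End QuadraticRing.

(** * The class group *)

Section Classes.
Import all_boot boolp.
Local Open Scope Z_scope.

Lemma pigeonhole_nat (b : nat) (f : nat -> nat) : (forall t, (f t < b)%N) ->
  exists t1 t2, (t1 < t2 <= b)%N /\ f t1 = f t2.
Proof.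
move=> hf; pose g (i : 'I_b.+1) : 'I_b := Ordinal (hf i).
have : ~ injective g by move=> /leq_card; rewrite !card_ord ltnn.
move=> ninj; apply: NNPP => none; apply: ninj => i j /(congr1 val) /= e; apply: val_inj => /=.
have h (i0 j0 : 'I_b.+1) : (i0 < j0)%N -> f i0 <> f j0.
  by move=> lij eij; apply: none; exists i0, j0; rewrite lij -ltnS ltn_ord.
by case: (ltngtP i j) => // l; [case: (h i j l)|case: (h j i l)].
Qed.

Section ClassGroup.
Variable m : Z.
Hypothesis sf : squarefree m.
Hypothesis m4 : m mod 4 = 2 \/ m mod 4 = 3.
Local Notation D := (4 * m).
Local Notation "x *q y" := (qmul D x y) (at level 40, left associativity).
Local Notation "x +q y" := (qadd x y) (at level 50, left associativity).
Local Notation N := (qnorm m).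
Local Notation bar := (qbar m).
Local Notation "I ** J" := (iprod D I J) (at level 40, left associativity).
Local Notation "I ~~~ J" := (same_class D I J) (at level 70).
Add Ring qelt_ring_D : (qelt_ring D).
Implicit Types (I J K : qelt -> Prop) (x y a b : qelt).

Let mul0 x y : x <> qzero -> y <> qzero -> x *q y <> qzero.
Proof. exact: (qmul_neq0 m sf m4). Qed.

Lemma qone_neq0 : qone <> qzero.
Proof. by []. Qed.

Lemma nonzero_ideal_mul I J : nonzero_ideal D I -> nonzero_ideal D J -> nonzero_ideal D (I ** J).
Proof.
move=> [hI [x [hx x0]]] [hJ [y [hy y0]]]; split; first exact: iprod_ideal.
by exists (x *q y); split; [apply: iprod_in|apply: mul0].
Qed.

Lemma nonzero_unit : nonzero_ideal D unit_ideal.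
Proof. by split; [|exists qone; split; last exact: qone_neq0]. Qed.

Lemma nonzero_pow I n : nonzero_ideal D I -> nonzero_ideal D (ipow D I n).
Proof. by move=> hI; elim: n => [|n IH] /=; [exact: nonzero_unit|exact: nonzero_ideal_mul]. Qed.

Lemma nonzero_bar I : nonzero_ideal D I -> nonzero_ideal D (fun x => I (bar x)).
Proof.
move=> [hI [x [hx x0]]]; split; first exact: ideal_bar.
exists (bar x); split; first by rewrite bar_bar.
by move=> h; apply: x0; rewrite -(bar_bar m x) h; apply: (qeltE m) => //; exact: qre_bar.
Qed.

Lemma nonzero_ideal_ideal I : nonzero_ideal D I -> is_ideal D I.
Proof. by case. Qed.
Hint Resolve nonzero_ideal_ideal nonzero_ideal_mul nonzero_unit nonzero_pow nonzero_bar : core.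

Lemma same_class_refl I : I ~~~ I.
Proof. by exists qone, qone; split; [exact: qone_neq0|split; first exact: qone_neq0]. Qed.

Lemma same_classE I J : I ~~~ J <->
  exists a b, a <> qzero /\ b <> qzero /\ principal D a ** I = principal D b ** J.
Proof.
split=> -[a [b [a0 [b0 h]]]]; exists a, b; split=> //; split=> //; first exact: set_ext.
by move=> x; rewrite h.
Qed.

Lemma same_class_sym I J : I ~~~ J -> J ~~~ I.
Proof. by move=> /same_classE [a [b [a0 [b0 h]]]]; apply/same_classE; exists b, a. Qed.

Lemma same_class_trans I J K : I ~~~ J -> J ~~~ K -> I ~~~ K.
Proof.
move=> /same_classE [a [b [a0 [b0 h]]]] /same_classE [c [d [c0 [d0 h']]]].
apply/same_classE; exists (c *q a), (b *q d); split; first exact: mul0.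
split; first exact: mul0.
rewrite -2!prin_prin.
rewrite -(iprodA D (principal D c)) h.
rewrite -(iprodA D (principal D b)) -h'.
rewrite !iprodA.
rewrite (iprodC D (principal D c)).
reflexivity.
Qed.

Lemma same_class_mul I I' J J' : I ~~~ I' -> J ~~~ J' -> (I ** J) ~~~ (I' ** J').
Proof.
move=> /same_classE [a [b [a0 [b0 h]]]] /same_classE [c [d [c0 [d0 h']]]].
apply/same_classE; exists (a *q c), (b *q d); split; first exact: mul0.
split; first exact: mul0.
by rewrite -2!prin_prin (iprodACA D (principal D a)) (iprodACA D (principal D b)) h h'.
Qed.

Lemma same_class_pow I J n : I ~~~ J -> ipow D I n ~~~ ipow D J n.
Proof. by move=> h; elim: n => [|n IH] /=; [exact: same_class_refl|exact: same_class_mul]. Qed.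

Lemma same_class_inv I : nonzero_ideal D I -> (I ** (fun x => I (bar x))) ~~~ unit_ideal.
Proof.
move=> hI; have [n [n0 ->]] := ideal_mul_bar m sf m4 I hI.
apply/same_classE; exists qone, (qint n); split; first exact: qone_neq0.
split; first by apply: qint_neq0; lia.
by rewrite (unit_idealE D) !prin_prin; congr principal; ring.
Qed.

(** The product of [I] and its conjugate is principal, so the conjugate inverts the class of [I]. *)
Lemma same_class_cancel I J K : nonzero_ideal D I -> nonzero_ideal D J -> nonzero_ideal D K ->
  (I ** J) ~~~ (I ** K) -> J ~~~ K.
Proof.
move=> hI hJ hK h.
have e L : nonzero_ideal D L -> L ~~~ ((fun x => I (bar x)) ** (I ** L)).
  move=> hL; rewrite iprodA (iprodC D _ I); apply: same_class_sym.
  rewrite -{2}(iprod1 D L) //; last exact: nonzero_ideal_ideal.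
  apply: same_class_mul; [exact: same_class_inv|exact: same_class_refl].
apply: (same_class_trans _ _ _ (e J hJ)); apply: same_class_trans (same_class_sym _ _ (e K hK)).
by apply: same_class_mul => //; exact: same_class_refl.
Qed.

Lemma same_class_unit I : is_ideal D I -> I ~~~ unit_ideal -> exists x, I = principal D x.
Proof.
move=> hI /same_classE [a [b [a0 [b0 h]]]].
have : (principal D a ** I) b.
  by rewrite h (unit_idealE D) prin_prin; exists qone; ring.
move/(iprod_prin D I a b hI) => [c hc bE].
exists c; apply: set_ext => x; split=> [hx|[r ->]]; last first.
  by case: hI => _ [_ mu]; rewrite (_ : c *q r = r *q c); [exact: mu|ring].
have : (principal D b ** unit_ideal) (a *q x).
  by rewrite -h; apply: iprod_in => //; exists qone; ring.
rewrite (unit_idealE D) prin_prin => -[r hr]; exists r.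
apply: (qmulI m sf m4 a) => //; rewrite hr bE; ring.
Qed.

(** Dirichlet's box argument stands in for Euclidean division: some multiple [t * x / y] is close to
    an integer of the field, with [t] bounded in terms of [m] alone. *)
Lemma small_multiple_bound : exists M : nat, (0 < M)%N /\ forall x y, y <> qzero ->
  exists t, 0 < t <= Z.of_nat M /\
    exists z, Z.abs (N (qsub (qint t *q x) (z *q y))) < Z.abs (N y).
Proof.
(* For boxes of side [1 / k] the norm of a difference is below [(1 + |m|) / k^2 = (k - 1) / k^2],
   which is less than 1. *)
pose k := Z.abs m + 2; exists (Z.to_nat (k * k)); split; first by apply/ltP; rewrite /k; nia.
move=> x y y0; set n := Z.abs (N y).
have n0 : 0 < n.
  suff : N y <> 0 by rewrite /n; lia.
  by move=> /(qnorm_eq0 m sf m4).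
(* Up to sign [x / y] is [w / n], so the coordinates of [t * w] modulo [n] measure the fractional
   part of [t * x / y]. *)
set w := x *q bar y.
pose box (t a : Z) := k * ((t * a) mod n) / n.
have boxP (t c : Z) : 0 <= box t c < k.
  have h := Z.mod_pos_bound (t * c) n n0; rewrite /box; split.
    by apply: Z.div_pos; rewrite /k; nia.
  by apply: Z.div_lt_upper_bound; rewrite /k; nia.
pose f (t : nat) := Z.to_nat (box (Z.of_nat t) (qre m w) * k + box (Z.of_nat t) (snd w)).
have [t1 [t2 [/andP [l12 l2] e]]] : exists t1 t2, (t1 < t2 <= Z.to_nat (k * k))%N /\ f t1 = f t2.
  apply: pigeonhole_nat => t; apply/ltP; rewrite /f.
  have := boxP (Z.of_nat t) (qre m w); have := boxP (Z.of_nat t) (snd w); nia.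
exists (Z.of_nat t2 - Z.of_nat t1); split; first by move/ltP: l12; move/leP: l2; lia.
move: e; rewrite /f => /Z2Nat.inj.
have b1 := boxP (Z.of_nat t1) (qre m w); have b2 := boxP (Z.of_nat t1) (snd w).
have b3 := boxP (Z.of_nat t2) (qre m w); have b4 := boxP (Z.of_nat t2) (snd w).
move=> /(_ ltac:(nia) ltac:(nia)) e.
have [e1 e2] : box (Z.of_nat t1) (qre m w) = box (Z.of_nat t2) (qre m w) /\
    box (Z.of_nat t1) (snd w) = box (Z.of_nat t2) (snd w).
  by apply: (Z.div_mod_unique k); [left|left|rewrite !(Z.mul_comm k)].
have close (a : Z) : box (Z.of_nat t1) a = box (Z.of_nat t2) a ->
    exists r q, (Z.of_nat t2 - Z.of_nat t1) * a = r + n * q /\ k * Z.abs r < n.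
  rewrite /box => eb; set u1 := (Z.of_nat t1 * a) mod n; set u2 := (Z.of_nat t2 * a) mod n.
  exists (u2 - u1), (Z.of_nat t2 * a / n - Z.of_nat t1 * a / n); split.
    by rewrite /u1 /u2 !Z.mod_eq; lia.
  have d1 := Z.div_mod (k * u1) n ltac:(lia); have d2 := Z.div_mod (k * u2) n ltac:(lia).
  have m1 := Z.mod_pos_bound (k * u1) n n0; have m2 := Z.mod_pos_bound (k * u2) n n0.
  rewrite -/u1 -/u2 in eb; rewrite eb in d1.
  have -> : k * Z.abs (u2 - u1) = Z.abs (k * u2 - k * u1) by rewrite /k; nia.
  lia.
have [r [q [hr kr]]] := close _ e1; have [s [q' [hs ks]]] := close _ e2.
have [sg hsg] : exists sg, n = sg * N y /\ sg * sg = 1.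
  by rewrite /n; case: (Z.abs_spec (N y)) => -[_ ->]; [exists 1|exists (-1)]; lia.
pose z := qof m (sg * q) (sg * q').
exists z; set t := _ - _ in hr hs *; set v := qsub _ _.
rewrite /w qre_mul in hr; rewrite /w qim_mul in hs.
have hv : bar y *q v = qof m r s.
  have -> : bar y *q v = qsub (qint t *q w) (z *q (y *q bar y)).
    by rewrite /v /w; ring.
  rewrite mul_bar; apply: (qeltE m);
    rewrite /qsub ?(qre_add, qim_add, qre_opp, qre_mul, qim_mul, qre_int, qim_int, qre_of, qim_of).
    by case: hsg => hn _; rewrite hn in hr; cbn [snd fst qopp z qof]; lia.
  rewrite /qopp; cbn [snd fst]; rewrite ?(qim_mul, qre_int, qim_int, qre_of, qim_of).
  by case: hsg => hn _; rewrite hn in hs; cbn [snd fst qopp z qof]; lia.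
have := congr1 (fun u => Z.abs (N u)) hv; rewrite qnorm_mul qnorm_bar Z.abs_mul -/n => hN.
have k0 : 2 <= k by rewrite /k; lia.
have sq u : k * Z.abs u < n -> 0 <= k * k * (u * u) < n * n.
  move=> h; have -> : k * k * (u * u) = (k * Z.abs u) * (k * Z.abs u).
    by case: (Z.abs_spec u) => -[_ ->]; ring.
  split; first exact: Z.square_nonneg.
  apply: Z.square_lt_mono_nonneg => //; apply: Z.mul_nonneg_nonneg; lia.
have h : k * k * Z.abs (N (qof m r s)) < (k - 1) * (n * n).
  rewrite /qnorm qre_of qim_of.
  have -> : k * k * Z.abs (r * r - m * (s * s)) = Z.abs (k * k * (r * r) - m * (k * k * (s * s))).
    by rewrite (_ : k * k * (r * r) - _ = k * k * (r * r - m * (s * s))) ?Z.abs_mul ?Z.abs_square; [|ring].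
  have := sq _ kr; have := sq _ ks; move: (k * k * (r * r)) (k * k * (s * s)) (n * n) => P S n2 hS hP.
  have : Z.abs (m * S) <= Z.abs m * n2.
    by rewrite Z.abs_mul; apply: Z.mul_le_mono_nonneg_l; lia.
  by rewrite (_ : k - 1 = Z.abs m + 1) ?Z.mul_add_distr_r; rewrite /k; lia.
rewrite -hN in h.
have {}h : n * (k * k * Z.abs (N v)) < n * ((k - 1) * n) by lia.
move: (proj2 (Z.mul_lt_mono_pos_l n _ _ n0) h); move: (Z.abs (N v)) => V {}h.
have hk : k * 1 <= k * k by apply: Z.mul_le_mono_nonneg_l; lia.
case: (Z_lt_le_dec V n) => // hV.
have : (k * k) * n <= (k * k) * V by apply: Z.mul_le_mono_nonneg_l; lia.
have : (k - 1) * n <= (k * k) * n by apply: Z.mul_le_mono_nonneg_r; lia.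
lia.
Qed.

End ClassGroup.

Local Arguments Z.mul : simpl never.
Local Arguments ipow : simpl never.

Lemma common_multiple (M : nat) : exists n, 0 < n /\ forall t, 0 < t <= Z.of_nat M -> (t | n).
Proof.
elim: M => [|M [n [n0 hn]]]; first by exists 1; split=> // t; lia.
exists (n * Z.of_nat M.+1); split=> [|t ht]; first by lia.
case: (Z.eq_dec t (Z.of_nat M.+1)) => [->|tM]; first exact: Z.divide_factor_r.
by apply: Z.divide_mul_l; apply: hn; lia.
Qed.

Section ClassGroup.
Variable m : Z.
Hypothesis sf : squarefree m.
Hypothesis m4 : m mod 4 = 2 \/ m mod 4 = 3.
Local Notation D := (4 * m).
Local Notation "x *q y" := (qmul D x y) (at level 40, left associativity).
Local Notation "x +q y" := (qadd x y) (at level 50, left associativity).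
Local Notation N := (qnorm m).
Local Notation "I ** J" := (iprod D I J) (at level 40, left associativity).
Local Notation "I ~~~ J" := (same_class D I J) (at level 70).
Local Notation nz := (nonzero_ideal D).
Add Ring qelt_ring_D : (qelt_ring D).
Implicit Types (I J K : qelt -> Prop) (x y a b : qelt).

Let nzi I : nz I -> is_ideal D I := @nonzero_ideal_ideal m I.
Let mul_nz I J : nz I -> nz J -> nz (I ** J) := nonzero_ideal_mul m sf m4 I J.
Let pow_nz I n : nz I -> nz (ipow D I n) := nonzero_pow m sf m4 I n.
Let bar_nz I : nz I -> nz (fun x => I (qbar m x)) := nonzero_bar m I.
Let sc_trans I J K : I ~~~ J -> J ~~~ K -> I ~~~ K := same_class_trans m sf m4 I J K.
Let sc_mul I I' J J' : I ~~~ I' -> J ~~~ J' -> (I ** J) ~~~ (I' ** J') := same_class_mul m sf m4 I I' J J'.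
Let sc_refl I : I ~~~ I := same_class_refl m I.
Let sc_sym I J : I ~~~ J -> J ~~~ I := same_class_sym m I J.

(** Let [y] have least norm in [I]. The remainder of [t * x] by [y] lies in [I] and is smaller, so
    it is 0; hence [y] divides [n * x] for all [x] in [I], and [(n / y) I] is an integral ideal that
    contains [n]. *)
Lemma common_modulus : exists n : nat, (0 < n)%N /\ forall I, nz I ->
  exists J, nz J /\ J (qint (Z.of_nat n)) /\ I ~~~ J.
Proof.
have [M [M0 hM]] := small_multiple_bound m sf m4.
have [n [n0 hn]] := common_multiple M.
exists (Z.to_nat n); split; first by apply/ltP; lia.
rewrite Z2Nat.id; last by lia.
move=> I [hI [y1 [hy1 y10]]].
have [k0 [nm0 [[y [hy [y0 e0]]] ymin]]] : exists k, 0 < k /\ (exists y, I y /\ y <> qzero /\ Z.abs (N y) = k) /\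
    forall j, 0 < j -> (exists y, I y /\ y <> qzero /\ Z.abs (N y) = j) -> k <= j.
  apply: least_pos; exists (Z.abs (N y1)); split; last by exists y1.
  suff : N y1 <> 0 by lia.
  by move=> /(qnorm_eq0 m sf m4).
subst k0.
have hdiv x : I x -> exists j, qint n *q x = y *q j.
  move=> hx; have [t [ht [z hz]]] := hM x y y0.
  have [t' nt] := hn t ht.
  have e : qsub (qint t *q x) (z *q y) = qzero.
    apply: NNPP => ne; suff : Z.abs (N y) <= Z.abs (N (qsub (qint t *q x) (z *q y))) by lia.
    case: (hI) => _ [_ mu]; apply: ymin.
      suff : N (qsub (qint t *q x) (z *q y)) <> 0 by lia.
      by move=> /(qnorm_eq0 m sf m4).
    exists (qsub (qint t *q x) (z *q y)); split; last by split.
    by apply: (ideal_sub D) => //; apply: mu.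
  exists (qint t' *q z); rewrite nt (qint_mul m).
  have -> : qint t' *q qint t *q x = qint t' *q (qsub (qint t *q x) (z *q y) +q z *q y) by ring.
  by rewrite e; ring.
pose J j := exists2 x, I x & qint n *q x = y *q j.
have hJ : is_ideal D J.
  case: (hI) => I0 [ad mu]; split; first by exists qzero => //; ring.
  split=> [j j' [x hx e] [x' hx' e']|r j [x hx e]].
    exists (x +q x'); first exact: ad.
    have -> : qint n *q (x +q x') = qint n *q x +q qint n *q x' by ring.
    by rewrite e e'; ring.
  exists (r *q x); first exact: mu.
  have -> : qint n *q (r *q x) = r *q (qint n *q x) by ring.
  by rewrite e; ring.
have Jn : J (qint n) by exists y => //; ring.
exists J; split; first by split=> //; exists (qint n); split=> //; apply: qint_neq0; lia.
split=> //; exists (qint n), y; split; first by apply: qint_neq0; lia.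
split=> // x; rewrite !iprod_prin //; split=> [[z hz ->]|[j [z hz e] ->]].
  by have [j hj] := hdiv z hz; exists j => //; exists z.
by exists z.
Qed.

Definition nmod : nat := proj1_sig (cid common_modulus).

Lemma nmodP : (0 < nmod)%N /\ forall I, nz I ->
  exists J, nz J /\ J (qint (Z.of_nat nmod)) /\ I ~~~ J.
Proof. exact: (proj2_sig (cid common_modulus)). Qed.

(** An ideal containing [nmod] is known from its residues modulo [nmod], so these indicator
    functions can name the classes; finiteness of the class group follows. *)
Definition residues : finType := {ffun 'I_nmod * 'I_nmod -> bool}.

Definition reduction J : residues :=
  [ffun p => `[< J (Z.of_nat (val p.1), Z.of_nat (val p.2)) >]].

Lemma reduction_inj J J' : is_ideal D J -> is_ideal D J' ->
  J (qint (Z.of_nat nmod)) -> J' (qint (Z.of_nat nmod)) -> reduction J = reduction J' -> J = J'.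
Proof.
set n := Z.of_nat nmod.
have n0 : 0 < n by have [/ltP] := nmodP; rewrite /n; lia.
have red K : is_ideal D K -> K (qint n) -> forall x, K x <-> K (fst x mod n, snd x mod n).
  move=> hK Kn x; case: (hK) => _ [ad mu].
  have Kq : K ((fst x / n, snd x / n) *q qint n) by exact: mu.
  have e : x = (fst x mod n, snd x mod n) +q (fst x / n, snd x / n) *q qint n.
    by case: x Kq => u v _; rewrite /qadd /qmul /qint; cbn [fst snd]; congr pair; rewrite Z.mod_eq; lia.
  split=> h; last by rewrite e; exact: ad.
  have sol r s : x = r +q s -> r = qsub x s by move=> ->; ring.
  rewrite (sol _ _ e); exact: (ideal_sub D).
move=> hJ hJ' Jn J'n /ffunP e; apply: set_ext => x; rewrite (red J) // (red J') //.
have b1 := Z.mod_pos_bound (fst x) n n0; have b2 := Z.mod_pos_bound (snd x) n n0.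
have l1 : (Z.to_nat (fst x mod n)%Z < nmod)%N by apply/ltP; rewrite /n in b1 *; lia.
have l2 : (Z.to_nat (snd x mod n)%Z < nmod)%N by apply/ltP; rewrite /n in b2 *; lia.
have := e (Ordinal l1, Ordinal l2); rewrite !ffunE /= !Z2Nat.id; try lia.
by move=> ee; split=> /asboolP; [rewrite ee|rewrite -ee] => /asboolP.
Qed.

(** The predicate under [epsilon] depends on the class of [I] only, so equivalent ideals receive the
    same representative. *)
Definition representative I : qelt -> Prop :=
  epsilon (inhabits unit_ideal)
    (fun J => nz J /\ J (qint (Z.of_nat nmod)) /\ I ~~~ J).

Definition cls I : residues := reduction (representative I).

Lemma representativeP I : nz I ->
  nz (representative I) /\ representative I (qint (Z.of_nat nmod)) /\ I ~~~ representative I.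
Proof. by move=> hI; have [_ h] := nmodP; exact: (epsilon_spec (inhabits unit_ideal) _ (h I hI)). Qed.

Lemma clsP I J : nz I -> nz J -> cls I = cls J <-> I ~~~ J.
Proof.
move=> hI hJ; have [h1 [h2 h3]] := representativeP I hI; have [k1 [k2 k3]] := representativeP J hJ.
split=> [e|h].
  have r : representative I = representative J by apply: reduction_inj => //; exact: nzi.
  by apply: (sc_trans _ _ _ h3); rewrite r; exact: sc_sym.
rewrite /cls; congr reduction; rewrite /representative; congr epsilon.
apply: set_ext => K; split=> -[a [b c]]; do 2 split=> //; apply: sc_trans c => //.
exact: sc_sym.
Qed.

Definition cube_classes : {set residues} :=
  [set f | `[< exists K, nz K /\ cls (ipow D K 3) = f >]].
Definition torsion_classes : {set residues} :=
  [set f | `[< exists K, nz K /\ ipow D K 3 ~~~ unit_ideal /\ cls K = f >]].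
Definition all_classes : {set residues} := [set f | `[< exists K, nz K /\ cls K = f >]].

(** Multiply a cube root of [f] by a torsion ideal of class [g]. The cube of the product recovers
    [f], and cancellation then recovers [g]. *)
Lemma card_cube_torsion : (#|cube_classes| * #|torsion_classes| <= #|all_classes|)%N.
Proof.
have [rt hrt] : exists rt : residues -> (qelt -> Prop), forall f, f \in cube_classes ->
    nz (rt f) /\ cls (ipow D (rt f) 3) = f.
  apply: (skolem _ _ (fun f K => f \in cube_classes -> nz K /\ cls (ipow D K 3) = f)) => f.
  case: (boolP (f \in cube_classes)) => [|_]; last by exists unit_ideal.
  by rewrite inE => /asboolP [K hK]; exists K.
have [tr htr] : exists tr : residues -> (qelt -> Prop), forall f, f \in torsion_classes ->
    nz (tr f) /\ ipow D (tr f) 3 ~~~ unit_ideal /\ cls (tr f) = f.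
  apply: (skolem _ _ (fun f K => f \in torsion_classes -> nz K /\ ipow D K 3 ~~~ unit_ideal /\ cls K = f)) => f.
  case: (boolP (f \in torsion_classes)) => [|_]; last by exists unit_ideal.
  by rewrite inE => /asboolP [K hK]; exists K.
pose h (p : residues * residues) := cls (rt p.1 ** tr p.2).
rewrite -cardsX -(card_in_imset (f := h)).
  apply/subset_leq_card/subsetP => _ /imsetP [[f g] /setXP [hf hg] ->]; rewrite inE; apply/asboolP.
  by exists (rt f ** tr g); split=> //; apply: mul_nz; [case: (hrt f hf)|case: (htr g hg)].
move=> [f g] [f' g'] /setXP [/hrt [r1 r2] /htr [t1 [t2 t3]]] /setXP [/hrt [r1' r2'] /htr [t1' [t2' t3']]].
rewrite /h /= => /clsP h1; have {h1} h1 := h1 (mul_nz _ _ r1 t1) (mul_nz _ _ r1' t1').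
have cb K L : nz K -> ipow D L 3 ~~~ unit_ideal -> ipow D K 3 ~~~ ipow D (K ** L) 3.
  move=> hK hL; rewrite ipow_iprod iprodC -{1}(iprod1 D (ipow D K 3)); last by apply/nzi/pow_nz.
  by apply: sc_mul => //; exact: sc_sym.
have ef : f = f'.
  rewrite -r2 -r2'; apply/clsP; try exact: pow_nz.
  apply: (sc_trans _ _ _ (cb _ _ r1 t2)).
  apply: (sc_trans _ _ _ (same_class_pow m sf m4 _ _ 3 h1)); apply: sc_sym; exact: cb.
rewrite -ef in r1' r2' h1 *; congr pair; rewrite -t3 -t3'; apply/clsP => //.
exact: (same_class_cancel m sf m4 (rt f)).
Qed.

(** The exponents [- e] modulo 3, which invert a monomial up to a cube. *)
Fixpoint complement (es : list nat) : list nat :=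
  match es with nil => nil | e :: es' => (match e with 0 => 0 | 1 => 2 | _ => 1 end)%N :: complement es' end.

Lemma monomial_nz Is es : Forall nz Is -> nz (ideal_monomial D Is es).
Proof.
elim: Is es => [|I Is IH] [|e es] /= h; try exact: nonzero_unit.
by move/Forall_cons_iff: h => [h1 h2]; apply: mul_nz; [exact: pow_nz|exact: IH].
Qed.

Lemma monomial_complement Is es : Forall nz Is -> Forall (fun e => (e < 3)%coq_nat) es ->
  exists K, nz K /\ ideal_monomial D Is es ** ideal_monomial D Is (complement es) = ipow D K 3.
Proof.
elim: Is es => [|I Is IH] [|e es] /= hI he;
  try by exists unit_ideal; split; [exact: nonzero_unit|rewrite ipow_unit iprod1].
move/Forall_cons_iff: hI => [h1 h2]; move/Forall_cons_iff: he => [e1 e2].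
have [K [hK eK]] := IH es h2 e2.
rewrite iprodACA eK -ipow_add.
case: e e1 => [|[|[|e]]] e1; last by lia.
- by exists K; split=> //; rewrite iprod1 //; exact: ipow_ideal.
- by exists (I ** K); split; [exact: mul_nz|rewrite ipow_iprod].
- by exists (I ** K); split; [exact: mul_nz|rewrite ipow_iprod].
Qed.

Lemma complement_lt es : Forall (fun e => (e < 3)%coq_nat) (complement es).
Proof.
elim: es => [|e es IH] /=; constructor=> //; case: e => [|[|e]] /=; lia.
Qed.

Lemma complement_length es : length (complement es) = length es.
Proof. by elim: es => [//|e es IH] /=; rewrite IH. Qed.

(** The classes are chosen greedily: [j] of them together with the cubes span at most
    [3 ^ j * #|cube_classes|] classes, fewer than there are in all as long as [j < r]. *)
Lemma rk3_of_torsion (r : nat) : (3 ^ r <= #|torsion_classes|)%N -> rk3_cl_ge D r.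
Proof.
move=> hr.
suff h j : (j <= r)%N -> rk3_cl_ge D j by exact: h.
elim: j => [_|j IH hj].
  by exists nil; do 2 split=> //; case=> // _ _ /Exists_nil.
have [Is [lIs [nzIs hIs]]] := IH (ltnW hj).
have [rt hrt] : exists rt : residues -> (qelt -> Prop), forall f, f \in cube_classes ->
    nz (rt f) /\ cls (ipow D (rt f) 3) = f.
  apply: (skolem _ _ (fun f K => f \in cube_classes -> nz K /\ cls (ipow D K 3) = f)) => f.
  case: (boolP (f \in cube_classes)) => [|_]; last by exists unit_ideal.
  by rewrite inE => /asboolP [K hK]; exists K.
pose g (p : j.-tuple 'I_3 * residues) :=
  cls (ideal_monomial D Is (map (@nat_of_ord 3) p.1) ** ipow D (rt p.2) 3).
pose Bad := g @: setX [set: j.-tuple 'I_3] cube_classes.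
have c0 : (0 < #|cube_classes|)%N.
  apply/card_gt0P; exists (cls (ipow D unit_ideal 3)); rewrite inE; apply/asboolP.
  by exists unit_ideal; split=> //; exact: nonzero_unit.
have lt : (#|Bad| < #|all_classes|)%N.
  apply: leq_ltn_trans (leq_imset_card _ _) _; rewrite cardsX cardsT card_tuple card_ord.
  apply: leq_trans card_cube_torsion; rewrite mulnC ltn_pmul2l //.
  by apply: leq_trans hr; rewrite ltn_exp2l.
have [f] : exists2 f, f \in all_classes & f \notin Bad.
  apply/subsetPn; apply/negP => /subset_leq_card; rewrite leqNgt lt //.
rewrite inE => /asboolP [I [hI <-]] nb.
have nbad es K : length es = j -> Forall (fun e => (e < 3)%coq_nat) es -> nz K ->
    ~ I ~~~ (ideal_monomial D Is es ** ipow D K 3).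
  move=> les ltes hK h; move/negP: nb; apply.
  have sz : size [seq inord e : 'I_3 | e <- es] == j by rewrite size_map; apply/eqP.
  have hc : cls (ipow D K 3) \in cube_classes by rewrite inE; apply/asboolP; exists K.
  apply/imsetP; exists (Tuple sz, cls (ipow D K 3)); first by apply/setXP; rewrite inE.
  have [r1 /clsP r2] := hrt _ hc.
  have {}r2 := r2 (pow_nz _ 3%N r1) (pow_nz _ 3%N hK).
  rewrite /g /= -map_comp (_ : [seq _ | i <- es] = es); last first.
    elim: es ltes {les h sz} => [//|e es IHe] /Forall_cons_iff [e3 h] /=.
    by rewrite IHe // inordK //; apply/ltP.
  apply/clsP => //; first by apply: mul_nz; [exact: monomial_nz|exact: pow_nz].
  by apply: (sc_trans _ _ _ h); apply: sc_mul => //; exact: sc_sym.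
exists (I :: Is); split; first by rewrite /= lIs.
split; first by constructor.
case=> [|e es] //= [les] /Forall_cons_iff [e3 ltes] ex.
have mI := monomial_nz Is es nzIs.
case: e e3 ex => [|[|[|e]]] e3 ex; last by lia.
- rewrite iprod1; last exact: nzi.
  by apply: hIs => //; inversion ex.
(* Exponent 1: [I] would be the complementary monomial times the cube of [J / K], with the conjugate
   of [K] in place of its inverse. *)
- move=> [J [hJ h]].
  have [K [hK eK]] := monomial_complement Is es nzIs ltes.
  have := nbad (complement es) (J ** (fun x => K (qbar m x))).
  rewrite complement_length; move/(_ les (complement_lt es) (mul_nz _ _ hJ (bar_nz _ hK))); apply.
  apply: (same_class_cancel m sf m4 (ipow D K 3)) => //; first exact: pow_nz.
    by apply: mul_nz; [exact: monomial_nz|apply/pow_nz/mul_nz => //; exact: bar_nz].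
  have -> : ipow D K 3 ** (ideal_monomial D Is (complement es) ** ipow D (J ** (fun x => K (qbar m x))) 3)
     = ideal_monomial D Is (complement es) ** ipow D J 3 ** ipow D (K ** (fun x => K (qbar m x))) 3.
    by rewrite !ipow_iprod iprodCA (iprodCA D (ipow D K 3)) -!iprodA.
  have -> : ipow D K 3 ** I = ideal_monomial D Is (complement es) ** (ipow D I 1 ** ideal_monomial D Is es) ** unit_ideal.
    rewrite (iprodC D _ unit_ideal) iprod1; last exact: iprod_ideal.
    rewrite ipow1; last exact: nzi.
    by rewrite -eK -iprodA iprodCA (iprodC D I).
  apply: sc_mul; first exact: sc_mul.
  apply: sc_sym; rewrite -(ipow_unit D 3).
  by apply: (same_class_pow m sf m4); exact: (same_class_inv m sf m4).
(* Exponent 2: [I = I^3 / I^2] would be the monomial times the cube of [I / J]. *)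
- move=> [J [hJ h]].
  have := nbad es (I ** (fun x => J (qbar m x))) les ltes (mul_nz _ _ hI (bar_nz _ hJ)); apply.
  apply: (same_class_cancel m sf m4 (ipow D J 3)) => //; first exact: pow_nz.
    by apply: mul_nz => //; apply/pow_nz/mul_nz => //; exact: bar_nz.
  have -> : ipow D J 3 ** (ideal_monomial D Is es ** ipow D (I ** (fun x => J (qbar m x))) 3)
     = I ** (ipow D I 2 ** ideal_monomial D Is es) ** ipow D (J ** (fun x => J (qbar m x))) 3.
    rewrite !ipow_iprod (iprodA D I) -[I ** ipow D I 2]/(ipow D I 3) iprodCA.
    by rewrite (iprodCA D (ipow D J 3)) iprodCA iprodA.
  have -> : ipow D J 3 ** I = I ** ipow D J 3 ** unit_ideal.
    by rewrite (iprodC D _ unit_ideal) iprod1 ?(iprodC D I) //; exact: iprod_ideal.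
  apply: sc_mul; first by apply: sc_mul => //; exact: sc_sym.
  apply: sc_sym; rewrite -(ipow_unit D 3).
  by apply: (same_class_pow m sf m4); exact: (same_class_inv m sf m4).
Qed.

End ClassGroup.

End Classes.

(** * Units modulo cubes *)

Local Arguments Z.mul : simpl never.
Local Arguments Z.add : simpl never.
Local Arguments qmul : simpl never.

Lemma list_argmin (T : Type) (P : T -> Prop) (f : T -> R) (l : list T) :
  (exists x, In x l /\ P x) ->
  exists x, P x /\ forall y, In y l -> P y -> (f x <= f y)%R.
Proof.
elim: l => [[x []] //|a l IH] [x0 [hx0 Px0]].
case: (classic (exists x, In x l /\ P x)) => [/IH [x [Px hx]]|none].
  case: (classic (P a)) => [Pa|nPa]; last first.
    by exists x; split=> // y [<- //|]; apply: hx.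
  case: (Rle_lt_dec (f a) (f x)) => h.
    exists a; split=> // y [<- _|hy Py]; first by lra.
    by have := hx y hy Py; lra.
  exists x; split=> // y [<- _|]; first by lra.
  exact: hx.
exists x0; split=> // y hy Py.
have ea z : In z (a :: l) -> P z -> z = a by move=> [<- //|hz Pz]; case: none; exists z.
by rewrite (ea y) // (ea x0) //; lra.
Qed.

Definition zbox (K : Z) : list (Z * Z) :=
  let l := map (fun i => Z.of_nat i - K) (List.seq 0 (Z.to_nat (2 * K + 1))) in list_prod l l.

Lemma in_zbox K a b : Z.abs a <= K -> Z.abs b <= K -> In (a, b) (zbox K).
Proof.
move=> ha hb; apply/in_prod_iff; split; apply/in_map_iff.
  by exists (Z.to_nat (a + K)); split; [lia|apply/in_seq; lia].
by exists (Z.to_nat (b + K)); split; [lia|apply/in_seq; lia].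
Qed.

Section Units.
Variable m : Z.
Hypothesis sf : squarefree m.
Hypothesis m4 : m mod 4 = 2 \/ m mod 4 = 3.
Local Notation D := (4 * m).
Local Notation "x *q y" := (qmul D x y) (at level 40, left associativity).
Local Notation N := (qnorm m).
Local Notation bar := (qbar m).
Local Notation cube x := (x *q x *q x).
Add Ring qelt_ring_D : (qelt_ring D).
Implicit Types (x y e : qelt).

Lemma qnorm_opp x : N (qopp x) = N x.
Proof. by rewrite /qnorm qre_opp /qopp; cbn [snd]; ring. Qed.

Definition qunit e := Z.abs (N e) = 1.

Lemma qunit_one : qunit qone.
Proof. by rewrite /qunit -[qone]/(qint 1) /qnorm qre_int qim_int !Z.mul_0_r. Qed.

Lemma qunit_mul e e' : qunit e -> qunit e' -> qunit (e *q e').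
Proof. by rewrite /qunit qnorm_mul Z.abs_mul => -> ->. Qed.

Lemma qunit_mull e e' : qunit (e *q e') -> qunit e.
Proof.
rewrite /qunit qnorm_mul Z.abs_mul => h; exact: (proj1 (Z.eq_mul_1_nonneg _ _ (Z.abs_nonneg _) h)).
Qed.

Lemma qunit_inv e : qunit e -> exists i, e *q i = qone /\ qunit i.
Proof.
move=> he; have [h|h] : N e = 1 \/ N e = -1 by move: he; rewrite /qunit; lia.
  by exists (bar e); rewrite mul_bar h /qunit qnorm_bar.
exists (qopp (bar e)); split; last by rewrite /qunit qnorm_opp qnorm_bar.
by rewrite (_ : _ *q _ = qopp (e *q bar e)); [rewrite mul_bar h|ring].
Qed.

Lemma qunit_opp e : qunit e -> qunit (qopp e).
Proof. by rewrite /qunit qnorm_opp. Qed.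

(** The order of a unit divides 4 and so is prime to 3. The field of cube roots of unity is excluded
    because [-3 mod 4 = 1]. *)
Lemma imaginary_unit_cube e : m < 0 -> qunit e -> exists i, e = cube i /\ qunit i.
Proof.
move=> m0; rewrite /qunit => h.
have hN : qre m e * qre m e + (- m) * (snd e * snd e) = 1.
  by move: h; rewrite /qnorm; nia.
have [[r1 i1]|[m1 [r1 i1]]] : (qre m e * qre m e = 1 /\ snd e = 0) \/ (m = -1 /\ qre m e = 0 /\ snd e * snd e = 1).
- by case: (Z.eq_dec (snd e) 0) => h0; [left; nia|right; nia].
- exists e; split; last by rewrite h.
  apply: (qeltE m); rewrite ?(qre_mul, qim_mul) i1; last by ring.
  by rewrite [RHS](_ : _ = qre m e * qre m e * qre m e); [rewrite r1; ring|ring].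
- exists (bar e); rewrite qnorm_bar; split=> //.
  apply: (qeltE m); rewrite ?(qre_mul, qim_mul, qre_bar, qim_bar) r1; first by ring.
  by rewrite m1 [RHS](_ : _ = snd e * snd e * snd e); [rewrite i1; ring|ring].
Qed.

Section Real.
Hypothesis mpos : 0 < m.
Local Notation sm := (sqrt (IZR m)).
Definition qval x : R := (IZR (qre m x) + IZR (snd x) * sm)%R.

Let sm2 : (sm * sm = IZR m)%R.
Proof. by apply: sqrt_sqrt; apply: (IZR_le 0); lia. Qed.

Let sm1 : (1 < sm)%R.
Proof. rewrite -sqrt_1; apply: sqrt_lt_1; [lra|apply: (IZR_le 0); lia|]. have := m_neq1 m m4 => h; apply: (IZR_lt 1); lia. Qed.

Lemma qval_mul x y : qval (x *q y) = (qval x * qval y)%R.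
Proof.
rewrite /qval qre_mul qim_mul !plus_IZR !mult_IZR !plus_IZR !mult_IZR.
by move: sm2; move: sm => s <-; ring.
Qed.

Lemma qval_bar x : (qval x * qval (bar x) = IZR (N x))%R.
Proof.
by rewrite -qval_mul mul_bar /qval qre_int qim_int; ring.
Qed.

Lemma qval_one : qval qone = 1%R.
Proof. by rewrite /qval /qre /qone; cbn [fst snd]; rewrite Z.mul_0_r Z.add_0_r; lra. Qed.

Lemma qval_opp x : qval (qopp x) = (- qval x)%R.
Proof. rewrite /qval qre_opp /qopp; cbn [snd]; rewrite !opp_IZR; ring. Qed.

Lemma qval_bar_unit e : qunit e -> (Rabs (qval e) * Rabs (qval (bar e)) = 1)%R.
Proof. by move=> he; rewrite -Rabs_mult qval_bar Rabs_Zabs he. Qed.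

Lemma qval_unit_neq0 e : qunit e -> qval e <> 0%R.
Proof. by move=> he h; have := qval_bar_unit e he; rewrite h Rabs_R0; lra. Qed.

Lemma qval_inj x y : qval x = qval y -> x = y.
Proof.
move=> h; have h0 : qval (qsub x y) = 0%R.
  rewrite /qsub /qval qre_add qim_add /qopp plus_IZR plus_IZR qre_opp; cbn [snd]; rewrite !opp_IZR.
  by move: h; rewrite /qval; lra.
have : IZR (N (qsub x y)) = 0%R by rewrite -qval_bar h0; ring.
move/eq_IZR_R0/(qnorm_eq0 m sf m4) => h1.
by rewrite (_ : x = qadd (qsub x y) y); [rewrite h1; ring|ring].
Qed.

(** The conjugate of such a unit is less than 1 in absolute value, so the sum and the difference of
    the two bound both coordinates. *)
Lemma unit_in_zbox e B : qunit e -> (1 < qval e <= B)%R -> In e (map (fun p => qof m p.1 p.2) (zbox (up (B + 1)))).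
Proof.
move=> he [h1 hB]; apply/in_map_iff; exists (qre m e, snd e); split.
  by apply: (qeltE m); rewrite ?qre_of ?qim_of.
have hb := qval_bar_unit e he; rewrite (Rabs_pos_eq (qval e)) in hb; last lra.
have hb1 : (Rabs (qval (bar e)) < 1)%R.
  by have := Rabs_pos (qval (bar e)); nra.
have [u1 u2] := archimed (B + 1).
have e1 : (2 * IZR (qre m e) = qval e + qval (bar e))%R by rewrite /qval qre_bar qim_bar opp_IZR; ring.
have e2 : (2 * (IZR (snd e) * sm) = qval e - qval (bar e))%R by rewrite /qval qre_bar qim_bar opp_IZR; ring.
have [hl hr] := Rabs_def2 _ _ hb1.
have box a : (Rabs (IZR a) <= B + 1)%R -> Z.abs a <= up (B + 1).
  by rewrite Rabs_Zabs => h; apply: le_IZR; lra.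
apply: in_zbox; apply: box; apply: Rabs_le; first by lra.
have : (Rabs (IZR (snd e)) * sm < B + 1)%R.
  have -> : (Rabs (IZR (snd e)) * sm = Rabs (IZR (snd e) * sm))%R by rewrite Rabs_mult (Rabs_pos_eq sm) //; lra.
  by apply: Rabs_def1; lra.
by have := Rabs_pos (IZR (snd e)); have := Rle_abs (IZR (snd e)); have := Rle_abs (- IZR (snd e)); rewrite Rabs_Ropp; nra.
Qed.

(** A least unit above 1 exists since only finitely many lie below a given one; repeated division by
    it brings any unit into the interval from 1 to [h]. *)
Lemma fundamental_unit : exists h, qunit h /\ forall e, qunit e -> (1 <= qval e)%R ->
  exists n : nat, e = Nat.iter n (qmul D h) qone.
Proof.
case: (classic (exists e, qunit e /\ (1 < qval e)%R)) => [[e0 [u0 v0]]|none]; last first.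
  (* If no unit exceeds 1, the unit 1 itself serves as generator. *)
  exists qone; split=> [|e ue ve]; first exact: qunit_one.
  exists 0%nat => /=; apply: qval_inj; rewrite qval_one.
  by apply: Rle_antisym => //; apply: Rnot_lt_le => h; apply: none; exists e.
have [h [[uh vh] hmin]] := list_argmin _ (fun e => qunit e /\ (1 < qval e)%R) qval
  (map (fun p => qof m p.1 p.2) (zbox (up (qval e0 + 1))))
  (ex_intro _ e0 (conj (unit_in_zbox e0 _ u0 (conj v0 (Rle_refl _))) (conj u0 v0))).
have {}hmin e : qunit e -> (1 < qval e)%R -> (qval h <= qval e)%R.
  move=> ue ve; case: (Rle_lt_dec (qval e) (qval e0)) => hle.
    by apply: hmin => //; exact: unit_in_zbox.
  have := hmin e0 (unit_in_zbox e0 _ u0 (conj v0 (Rle_refl _))) (conj u0 v0); lra.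
exists h; split=> //.
have [i [hi ui]] := qunit_inv h uh.
have vi : (qval h * qval i = 1)%R by rewrite -qval_mul hi qval_one.
have main (n : nat) : forall e, qunit e -> (1 <= qval e < qval h ^ n)%R ->
    exists n : nat, e = Nat.iter n (qmul D h) qone.
  elim: n => [e _ /=|n IH e ue [v1 v2]]; first by lra.
  case: (Rle_lt_dec (qval e) 1) => h1.
    by exists 0%nat => /=; apply: qval_inj; rewrite qval_one; lra.
  have hm := hmin e ue h1.
  have [] := IH (i *q e); first exact: qunit_mul.
    rewrite qval_mul; have i0 : (0 < qval i)%R by nra.
    split; first by rewrite -vi Rmult_comm; apply: Rmult_le_compat_l; lra.
    apply: (Rmult_lt_reg_l (qval h)); first by lra.
    by rewrite -Rmult_assoc vi Rmult_1_l.
  move=> k hk; exists (S k) => /=; rewrite -hk.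
  by rewrite (_ : h *q (i *q e) = h *q i *q e); [rewrite hi; ring|ring].
move=> e ue ve; have [n hn] := Pow_x_infinity (qval h) (Rlt_le_trans _ _ _ vh (Rle_abs _)) (qval e + 1).
apply: (main n) => //; split=> //; have := hn n (le_n n).
rewrite Rabs_pos_eq; first by lra.
by apply: pow_le; lra.
Qed.

(** A unit is a power of [h] up to sign, and -1 is a cube. Negative powers go through the inverse
    [g] of [h], as [g = h^2 g^3] and [g^2 = h g^3]. *)
Lemma real_unit_mod_cubes : exists h, qunit h /\ forall e, qunit e ->
  exists i d, qunit d /\ (i < 3)%nat /\ e = Nat.iter i (qmul D h) qone *q cube d.
Proof.
have [h [uh hh]] := fundamental_unit; exists h; split=> //.
have [g [hg ug]] := qunit_inv h uh.
have pw x n k : Nat.iter (n + k) (qmul D x) qone = Nat.iter n (qmul D x) qone *q Nat.iter k (qmul D x) qone.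
  by elim: n => [|n IH] /=; [ring|rewrite IH; ring].
have upw x n : qunit x -> qunit (Nat.iter n (qmul D x) qone).
  by move=> ux; elim: n => [|n IH] /=; [exact: qunit_one|exact: qunit_mul].
have pw3 x n : exists i d, qunit x -> qunit d /\ (i < 3)%nat /\
    Nat.iter n (qmul D x) qone = Nat.iter i (qmul D x) qone *q cube d.
  exists (Nat.modulo n 3), (Nat.iter (Nat.div n 3) (qmul D x) qone) => ux; split; first exact: upw.
  split; first by apply: Nat.mod_upper_bound.
  rewrite {1}(Nat.div_mod_eq n 3) Nat.add_comm pw; congr qmul.
  by rewrite /= !pw /=; ring.
have pos e : qunit e -> (0 < qval e)%R -> exists i d, qunit d /\ (i < 3)%nat /\ e = Nat.iter i (qmul D h) qone *q cube d.
  move=> ue ve; case: (Rle_lt_dec 1 (qval e)) => h1.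
    have [n ->] := hh e ue h1; have [i [d hd]] := pw3 h n; exists i, d; exact: hd.
  have [f [hf uf]] := qunit_inv e ue.
  have vf : (qval e * qval f = 1)%R by rewrite -qval_mul hf qval_one.
  have [|n hn] := hh f uf; first by nra.
  have [i [d hd]] := pw3 g n; have [ud [i3 eg]] := hd ug.
  have eE : e = Nat.iter n (qmul D g) qone.
    have : f *q Nat.iter n (qmul D g) qone = qone.
      rewrite hn; elim: n {hn eg hd} => [/=|n IH] /=; first by ring.
      rewrite -[RHS]IH.
      by rewrite [LHS](_ : _ = (h *q g) *q (Nat.iter n (qmul D h) qone *q Nat.iter n (qmul D g) qone)); [rewrite hg; ring|ring].
    move: (Nat.iter n _ _) => w h2; transitivity (e *q (f *q w)); first by rewrite h2; ring.
    transitivity (e *q f *q w); first by ring.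
    by rewrite hf; ring.
  rewrite eE eg; case: i i3 {eg hd} => [|[|[|i]]] i3 /=; last by lia.
  - by exists 0%nat, d; split=> //; split=> //; lia.
  - exists 2%nat, (g *q d); split; first exact: qunit_mul.
    split; first by lia.
    rewrite /= [RHS](_ : _ = (h *q g) *q (h *q g) *q (g *q cube d)); last by ring.
    by rewrite hg; ring.
  - exists 1%nat, (g *q d); split; first exact: qunit_mul.
    split; first by lia.
    rewrite /= [RHS](_ : _ = (h *q g) *q (g *q g *q cube d)); last by ring.
    by rewrite hg; ring.
move=> e ue; case: (Rle_lt_dec (qval e) 0) => h0; last exact: pos.
have [|i [d [ud [i3 hd]]]] := pos (qopp e) (qunit_opp e ue).
  by rewrite qval_opp; have := qval_unit_neq0 e ue; lra.
exists i, (qopp d); split; first exact: qunit_opp.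
split=> //; rewrite (_ : e = qopp (qopp e)); last by ring.
by rewrite hd; ring.
Qed.

End Real.

(* The map u separates the classes of units modulo cubes. *)
Definition unit_rank_bound (k : nat) := exists u : qelt -> nat,
  (forall e, qunit e -> (u e < k)%nat) /\
  forall e e', qunit e -> qunit e' -> u e = u e' -> exists d, qunit d /\ e = e' *q cube d.

Lemma unit_rank_imaginary : m < 0 -> unit_rank_bound 1.
Proof.
move=> m0; exists (fun=> 0%nat); split=> [e _|e e' ue ue' _]; first by lia.
have [f [hf uf]] := qunit_inv e' ue'.
have [i [hi ui]] := imaginary_unit_cube (f *q e) m0 (qunit_mul _ _ uf ue).
exists i; split=> //; rewrite -hi (_ : _ *q _ = e' *q f *q e); last by ring.
by rewrite hf; ring.
Qed.

Lemma unit_rank_real : 0 < m -> unit_rank_bound 3.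
Proof.
move=> m0; have [h [uh hh]] := real_unit_mod_cubes m0.
pose P e i := qunit e -> (i < 3)%nat /\ exists d, qunit d /\ e = Nat.iter i (qmul D h) qone *q cube d.
have [u hu] : exists u, forall e, P e (u e).
  apply: (skolem _ _ P) => e; case: (classic (qunit e)) => [ue|nu]; last by exists 0%nat.
  by have [i [d [ud [i3 hd]]]] := hh e ue; exists i => _; split=> //; exists d.
exists u; split=> [e ue|e e' ue ue' eu]; first by case: (hu e ue).
have [_ [d [ud ed]]] := hu e ue; have [_ [d' [ud' ed']]] := hu e' ue'.
have [f [hf uf]] := qunit_inv d' ud'.
exists (f *q d); split; first exact: qunit_mul.
have -> : e' *q cube (f *q d) = Nat.iter (u e') (qmul D h) qone *q (cube (d' *q f) *q cube d).
  by rewrite {1}ed'; ring.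
by rewrite hf {1}ed eu; ring.
Qed.

End Units.

(** * Virtual units *)

Section VirtualUnitRank.
Import all_boot boolp.
Local Open Scope Z_scope.
Local Arguments ipow : simpl never.

Fixpoint qmonomial (D : Z) (xs : list qelt) (es : list nat) : qelt :=
  match xs, es with
  | x :: xs', e :: es' => qmul D (Nat.iter e (qmul D x) qone) (qmonomial D xs' es')
  | _, _ => qone
  end.

Fixpoint weighted_sum (ws : list Z) (es : list nat) : Z :=
  match ws, es with
  | w :: ws', e :: es' => Z.of_nat e * w + weighted_sum ws' es'
  | _, _ => 0
  end.

(* The logarithm c of a cubic residue character of Z[sqrt m], defined on the elements G prime to
   its modulus. *)
Definition cubic_log (m : Z) (G : qelt -> Prop) (c : qelt -> Z) :=
  G qone /\ (forall x y, G (qmul (4 * m) x y) <-> G x /\ G y) /\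
  (forall x y, G x -> G y -> (3 | c (qmul (4 * m) x y) - (c x + c y))).

(** The trace being prime to [n], no prime ideal divides both [x] and its conjugate. Their product
    is [n^3], so each generates the cube of an ideal. *)
Definition virtual_unit (m : Z) (x : qelt) := exists n, qnorm m x = n * n * n /\ rel_prime (2 * qre m x) n.

Section VirtualUnits.
Variable m : Z.
Hypothesis sf : squarefree m.
Hypothesis m4 : m mod 4 = 2 \/ m mod 4 = 3.
Local Notation D := (4 * m).
Local Notation "x *q y" := (qmul D x y) (at level 40, left associativity).
Local Notation "x +q y" := (qadd x y) (at level 50, left associativity).
Local Notation N := (qnorm m).
Local Notation bar := (qbar m).
Local Notation "I ** J" := (iprod D I J) (at level 40, left associativity).
Local Notation "I ~~~ J" := (same_class D I J) (at level 70).
Local Notation nz := (nonzero_ideal D).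
Local Notation cube x := (x *q x *q x).
Add Ring qelt_ring_D : (qelt_ring D).
Implicit Types (I J K : qelt -> Prop) (x y a b : qelt).

Lemma virtual_unit_neq0 x : virtual_unit m x -> x <> qzero.
Proof.
move=> [n [hn rp]] h; move: hn rp; rewrite h.
have -> : qre m qzero = 0 by rewrite /qre /qzero; cbn [fst snd]; ring.
have -> : N qzero = 0 by rewrite /qnorm /qre /qzero; cbn [fst snd]; ring.
move=> hn [_ _ /(_ 2)] []; first by exists 0.
  by exists 0; nia.
by move=> ?; lia.
Qed.

(** The cube root of the ideal [(x)] is [(n, x)]. *)
Lemma virtual_unit_cube_ideal x : virtual_unit m x -> exists J, nz J /\ ipow D J 3 = principal D x.
Proof.
move=> vx; have x0 := virtual_unit_neq0 x vx; have [n [hn rp]] := vx.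
pose J z := exists r s, z = qint n *q r +q x *q s.
have hJ : is_ideal D J.
  split; first by exists qzero, qzero; ring.
  split=> [z z' [r [s ->]] [r' [s' ->]]|t z [r [s ->]]].
    by exists (r +q r'), (s +q s'); ring.
  by exists (t *q r), (t *q s); ring.
have Jn : J (qint n) by exists qone, qzero; ring.
have Jx : J x by exists qzero, qone; ring.
have n3 : cube (qint n) = x *q bar x by rewrite mul_bar hn !(qint_mul m).
exists J; split; first by split=> //; exists x.
have P3 a b c : J a -> J b -> J c -> ipow D J 3 (a *q b *q c).
  move=> ha hb hc; rewrite (_ : _ *q c = a *q (b *q (c *q qone))); last by ring.
  by do 3! apply: iprod_in => //.
have id3 := ipow_ideal D J 3; case: (id3) => z0 [ad mu].
apply: set_ext => z; split; last first.
  move=> [r ->]; rewrite (_ : x *q r = r *q x); last by ring.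
  apply: (mu).
  (* As [x * bar x = n^3], the squared trace times [x] equals [x^3 + 2 n^3 x + n^3 bar x]. Each term
     is a combination of triple products from [J], and so is [n^2 x]. *)
  have [u v huv] : Bezout (2 * qre m x * (2 * qre m x)) (n * n) 1.
    by apply: rel_prime_bezout; apply: rel_prime_sym; apply: rel_prime_mult; apply: rel_prime_sym; apply: rel_prime_mult.
  have tE : qint (2 * qre m x) = x +q bar x by rewrite trace_int.
  have -> : x = qint u *q (cube x +q (qint 2 *q qint n) *q (qint n *q qint n *q x) +q bar x *q cube (qint n))
                +q qint v *q (qint n *q qint n *q x).
    transitivity (qint 1 *q x); first by rewrite -[qint 1]/qone; ring.
    rewrite -huv qint_add (qint_mul m u) (qint_mul m v) !(qint_mul m (2 * qre m x)) (qint_mul m n) tE.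
    transitivity (qint u *q (cube x +q qint 2 *q (x *q (x *q bar x)) +q bar x *q (x *q bar x)) +q qint v *q (qint n *q qint n *q x)).
      by rewrite (_ : qint 2 = qone +q qone) //; ring.
    by rewrite -n3; ring.
  apply: (ad); last by apply: (mu); exact: (P3).
  apply: (mu); apply: (ad); last by apply: (mu); exact: (P3).
  apply: (ad); first exact: (P3).
  by apply: (mu); exact: (P3).
have hp := principal_ideal D x; case: (hp) => p0 [pad pmu].
have mem a : J a -> exists r s, a = qint n *q r +q x *q s by [].
(* Expanded, the product is a multiple of [n^3 = x * bar x] plus a multiple of [x]. *)
have key a b c : J a -> J b -> J c -> principal D x (a *q b *q c).
  move=> [r [s ->]] [r' [s' ->]] [r2 [s2 ->]].
  exists (bar x *q (r *q r' *q r2) +q s *q (qint n *q r' +q x *q s') *q (qint n *q r2 +q x *q s2)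
    +q qint n *q r *q s' *q (qint n *q r2 +q x *q s2) +q qint n *q qint n *q r *q r' *q s2).
  transitivity (cube (qint n) *q (r *q r' *q r2) +q x *q (s *q (qint n *q r' +q x *q s') *q (qint n *q r2 +q x *q s2)
    +q qint n *q r *q s' *q (qint n *q r2 +q x *q s2) +q qint n *q qint n *q r *q r' *q s2)).
    by ring.
  by rewrite n3; ring.
move=> h; apply: h hp _ => a b ha hb.
rewrite (_ : a *q b = b *q a); last by ring.
apply: (hb (fun b => principal D x (b *q a))).
  split; first by rewrite (_ : qzero *q a = qzero) //; ring.
  split=> [y y' h h'|t y h].
    by rewrite (_ : _ *q a = y *q a +q y' *q a); [exact: pad|ring].
  by rewrite (_ : _ *q a = t *q (y *q a)); [exact: pmu|ring].
move=> b1 b2 hb1 hb2.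
rewrite (_ : _ *q a = b2 *q (b1 *q a)); last by ring.
apply: (hb2 (fun b2 => principal D x (b2 *q (b1 *q a)))).
  split; first by rewrite (_ : qzero *q _ = qzero) //; ring.
  split=> [y y' h h'|t y h].
    by rewrite (_ : _ *q (b1 *q a) = y *q (b1 *q a) +q y' *q (b1 *q a)); [exact: pad|ring].
  by rewrite (_ : _ *q (b1 *q a) = t *q (y *q (b1 *q a))); [exact: pmu|ring].
move=> b3 b4 hb3 _; rewrite (_ : _ *q (b1 *q a) = b4 *q (b3 *q b1 *q a)); last by ring.
by apply: (pmu); exact: key.
Qed.

Lemma ipow_monomial xs Js es : Forall2 (fun x J => ipow D J 3 = principal D x) xs Js ->
  ipow D (ideal_monomial D Js es) 3 = principal D (qmonomial D xs es).
Proof.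
move=> h; elim: h es => [|x J xs' Js' hxJ _ IH] [|e es] /=;
  try by rewrite ipow_unit (unit_idealE D).
rewrite ipow_iprod IH -prin_prin; congr iprod.
by rewrite -ipow_prin -hxJ -!ipow_mul Nat.mul_comm.
Qed.

Lemma associated x y : x <> qzero -> principal D x = principal D y ->
  exists e, qunit m e /\ x = e *q y.
Proof.
move=> x0 h.
have [r hr] : principal D y x by rewrite -h; exists qone; ring.
have [s hs] : principal D x y by rewrite h; exists qone; ring.
exists r; split; last by rewrite hr; ring.
apply: (qunit_mull m _ s); rewrite (_ : r *q s = qone); first exact: qunit_one.
apply: (qmulI m sf m4 x) => //; rewrite {2}hr hs; ring.
Qed.

Lemma cubic_log_one G c : cubic_log m G c -> G qone /\ (3 | c qone).
Proof.
move=> [g1 [_ hc]]; split=> //; have := hc qone qone g1 g1.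
rewrite (_ : qone *q qone = qone); last by ring.
by case=> k hk; exists (- k); lia.
Qed.

Lemma cubic_log_iter G c x n : cubic_log m G c -> G x ->
  G (Nat.iter n (qmul D x) qone) /\ (3 | c (Nat.iter n (qmul D x) qone) - Z.of_nat n * c x).
Proof.
move=> hGc gx; have [g1 c1] := cubic_log_one G c hGc; case: hGc => _ [hG hc].
elim: n => [|n [IH1 IH2]] /=; first by split=> //; rewrite Z.sub_0_r.
split; first exact/hG.
have := hc _ _ gx IH1; case: IH2 => k hk [l hl]; exists (k + l); lia.
Qed.

Lemma cubic_log_monomial G c xs es : cubic_log m G c -> Forall G xs ->
  G (qmonomial D xs es) /\ (3 | c (qmonomial D xs es) - weighted_sum (map c xs) es).
Proof.
move=> hGc h; have [g1 c1] := cubic_log_one G c hGc.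
elim: h es => [|x xs' gx _ IH] [|e es] /=; try by split=> //; rewrite Z.sub_0_r.
have [h1 [k hk]] := cubic_log_iter G c x e hGc gx; have [h2 [l hl]] := IH es.
case: hGc => _ [hG hc]; split; first exact/hG.
by have [j hj] := hc _ _ h1 h2; exists (j + k + l); lia.
Qed.

Lemma cubic_log_cube G c x : cubic_log m G c -> G (cube x) -> G x /\ (3 | c (cube x)).
Proof.
move=> [_ [hG hc]] /hG [/[dup] hxx /hG [gx _] _]; split=> //.
by have [k hk] := hc _ _ hxx gx; have [l hl] := hc _ _ gx gx; exists (k + l + c x); lia.
Qed.

(** The [3 ^ s] exponent vectors inject into pairs of a torsion class and a unit class modulo cubes,
    so the number of torsion classes is at least [3 ^ s / k]. *)
Theorem rk3_of_virtual_units (k r s : nat) (xs : list qelt) (ls : list ((qelt -> Prop) * (qelt -> Z))) :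
  unit_rank_bound m k -> (k * 3 ^ r <= 3 ^ s)%N -> length xs = s ->
  Forall (virtual_unit m) xs ->
  Forall (fun l => cubic_log m l.1 l.2 /\ Forall l.1 xs) ls ->
  (forall es es', length es = s -> length es' = s -> Forall (fun e => (e < 3)%coq_nat) es ->
     Forall (fun e => (e < 3)%coq_nat) es' ->
     Forall (fun l => (3 | weighted_sum (map l.2 xs) es - weighted_sum (map l.2 xs) es')) ls -> es = es') ->
  rk3_cl_ge D r.
Proof.
move=> [u [uk hu]] krs lxs vxs hls sep.
have [Js [hJs nJs]] : exists Js, Forall2 (fun x J => ipow D J 3 = principal D x) xs Js /\ Forall nz Js.
  elim: vxs {lxs hls sep} => [|x xs' vx _ [Js [h1 h2]]]; first by exists nil; split.
  have [J [nJ hJ]] := virtual_unit_cube_ideal x vx.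
  by exists (J :: Js); split; constructor.
pose es (t : s.-tuple 'I_3) := map (@nat_of_ord 3) t.
have les t : length (es t) = s.
  by rewrite -[length _]/(size _) size_map size_tuple.
have es3 t : Forall (fun e => (e < 3)%coq_nat) (es t).
  by rewrite /es; elim: (tval t) => [|a l IH] /=; constructor=> //; apply/ltP.
pose mon t := ideal_monomial D Js (es t); pose a t := qmonomial D xs (es t).
have nmon t : nz (mon t) by exact: (monomial_nz m sf m4).
have mon3 t : ipow D (mon t) 3 = principal D (a t) by exact: ipow_monomial.
have a0 t : a t <> qzero.
  have q0 (x : qelt) n : x <> qzero -> Nat.iter n (qmul D x) qone <> qzero.
    by move=> x0; elim: n => [//|n IH] /=; exact: (qmul_neq0 m sf m4).
  rewrite /a; elim: vxs (es t) {lxs hls sep hJs a mon3} => [|x xs' vx _ IH] [|e l] //=.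
  by apply: (qmul_neq0 m sf m4) => //; apply: q0; exact: virtual_unit_neq0.
have tor t : cls m sf m4 (mon t) \in torsion_classes m sf m4.
  rewrite inE; apply/asboolP; exists (mon t); split=> //; split=> //.
  rewrite mon3; apply/same_classE; exists qone, (a t); split=> //; split=> //.
  by rewrite (unit_idealE D) !prin_prin; congr principal; ring.
have [b hb] : exists b : residues m sf m4 -> s.-tuple 'I_3, forall f, (exists t, cls m sf m4 (mon t) = f) ->
    cls m sf m4 (mon (b f)) = f.
  apply: (skolem _ _ (fun f t0 => (exists t, cls m sf m4 (mon t) = f) -> cls m sf m4 (mon t0) = f)) => f.
  case: (pselect (exists t, cls m sf m4 (mon t) = f)) => [[t ht]|none]; first by exists t.
  by exists [tuple of nseq s ord0].
(* [base t] is one chosen exponent vector for the class of [t]. The square of its monomial is an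
   inverse modulo cubes, so vectors of one class are compared through units. *)
pose base t := b (cls m sf m4 (mon t)).
have [e he] : exists e, forall t, qunit m (e t) /\ exists g, a t *q (a (base t) *q a (base t)) = e t *q cube g.
  apply: (skolem _ _ (fun t e => qunit m e /\ exists g, a t *q (a (base t) *q a (base t)) = e *q cube g)) => t.
  have h : mon t ~~~ mon (base t).
    by apply/(clsP m sf m4) => //; rewrite /base hb //; exists t.
  have [||g hg] := same_class_unit m sf m4 (mon t ** ipow D (mon (base t)) 2); first exact: iprod_ideal.
    apply: (same_class_trans m sf m4 _ (ipow D (mon (base t)) 3)).
      by apply: (same_class_mul m sf m4) => //; exact: same_class_refl.
    by move: (tor (base t)); rewrite inE => /asboolP [K [nK [K3 /(clsP m sf m4)]]] hK;
       apply: (same_class_trans m sf m4 _ (ipow D K 3)) => //; apply: (same_class_pow m sf m4);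
       apply: same_class_sym; exact: hK.
  have := congr1 (fun I => ipow D I 3) hg; rewrite /= ipow_iprod ipow_prin mon3.
  rewrite -(ipow_mul D _ 3 2) (ipow_mul D _ 2 3) mon3 ipow_prin /= !prin_prin.
  move/associated => [|f [uf hf]].
    do 2! apply: (qmul_neq0 m sf m4) => //; apply: (qmul_neq0 m sf m4) => //.
  exists f; split=> //; exists g; rewrite (_ : a (base t) *q a (base t) = a (base t) *q (a (base t) *q qone)); last by ring.
  by rewrite hf; ring.
pose h t := (cls m sf m4 (mon t), Ordinal (introT ltP (uk _ (he t).1))).
(* Equal classes give the same base and equal unit classes a relation modulo cubes. The logarithms
   of cubes vanish modulo 3, so all the characters agree at [t] and [t']. *)
have hinj : injective h.
  move=> t t' [ef ei]; have eb : base t = base t' by rewrite /base ef.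
  apply: val_inj; apply: (inj_map (@ord_inj 3)); apply: sep; [exact: les|exact: les|exact: es3|exact: es3|].
  have [ut [g hg]] := he t; have [ut' [g' hg']] := he t'.
  have [d [ud hd]] := hu _ _ ut ut' ei.
  move: hls; apply: Forall_impl => -[G c] /= [hGc gxs].
  have ga z : G (a z) /\ (3 | c (a z) - weighted_sum (map c xs) (es z)) by exact: cubic_log_monomial.
  have [_ [hG hc]] := hGc.
  have rel z z0 f x : qunit m f -> a z *q (a z0 *q a z0) = f *q cube x ->
      G f /\ (3 | c f - (c (a z) + 2 * c (a z0))).
    move=> uf e0; have [gz _] := ga z; have [gz0 _] := ga z0.
    have g2 : G (a z0 *q a z0) by apply/hG.
    have gall : G (f *q cube x) by rewrite -e0; apply/hG.
    have [gf gx] := (hG _ _).1 gall; split=> //.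
    have [_ [k1 hk1]] := cubic_log_cube G c x hGc gx.
    have [k2 hk2] := hc _ _ gf gx; have [k3 hk3] := hc _ _ gz g2; have [k4 hk4] := hc _ _ gz0 gz0.
    by rewrite e0 in hk3; exists (k3 + k4 - k1 - k2); lia.
  have [gf [k1 hk1]] := rel _ _ _ _ ut hg.
  have [gf' [k2 hk2]] := rel _ _ _ _ ut' hg'.
  have gd : G (cube d) by move: gf; rewrite hd => /hG [].
  have [_ [k3 hk3]] := cubic_log_cube G c d hGc gd; have [k4 hk4] := hc _ _ gf' gd.
  have [_ [k5 hk5]] := ga t; have [_ [k6 hk6]] := ga t'.
  rewrite -hd in hk4; rewrite -eb in hk2.
  by exists (k2 - k1 + k4 + k3 - k5 + k6); move: hk5 hk6; rewrite /es; lia.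
have k0 : (0 < k)%N by apply: leq_ltn_trans (introT ltP (uk _ (he [tuple of nseq s ord0]).1)).
apply: (rk3_of_torsion m sf m4); rewrite -(leq_pmul2l k0); apply: (leq_trans krs).
have := card_imset [set: s.-tuple 'I_3] hinj; rewrite cardsT card_tuple card_ord => <-.
rewrite mulnC -[k in (_ * k)%N]card_ord -cardsT -cardsX; apply/subset_leq_card/subsetP.
by move=> _ /imsetP [t _ ->]; apply/setXP; split; [exact: tor|rewrite inE].
Qed.

End VirtualUnits.

End VirtualUnitRank.

(** * Binary forms in a residue class, virtual units from points, cubic residue characters *)

Local Arguments Z.pow : simpl never.
Local Arguments Z.of_nat : simpl never.

Section Points.
Import all_boot boolp.
Local Open Scope Z_scope.

Lemma squarefree_part (u : Z) : u <> 0 -> exists m g, u = m * (g * g) /\ squarefree m /\ g <> 0.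
Proof.
move=> u0; have : forall n, 0 <= n -> forall u, u <> 0 -> Z.abs u <= n ->
    exists m g, u = m * (g * g) /\ squarefree m /\ g <> 0; last first.
  by move=> /(_ (Z.abs u) (Z.abs_nonneg u) u u0); apply; lia.
apply: natlike_ind => [v v0 hv|n n0 IH v v0 hv]; first by lia.
case: (Classical_Prop.classic (squarefree v)) => [sf|/not_all_ex_not [k hk]].
  by exists v, 1; split; first ring; split.
have [[q hq] k1] := imply_to_and _ _ hk.
have k0 : k <> 0 by move=> kz; subst; lia.
have q0 : q <> 0 by move=> qz; subst; lia.
have [|m [g [hm [sf g0]]]] := IH q q0.
  have : Z.abs v = Z.abs q * (Z.abs k * Z.abs k) by rewrite hq !Z.abs_mul.
  have k2 : 2 <= Z.abs k by lia.
  have : 2 * 2 <= Z.abs k * Z.abs k by apply: Z.mul_le_mono_nonneg; lia.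
  by nia.
by exists m, (g * k); split; [rewrite hq hm; ring|split=> //; nia].
Qed.

(** Coefficients stand in increasing powers of [x]. The degree is the length minus one, so a final
    zero raises it. *)
Fixpoint form (cs : list Z) (x s : Z) : Z :=
  match cs with
  | nil => 0
  | c :: cs' => c * s ^ Z.of_nat (length cs') + x * form cs' x s
  end.

Definition congr_mod (Q a b : Z) := (Q | a - b).

Lemma congr_mod_refl Q a : congr_mod Q a a.
Proof. by exists 0; lia. Qed.

Lemma congr_mod_add Q a b a' b' : congr_mod Q a a' -> congr_mod Q b b' -> congr_mod Q (a + b) (a' + b').
Proof. by move=> [k hk] [l hl]; exists (k + l); lia. Qed.

Lemma congr_mod_mul Q a b a' b' : congr_mod Q a a' -> congr_mod Q b b' -> congr_mod Q (a * b) (a' * b').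
Proof. move=> [k hk] [l hl]; exists (k * b + a' * l).
by rewrite (_ : a * b - a' * b' = (a - a') * b + a' * (b - b')); [rewrite hk hl; ring|ring]. Qed.

Lemma congr_mod_pow Q a a' n : congr_mod Q a a' -> congr_mod Q (a ^ Z.of_nat n) (a' ^ Z.of_nat n).
Proof.
move=> h; elim: n => [|n IH]; first exact: congr_mod_refl.
by rewrite Nat2Z.inj_succ !Z.pow_succ_r; try lia; exact: congr_mod_mul.
Qed.

Lemma congr_mod_form Q cs x s x' s' : congr_mod Q x x' -> congr_mod Q s s' ->
  congr_mod Q (form cs x s) (form cs x' s').
Proof.
move=> hx hs; elim: cs => [|c cs IH] /=; first exact: congr_mod_refl.
by apply: congr_mod_add; apply: congr_mod_mul => //; [exact: congr_mod_refl|exact: congr_mod_pow].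
Qed.

Lemma congr_mod_divide q Q a b : (q | Q) -> congr_mod Q a b -> congr_mod q a b.
Proof. exact: Z.divide_trans. Qed.

Lemma congr_mod_eq q a b : congr_mod q a b -> a mod q = b mod q.
Proof.
move=> [k hk]; case: (Z.eq_dec q 0) => [q0|q0]; first by subst q; congr Z.modulo; lia.
by rewrite (_ : a = b + k * q) ?Z.mod_add; lia.
Qed.

Lemma rel_prime_addl a b s : rel_prime a s -> (s | b) -> rel_prime (b + a) s.
Proof.
move=> rp [k ->]; apply/Zgcd_1_rel_prime; rewrite Z.gcd_comm Z.add_comm.
by rewrite Z.gcd_add_mult_diag_r Z.gcd_comm; apply/Zgcd_1_rel_prime.
Qed.

(** Modulo [s] only the last coefficient times a power of [x] survives. *)
Lemma rel_prime_form cs x s : rel_prime x s -> rel_prime (List.last cs 1) s -> rel_prime (form cs x s) s \/ cs = nil.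
Proof.
move=> hx; elim: cs => [|c [|c' cs] IH] /= h; [by right|left|left].
  by rewrite (_ : c * s ^ Z.of_nat 0 + x * 0 = c) // (_ : Z.of_nat 0 = 0) // Z.pow_0_r; ring.
have [IH'|//] := IH h.
apply: rel_prime_addl.
  by apply: rel_prime_sym; apply: rel_prime_mult; apply: rel_prime_sym.
rewrite Nat2Z.inj_succ Z.pow_succ_r; last by lia.
by apply: Z.divide_mul_r; exact: Z.divide_factor_l.
Qed.

(** A common divisor of [N] and [Y] divides [R * s ^ t] and is prime to [s], so it divides [R] and
    hence [Q]. Modulo [Q] the coordinates may be replaced by those at the base point. *)
Lemma common_divisor_near N Y N0 Y0 Q R s t a b d : congr_mod Q N N0 -> congr_mod Q Y Y0 -> (R | Q) ->
  a * N + b * Y = R * s ^ Z.of_nat t -> rel_prime N s -> (d | N) -> (d | Y) -> (d | N0) /\ (d | Y0).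
Proof.
move=> hN hY RQ e rp dN dY.
have ds : rel_prime d (s ^ Z.of_nat t).
  have rds : rel_prime d s by apply: rel_prime_div rp dN.
  elim: t {e} => [|t IH]; first by apply: rel_prime_sym; exact: rel_prime_1.
  by rewrite Nat2Z.inj_succ Z.pow_succ_r; [apply: rel_prime_mult|lia].
have dR : (d | R).
  apply: (Gauss d (s ^ Z.of_nat t)) => //; rewrite Z.mul_comm -e.
  by apply: Z.divide_add_r; apply: Z.divide_mul_r.
have dQ := Z.divide_trans _ _ _ dR RQ.
have aux P P0 : congr_mod Q P P0 -> (d | P) -> (d | P0).
  move=> h dP; rewrite (_ : P0 = P - (P - P0)); last by ring.
  by apply: Z.divide_sub_r => //; exact: Z.divide_trans h.
by split; [exact: (aux N)|exact: (aux Y)].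
Qed.

Lemma rel_prime_of_divisors a b : (forall d, (d | a) -> (d | b) -> (d | 1)) -> rel_prime a b.
Proof. by move=> h; split; try exact: Z.divide_1_l. Qed.

Lemma rel_prime2_odd a : a mod 2 = 1 -> rel_prime 2 a.
Proof.
move=> h; apply/Zgcd_1_rel_prime; apply: (Z.bezout_1_gcd).
by exists (- (a / 2)), 1; have := Z.div_mod a 2; lia.
Qed.

(** This is [Y + sqrt K] for [K = 4 m g^2], of norm [N^3]; its trace [2 Y] is prime to the odd
    number [N]. *)
Lemma virtual_unit_point m g N Y : Y * Y = N * N * N + 4 * (m * (g * g)) -> rel_prime Y N -> N mod 2 = 1 ->
  virtual_unit m (qof m Y (2 * g)).
Proof.
move=> e rp n2; exists N; rewrite /qnorm qre_of qim_of; split; first by lia.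
apply: rel_prime_sym; apply: rel_prime_mult; apply: rel_prime_sym => //; exact: rel_prime2_odd.
Qed.

(* Here the point is (2n, 2y), and alpha^2 / 8 replaces alpha = 2 (y + g sqrt m). *)
Lemma virtual_unit_even_point m g n y : y * y = 2 * (n * n * n) + m * (g * g) -> rel_prime y n -> n mod 2 = 1 ->
  virtual_unit m (qof m (y * y - n * n * n) (y * g)).
Proof.
move=> e rp n2; exists (n * n); rewrite /qnorm qre_of qim_of; split.
  rewrite (_ : m * (y * g * (y * g)) = (m * (g * g)) * (y * y)); last by ring.
  by rewrite (_ : m * (g * g) = y * y - 2 * (n * n * n)); [ring|lia].
have h : rel_prime (2 * (y * y - n * n * n)) n.
  apply: rel_prime_sym; apply: rel_prime_mult; apply: rel_prime_sym; first exact: rel_prime2_odd.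
  rewrite (_ : _ - _ = - (n * n) * n + y * y); last by ring.
  apply: rel_prime_addl; last exact: Z.divide_factor_r.
  by apply: rel_prime_sym; apply: rel_prime_mult; apply: rel_prime_sym.
by apply: rel_prime_mult.
Qed.

(* Meaningful only when w is a primitive cube root of unity modulo p. *)
Definition cubic_dlog (p w a : Z) : Z :=
  let t := Z.pow_pos a (Z.to_pos ((p - 1) / 3)) mod p in
  if t =? 1 then 0 else if t =? w then 1 else 2.

Definition residues_below (p : Z) : list Z := map Z.of_nat (List.seq 1 (Z.to_nat (p - 1))).

Definition cubic_dlog_check (p w : Z) : bool :=
  forallb (fun a => forallb (fun b =>
    negb ((a * b) mod p =? 0) &&
    ((cubic_dlog p w ((a * b) mod p) - (cubic_dlog p w a + cubic_dlog p w b)) mod 3 =? 0))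
    (residues_below p)) (residues_below p).

Lemma in_residues_below p a : 0 < a < p -> In a (residues_below p).
Proof.
by move=> h; apply/in_map_iff; exists (Z.to_nat a); split; [lia|apply/in_seq; lia].
Qed.

(** A square root [r] of [m] modulo [p] defines the reduction of Z[sqrt m] at a prime above [p];
    multiplicativity of the character is then a finite table. *)
Lemma cubic_log_mod m p w r : 1 < p -> cubic_dlog_check p w = true -> congr_mod p (r * r) m ->
  cubic_dlog p w 1 = 0 ->
  cubic_log m (fun z => (qre m z + snd z * r) mod p <> 0)
    (fun z => cubic_dlog p w ((qre m z + snd z * r) mod p)).
Proof.
move=> p1 chk hr l1; set f := fun z => (qre m z + snd z * r) mod p.
have fM x y : f (qmul (4 * m) x y) = (f x * f y) mod p.
  rewrite /f -Z.mul_mod; last by lia.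
  apply: congr_mod_eq; rewrite qre_mul qim_mul; case: hr => k hk.
  by exists (- k * (snd x * snd y)); nia.
have fb x : 0 <= f x < p by apply: Z.mod_pos_bound; lia.
have chkP a b : 0 < a < p -> 0 < b < p -> (a * b) mod p <> 0 /\
    (3 | cubic_dlog p w ((a * b) mod p) - (cubic_dlog p w a + cubic_dlog p w b)).
  move=> ha hb; move: chk; rewrite /cubic_dlog_check => /forallb_forall /(_ a (in_residues_below _ _ ha)).
  move=> /forallb_forall /(_ b (in_residues_below _ _ hb)) /andP [/negP h1 /Z.eqb_eq h2].
  split; first by move/Z.eqb_eq.
  by apply/Z.mod_divide.
split.
  by rewrite /qre /qone; cbn [fst snd]; rewrite (_ : 1 + 2 * m * 0 + 0 * r = 1) ?Z.mod_small; lia.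
split=> x y; rewrite -/(f x) -/(f y) -/(f (qmul _ _ _)) fM.
  split.
    by move=> h; split=> h0; apply: h; rewrite h0 ?Z.mul_0_r ?Z.mul_0_l Z.mod_0_l; lia.
  move=> [hx hy]; have := fb x; have := fb y => b1 b2.
  by have [] := chkP (f x) (f y) ltac:(lia) ltac:(lia).
move=> hx hy; have := fb x; have := fb y => b1 b2.
by have [] := chkP (f x) (f y) ltac:(lia) ltac:(lia).
Qed.

End Points.

(** * The family *)

(* With a = (x, -x, 6s, 19s, 21s, -46s) and A = (X^2 + e2/3)^3 - prod (X - a_i), which has leading
   coefficient e3 = (-30s)^3, Kform x s is 729/4 times the discriminant of A. *)
Definition discK : list Z := [-19432911493156020847253567; -2089921679024154371863488;
  -9688932392471075902284; -13700086600601517045; 9618186674345004; 42193039086072; 37321328343;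
  3964464; 0; 1].
Definition Kform (x s : Z) : Z := form discK (x * x) (s * s).

(* The integral points (N, Y) of Y^2 = N^3 + Kform x s coming from the points X = x, -x, 6s, 19s, 21s of
   y^3 = A(X); the point of X = -x is obtained by the substitution x := -x. *)
Definition ptxN : list Z := [2180050523; -93231180; 5833731; -220140; 6369; -180; 2].
Definition ptxY : list Z := [-101693261437110; 6535719144003; -468164363310; 24306935538;
  -921262410; 37313793; -880560; 23538; -360; 3].
(** The substitution x := -x permutes the [a_i] and fixes 6s, 19s and 21s, so these coordinates are
    even in [x]. The odd degree 9 of [Y] leaves the factor [s]. *)
Definition evenN (cs : list Z) (x s : Z) := form cs (x * x) (s * s).
Definition evenY (cs : list Z) (x s : Z) := s * form cs (x * x) (s * s).
Definition pt6N : list Z := [1691911151; 2665872; 1728; -1].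
Definition pt6Y : list Z := [69453365136372; 149767838262; 135290682; 20862; 72].
Definition pt19N : list Z := [552914786; 2575977; 363; -1].
Definition pt19Y : list Z := [12231161021283; 11144522418; 62408223; 171168; 33].
Definition pt21N : list Z := [612746666; 1943217; 243; -1].
Definition pt21Y : list Z := [-14513029260723; -3406256658; 85628637; 178092; 27].

Ltac ring_form :=
  change (Z.of_nat 0) with 0; change (Z.of_nat 1) with 1; change (Z.of_nat 2) with 2;
  change (Z.of_nat 3) with 3; change (Z.of_nat 4) with 4; change (Z.of_nat 5) with 5;
  change (Z.of_nat 6) with 6; change (Z.of_nat 7) with 7; change (Z.of_nat 8) with 8;
  change (Z.of_nat 9) with 9; change (Z.of_nat 10) with 10; change (Z.of_nat 11) with 11;
  change (Z.of_nat 12) with 12; change (Z.of_nat 13) with 13; change (Z.of_nat 14) with 14;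
  change (Z.of_nat 15) with 15; change (Z.of_nat 16) with 16; change (Z.of_nat 17) with 17;
  change (Z.of_nat 18) with 18; ring.
Ltac ring_points :=
  cbv [Kform discK ptxN ptxY evenN evenY pt6N pt6Y pt19N pt19Y pt21N pt21Y form length]; ring_form.

Lemma curve_x x s : form ptxY x s * form ptxY x s = form ptxN x s * form ptxN x s * form ptxN x s + Kform x s.
Proof. ring_points. Qed.
Lemma curve_6 x s : evenY pt6Y x s * evenY pt6Y x s = evenN pt6N x s * evenN pt6N x s * evenN pt6N x s + Kform x s.
Proof. ring_points. Qed.
Lemma curve_19 x s : evenY pt19Y x s * evenY pt19Y x s = evenN pt19N x s * evenN pt19N x s * evenN pt19N x s + Kform x s.
Proof. ring_points. Qed.
Lemma curve_21 x s : evenY pt21Y x s * evenY pt21Y x s = evenN pt21N x s * evenN pt21N x s * evenN pt21N x s + Kform x s.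
Proof. ring_points. Qed.

Lemma Kform_opp x s : Kform (- x) s = Kform x s.
Proof. by rewrite /Kform Z.mul_opp_opp. Qed.

(** The cofactors come from the elimination of [x] between [N] and [Y]; they confine the common
    divisors prime to [s] to a constant that divides [Qmod]. *)
Lemma bezout_x x s :
  form [16950875391853618925502450; -1245835248117429794600895; 71260926832370476482048;
    -3599134038444090409005; 121621689810607267656; -3167941111263005055; 70943764272534144;
    -948132596293920; 6332361509952] x s * form ptxN x s +
  form [312558063359641284535; -22160191824777467268; 779094116313651850; -23851989760601664;
    505441167330240; -4221574339968] x s * form ptxY x s = 5168715911809518788258493642187500 * s ^ Z.of_nat 14.
Proof. change (Z.of_nat 14) with 14; ring_points. Qed.
Lemma bezout_6 x s :
  s * form [6028400673443988; -475718539824; 1991406834; 769752] (x * x) (s * s) * evenN pt6N x s +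
  form [-104754201354; 6086663; 10691] (x * x) (s * s) * evenY pt6Y x s
  = 2923986525887396714062500 * s ^ Z.of_nat 13.
Proof. change (Z.of_nat 13) with 13; ring_points. Qed.
Lemma bezout_19 x s :
  s * form [-232513972118769; -491065667778; -4131298212; -840741] (x * x) (s * s) * evenN pt19N x s +
  form [60323104498; 16204179; -25477] (x * x) (s * s) * evenY pt19Y x s
  = 609261191282659682812500 * s ^ Z.of_nat 13.
Proof. change (Z.of_nat 13) with 13; ring_points. Qed.
Lemma bezout_21 x s :
  s * form [-12122137162719927; 23517863630586; 111941859384; 17741457] (x * x) (s * s) * evenN pt21N x s +
  form [-1202811643134; -347850557; 657091] (x * x) (s * s) * evenY pt21Y x s
  = 10028641440690718157812500 * s ^ Z.of_nat 13.
Proof. change (Z.of_nat 13) with 13; ring_points. Qed.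

(* A multiple of 16, of the right-hand constants of the identities bezout_* and of the primes 7, 13, 31,
   37, 61 of the characters. The family is restricted to (x, s) = (9, 7) modulo Qmod. *)
Definition Qmod : Z := 1098476180441406170955848102812256250000.

(* The residues modulo p of Y + sqrt K at the five points, sg being a square root of K and e8 an inverse
   of 8; at X = 6s the point is (2n, 2y) and alpha^2 / 8 replaces alpha. *)
Definition five_residues (sg e8 : Z) := [form ptxY 9 7 + sg; form ptxY (- 9) 7 + sg;
  e8 * ((evenY pt6Y 9 7 + sg) * (evenY pt6Y 9 7 + sg)); evenY pt19Y 9 7 + sg; evenY pt21Y 9 7 + sg].

(** [ki] is an inverse of [Kform 9 7] modulo [p]. Its existence keeps [g] and [m] invertible modulo
    [p] throughout the family. *)
Definition character_check p w sg ki e8 : bool :=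
  (Qmod mod p =? 0) && ((Kform 9 7 * ki - 1) mod p =? 0) && ((sg * sg - Kform 9 7) mod p =? 0) &&
  ((8 * e8 - 1) mod p =? 0) && cubic_dlog_check p w && (cubic_dlog p w 1 =? 0) &&
  forallb (fun a => negb (a mod p =? 0)) (five_residues sg e8).

Lemma character_check_7 : character_check 7 4 6 1 1 = true.
Proof. by vm_compute. Qed.

Lemma character_check_13 : character_check 13 3 10 3 5 = true.
Proof. by vm_compute. Qed.

Lemma character_check_31 : character_check 31 25 24 19 4 = true.
Proof. by vm_compute. Qed.

Lemma character_check_37 : character_check 37 26 14 27 14 = true.
Proof. by vm_compute. Qed.

Lemma character_check_61 : character_check 61 47 40 48 23 = true.
Proof. by vm_compute. Qed.

Section FamilyPoint.
Variables x s : Z.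
Hypothesis hx : congr_mod Qmod x 9.
Hypothesis hs : congr_mod Qmod s 7.
Hypothesis cop : rel_prime x s.

Let hx2 : congr_mod Qmod (x * x) (9 * 9).
Proof. exact: congr_mod_mul. Qed.
Let hs2 : congr_mod Qmod (s * s) (7 * 7).
Proof. exact: congr_mod_mul. Qed.
Let hxN : congr_mod Qmod (- x) (- 9).
Proof. by case: hx => k hk; exists (- k); lia. Qed.

Let congr_form cs : congr_mod Qmod (form cs x s) (form cs 9 7).
Proof. exact: congr_mod_form. Qed.
Let congr_formN cs : congr_mod Qmod (form cs (- x) s) (form cs (- 9) 7).
Proof. exact: congr_mod_form. Qed.
Let congr_even cs : congr_mod Qmod (evenN cs x s) (evenN cs 9 7).
Proof. exact: congr_mod_form. Qed.
Let congr_evenY cs : congr_mod Qmod (evenY cs x s) (evenY cs 9 7).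
Proof. by apply: congr_mod_mul => //; exact: congr_mod_form. Qed.
Let congr_K : congr_mod Qmod (Kform x s) (Kform 9 7).
Proof. exact: congr_mod_form. Qed.

Let residue q a b : (q | Qmod) -> congr_mod Qmod a b -> a mod q = b mod q.
Proof. by move=> hq h; apply: congr_mod_eq; exact: congr_mod_divide h. Qed.

Let s_odd : rel_prime 2 s.
Proof.
by apply: rel_prime2_odd; rewrite (residue 2 s 7) //; exists (Qmod / 2); vm_compute.
Qed.

Let near N Y N0 Y0 R t a b : congr_mod Qmod N N0 -> congr_mod Qmod Y Y0 -> (R | Qmod) ->
  a * N + b * Y = R * s ^ Z.of_nat t -> rel_prime N s -> Z.gcd N0 Y0 = 1 -> rel_prime Y N.
Proof.
move=> hN hY hR e rp g1; apply: rel_prime_of_divisors => d dY dN.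
have [d1 d2] := common_divisor_near _ _ _ _ _ _ _ _ _ _ d hN hY hR e rp dN dY.
by rewrite -g1; exact: Z.gcd_greatest.
Qed.

Let coprime_x y : rel_prime y s -> rel_prime (form ptxN y s) s.
Proof. by move=> h; case: (rel_prime_form ptxN y s h). Qed.

Let coprime_even c0 c1 c2 : rel_prime (evenN [c0; c1; c2; -1] x s) s.
Proof.
have h : rel_prime (x * x) (s * s).
  by apply: rel_prime_mult; apply: rel_prime_sym; apply: rel_prime_mult; apply: rel_prime_sym.
have h1 : rel_prime (-1) (s * s).
  by apply: rel_prime_of_divisors => d [k hk] _; exists (- k); lia.
case: (rel_prime_form [c0; c1; c2; -1] (x * x) (s * s) h h1) => // {}h.
apply: rel_prime_sym; apply: (rel_prime_div _ _ _ (rel_prime_sym _ _ h)); exact: Z.divide_factor_l.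
Qed.

Let coprime_ptx : rel_prime (form ptxY x s) (form ptxN x s).
Proof.
apply: (near _ _ _ _ _ _ _ _ (congr_form _) (congr_form _) _ (bezout_x x s)); last by vm_compute.
  by exists (Qmod / 5168715911809518788258493642187500); vm_compute.
exact: coprime_x.
Qed.

Let coprime_ptxN : rel_prime (form ptxY (- x) s) (form ptxN (- x) s).
Proof.
apply: (near _ _ _ _ _ _ _ _ (congr_formN _) (congr_formN _) _ (bezout_x (- x) s)); last by vm_compute.
  by exists (Qmod / 5168715911809518788258493642187500); vm_compute.
apply: coprime_x; case: cop => _ _ h; apply: rel_prime_of_divisors => d d1 d2.
by apply: h => //; rewrite -Z.divide_opp_r.
Qed.

Let coprime_pt19 : rel_prime (evenY pt19Y x s) (evenN pt19N x s).
Proof.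
apply: (near _ _ _ _ _ _ _ _ (congr_even _) (congr_evenY _) _ (bezout_19 x s)); last by vm_compute.
  by exists (Qmod / 609261191282659682812500); vm_compute.
exact: coprime_even.
Qed.

Let coprime_pt21 : rel_prime (evenY pt21Y x s) (evenN pt21N x s).
Proof.
apply: (near _ _ _ _ _ _ _ _ (congr_even _) (congr_evenY _) _ (bezout_21 x s)); last by vm_compute.
  by exists (Qmod / 10028641440690718157812500); vm_compute.
exact: coprime_even.
Qed.

(** At (9, 7) both coordinates are 2 modulo 4 and their gcd is 2. This persists in the class, whence
    the separate treatment of this point. *)
Let halves : exists n y, evenN pt6N x s = 2 * n /\ evenY pt6Y x s = 2 * y /\ n mod 2 = 1 /\ rel_prime y n.
Proof.
have h4 : (4 | Qmod) by exists (Qmod / 4); vm_compute.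
have := residue 4 _ _ h4 (congr_even pt6N).
rewrite (_ : evenN pt6N 9 7 mod 4 = 2); last by vm_compute.
have := residue 4 _ _ h4 (congr_evenY pt6Y).
rewrite (_ : evenY pt6Y 9 7 mod 4 = 2); last by vm_compute.
move=> e1 e2; have d1 := Z.div_mod (evenY pt6Y x s) 4; have d2 := Z.div_mod (evenN pt6N x s) 4.
set n := 2 * (evenN pt6N x s / 4) + 1; set y := 2 * (evenY pt6Y x s / 4) + 1.
have hn : evenN pt6N x s = 2 * n by rewrite /n; lia.
have hy : evenY pt6Y x s = 2 * y by rewrite /y; lia.
have n1 : n mod 2 = 1 by rewrite /n Z.add_comm Z.mul_comm Z.mod_add.
exists n, y; split=> //; split=> //; split=> //.
apply: rel_prime_of_divisors => d dy dn.
have dN : (d | evenN pt6N x s) by rewrite hn; exact: Z.divide_mul_r.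
have dY : (d | evenY pt6Y x s) by rewrite hy; exact: Z.divide_mul_r.
have [] := common_divisor_near _ _ _ _ Qmod _ _ _ _ _ d (congr_even _) (congr_evenY _) _
  (bezout_6 x s) (coprime_even _ _ _) dN dY.
  by exists (Qmod / 2923986525887396714062500); vm_compute.
move=> h1 h2; have := Z.gcd_greatest _ _ _ h1 h2.
rewrite (_ : Z.gcd _ _ = 2); last by vm_compute.
move=> d2'; have := rel_prime2_odd n n1 => -[_ _]; exact.
Qed.

Variables m g : Z.
Hypothesis hK : Kform x s = 4 * (m * (g * g)).

(** Since [4 m g^2 ki] is 1 modulo [p], the number [2 g m ki] inverts [2 g], and the root of [m] is
    [sg / (2 g)]. *)
Let character_root p sg ki : (p | Qmod) -> (p | Kform 9 7 * ki - 1) -> (p | sg * sg - Kform 9 7) ->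
  exists r, congr_mod p (r * r) m /\ congr_mod p (2 * g * r) sg.
Proof.
move=> /congr_mod_divide /(_ congr_K); move: (Kform 9 7) => K0; rewrite hK => -[a ha] [b hb] [c hc].
have h1 : congr_mod p (2 * g * (2 * g * m * ki)) 1.
  by exists (b + a * ki); nia.
exists (sg * (2 * g * m * ki)); split; last first.
  rewrite (_ : 2 * g * _ = sg * (2 * g * (2 * g * m * ki))); last by ring.
  by rewrite -{2}(Z.mul_1_r sg); apply: congr_mod_mul => //; exact: congr_mod_refl.
set i := 2 * g * m * ki in h1 *.
have h2 := congr_mod_mul _ _ _ _ _ h1 h1.
have {h2}[e he] := congr_mod_mul _ _ _ _ _ (congr_mod_refl p m) h2.
exists ((c - a) * (i * i) + e).
have -> : sg * i * (sg * i) - m = (sg * sg - K0) * (i * i) - (4 * (m * (g * g)) - K0) * (i * i) + (m * (2 * g * i * (2 * g * i)) - m * (1 * 1)) by ring.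
by rewrite ha hc he; ring.
Qed.

Let five_units (n y : Z) := [qof m (form ptxY x s) (2 * g); qof m (form ptxY (- x) s) (2 * g);
  qof m (y * y - n * n * n) (y * g); qof m (evenY pt19Y x s) (2 * g); qof m (evenY pt21Y x s) (2 * g)].

Let character_values p w sg ki e8 n y : evenN pt6N x s = 2 * n -> evenY pt6Y x s = 2 * y ->
  1 < p -> character_check p w sg ki e8 = true ->
  exists l : (qelt -> Prop) * (qelt -> Z), cubic_log m l.1 l.2 /\ Forall l.1 (five_units n y) /\
    seq.map l.2 (five_units n y) = seq.map (fun a => cubic_dlog p w (a mod p)) (five_residues sg e8).
Proof.
move=> hn hy p1; rewrite /character_check; do 6! case/andP.
have dv a : a mod p =? 0 -> (p | a) by move/Z.eqb_eq/Z.mod_divide; apply; lia.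
move=> /dv pQ /dv hki /dv hsg /dv he8 chk /Z.eqb_eq l1 nz.
have [r [hr hg]] := character_root p sg ki pQ hki hsg.
exists (fun z => (qre m z + snd z * r) mod p <> 0, fun z => cubic_dlog p w ((qre m z + snd z * r) mod p)).
split; first exact: cubic_log_mod.
have val Y Y0 : congr_mod Qmod Y Y0 -> (qre m (qof m Y (2 * g)) + snd (qof m Y (2 * g)) * r) mod p = (Y0 + sg) mod p.
  move=> h; rewrite qre_of qim_of; apply: congr_mod_eq; apply: congr_mod_add; last exact: hg.
  exact: congr_mod_divide h.
have val6 : (qre m (qof m (y * y - n * n * n) (y * g)) + snd (qof m (y * y - n * n * n) (y * g)) * r) mod p
    = (e8 * ((evenY pt6Y 9 7 + sg) * (evenY pt6Y 9 7 + sg))) mod p.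
  rewrite qre_of qim_of; apply: congr_mod_eq; set t := _ + _.
  have hY : congr_mod p (2 * y) (evenY pt6Y 9 7) by rewrite -hy; exact: congr_mod_divide (congr_evenY _).
  have hKp : congr_mod p (Kform x s) (Kform 9 7) by exact: congr_mod_divide congr_K.
  (* By the equation of the curve, eight times the value is [Y^2 + K + 2 Y sqrt K]. This becomes
     [(Y + sg)^2] modulo [p], where [sg^2] is [K] and [2 g r] is [sg]. *)
  have e8t : 8 * t = 2 * y * (2 * y) + Kform x s + 2 * (2 * y) * (2 * g * r).
    have := curve_6 x s; rewrite hn hy /t => e.
    by rewrite (_ : Kform x s = 2 * y * (2 * y) - 2 * n * (2 * n) * (2 * n)); [ring|lia].
  move: (evenY pt6Y 9 7) hY => Y0 hY.
  have h8 : congr_mod p (8 * t) ((Y0 + sg) * (Y0 + sg)).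
    rewrite e8t (_ : (Y0 + sg) * (Y0 + sg) = Y0 * Y0 + sg * sg + 2 * Y0 * sg); last by ring.
    apply: congr_mod_add; first apply: congr_mod_add.
    - by apply: congr_mod_mul; exact: hY.
    - case: hKp => a ha; case: hsg => b hb; exists (a - b); lia.
    - apply: congr_mod_mul; last exact: hg.
      by apply: congr_mod_mul; [exact: congr_mod_refl|exact: hY].
  have [a ha] := congr_mod_mul _ _ _ _ _ (congr_mod_refl p e8) h8; case: he8 => b hb.
  by exists (a - b * t); nia.
move: nz; rewrite /five_residues => /forallb_forall nz.
have nzP a : In a (five_residues sg e8) -> a mod p <> 0.
  by move=> /nz /negP h /Z.eqb_eq; exact: h.
have v1 := val _ _ (congr_form ptxY); have v2 := val _ _ (congr_formN ptxY).
have v3 := val _ _ (congr_evenY pt19Y); have v4 := val _ _ (congr_evenY pt21Y).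
rewrite /five_units; split.
  by repeat constructor; cbn [fst]; rewrite ?v1 ?v2 ?v3 ?v4 ?val6; apply: nzP; rewrite /five_residues /=; tauto.
by cbn [seq.map snd]; rewrite v1 v2 v3 v4 val6.
Qed.

Hypothesis sf : squarefree m.
Hypothesis m3 : m mod 4 = 3.

Lemma family_rank k r : unit_rank_bound m k -> is_true (ssrnat.leq (k * ssrnat.expn 3 r) (ssrnat.expn 3 5)) -> rk3_cl_ge (4 * m) r.
Proof.
move=> ub kr; have [n [y [hn [hy [n1 rp6]]]]] := halves.
have values p w sg ki e8 row : (1 <? p) = true -> character_check p w sg ki e8 = true ->
    seq.map (fun a => cubic_dlog p w (a mod p)) (five_residues sg e8) = row ->
    exists l : (qelt -> Prop) * (qelt -> Z), cubic_log m l.1 l.2 /\ Forall l.1 (five_units n y) /\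
      seq.map l.2 (five_units n y) = row.
  by move=> /Z.ltb_lt p1 chk <-; exact: (character_values p w sg ki e8).
(* Each row lists the logarithms at the five points; the matrix of the five rows is invertible
   modulo 3. *)
have [l7 [c7 [g7 v7]]] := values 7 4 6 1 1 [1; 2; 0; 0; 0] (eq_refl _) character_check_7 ltac:(vm_compute; reflexivity).
have [l13 [c13 [g13 v13]]] := values 13 3 10 3 5 [2; 2; 0; 0; 1] (eq_refl _) character_check_13 ltac:(vm_compute; reflexivity).
have [l31 [c31 [g31 v31]]] := values 31 25 24 19 4 [0; 0; 1; 0; 0] (eq_refl _) character_check_31 ltac:(vm_compute; reflexivity).
have [l37 [c37 [g37 v37]]] := values 37 26 14 27 14 [1; 2; 2; 2; 2] (eq_refl _) character_check_37 ltac:(vm_compute; reflexivity).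
have [l61 [c61 [g61 v61]]] := values 61 47 40 48 23 [1; 0; 0; 1; 1] (eq_refl _) character_check_61 ltac:(vm_compute; reflexivity).
have odd N N0 : congr_mod Qmod N N0 -> N0 mod 2 = 1 -> N mod 2 = 1.
  by move=> h <-; apply: residue h; exists (Qmod / 2); vm_compute.
apply: (rk3_of_virtual_units m sf (or_intror m3) k r 5 (five_units n y) [l7; l13; l31; l37; l61]) => //.
- repeat constructor.
  + apply: (virtual_unit_point m g (form ptxN x s)); [by rewrite curve_x hK|exact: coprime_ptx|].
    by apply: (odd _ _ (congr_form _)); vm_compute.
  + apply: (virtual_unit_point m g (form ptxN (- x) s)); [by rewrite curve_x Kform_opp hK|exact: coprime_ptxN|].
    by apply: (odd _ _ (congr_formN _)); vm_compute.
  + apply: virtual_unit_even_point => //; have := curve_6 x s; rewrite hn hy hK => e.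
    lia.
  + apply: (virtual_unit_point m g (evenN pt19N x s)); [by rewrite curve_19 hK|exact: coprime_pt19|].
    by apply: (odd _ _ (congr_even _)); vm_compute.
  + apply: (virtual_unit_point m g (evenN pt21N x s)); [by rewrite curve_21 hK|exact: coprime_pt21|].
    by apply: (odd _ _ (congr_even _)); vm_compute.
- by do 5! (apply: Forall_cons; first by split); exact: Forall_nil.
case=> [|a [|b [|c [|d [|e [|? ?]]]]]] // [|a' [|b' [|c' [|d' [|e' [|? ?]]]]]] // _ _.
move=> /Forall_cons_iff [a3 /Forall_cons_iff [b3 /Forall_cons_iff [c3 /Forall_cons_iff [d3 /Forall_cons_iff [e3 _]]]]].
move=> /Forall_cons_iff [a3' /Forall_cons_iff [b3' /Forall_cons_iff [c3' /Forall_cons_iff [d3' /Forall_cons_iff [e3' _]]]]].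
move=> /Forall_cons_iff [h7 /Forall_cons_iff [h13 /Forall_cons_iff [h31 /Forall_cons_iff [h37 /Forall_cons_iff [h61 _]]]]].
rewrite v7 in h7; rewrite v13 in h13; rewrite v31 in h31; rewrite v37 in h37; rewrite v61 in h61.
case: h7 h13 h31 h37 h61 => k7 h7 [k13 h13] [k31 h31] [k37 h37] [k61 h61].
cbn [weighted_sum] in h7, h13, h31, h37, h61.
(* The row of 31 involves [c] alone. Two exponents below 3 that agree modulo 3 are equal. *)
have ec : c = c' by lia.
have [eb [ee [ea ed]]] : b = b' /\ e = e' /\ a = a' /\ d = d' by lia.
by subst.
Qed.

End FamilyPoint.

(** * Binary forms and points with the same discriminant *)

Lemma pow_natS (s : Z) n : s ^ Z.of_nat (S n) = s * s ^ Z.of_nat n.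
Proof. by rewrite Nat2Z.inj_succ Z.pow_succ_r; lia. Qed.

Lemma pow_nat0 (s : Z) : s ^ Z.of_nat 0 = 1.
Proof. by []. Qed.

Lemma pow_natD (s : Z) n k : s ^ Z.of_nat (n + k) = s ^ Z.of_nat n * s ^ Z.of_nat k.
Proof. by rewrite Nat2Z.inj_add Z.pow_add_r; lia. Qed.

(** The extra factor [t] on the left covers the empty list, whose degree is -1. *)
Lemma form_scale cs t x s : t * form cs (t * x) (t * s) = t ^ Z.of_nat (length cs) * form cs x s.
Proof.
elim: cs => [|c cs IH] /=; first by ring.
rewrite pow_natS Z.pow_mul_l.
transitivity (t * (c * (t ^ Z.of_nat (length cs) * s ^ Z.of_nat (length cs))) + t * x * (t * form cs (t * x) (t * s))); first by ring.
by rewrite IH; ring.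
Qed.

Lemma form_mapZ c cs x s : form (map (Z.mul c) cs) x s = c * form cs x s.
Proof. by elim: cs => [|d cs IH] /=; rewrite ?length_map ?IH; ring. Qed.

Lemma form_rcons0 cs x s : form (cs ++ [0]) x s = s * form cs x s.
Proof.
elim: cs => [|c cs IH] /=; first by ring.
by rewrite length_app Nat.add_1_r pow_natS IH; ring.
Qed.

Lemma form_add cs ds : length cs = length ds ->
  exists es, length es = length cs /\ forall x s, form es x s = form cs x s + form ds x s.
Proof.
elim: cs ds => [|c cs IH] [|d ds] //=; first by exists nil.
move=> [h]; have [es [l e]] := IH ds h; exists (c + d :: es) => /=; split; first by rewrite l.
by move=> x s; rewrite e l -h; ring.
Qed.

Lemma form_shift cs n : exists es, length es = (length cs + n)%nat /\ forall x s, form es x s = s ^ Z.of_nat n * form cs x s.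
Proof.
elim: n => [|n [es [l e]]].
  by exists cs; split=> [|x s]; [rewrite Nat.add_0_r|rewrite pow_nat0; ring].
exists (es ++ [0]); split=> [|x s]; first by rewrite length_app l /=; lia.
by rewrite form_rcons0 e pow_natS; ring.
Qed.

Lemma form_mul cs ds : cs <> [] -> ds <> [] -> exists es, S (length es) = (length cs + length ds)%nat /\
  forall x s, form es x s = form cs x s * form ds x s.
Proof.
move=> cs0 ds0; elim: cs cs0 => // c [|c' cs] IH _.
  exists (map (Z.mul c) ds); rewrite length_map; split=> // x s.
  by rewrite form_mapZ /= pow_nat0; ring.
have [//|es [l e]] := IH.
have [es1 [l1 e1]] := form_shift (map (Z.mul c) ds) (length (c' :: cs)).
have [|es2 [l2 e2]] := form_add es1 (0 :: es).
  by rewrite l1 length_map /=; move: l => /=; lia.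
exists es2; split; first by rewrite l2 l1 length_map /=; lia.
move=> x s; rewrite e2 e1 form_mapZ.
have -> : form (0 :: es) x s = x * form es x s by move=> /=; ring.
have -> : form (c :: c' :: cs) x s = c * s ^ Z.of_nat (length (c' :: cs)) + x * form (c' :: cs) x s by [].
by rewrite e; ring.
Qed.

(* Division by b x - a s, after multiplication by a power of b. *)
Lemma form_divide (a b : Z) cs n : b <> 0 -> length cs = S n ->
  exists ds r, length ds = n /\
    (forall x s, b ^ Z.of_nat n * form cs x s = (b * x - a * s) * form ds x s + r * s ^ Z.of_nat n) /\
    (r = 0 -> Forall (eq 0) ds -> Forall (eq 0) cs).
Proof.
move=> b0; elim: n cs => [|n IH] [|c cs] //= [l].
  case: cs l => // _; exists [], c; split=> //; split=> [x s|<- _]; last by repeat constructor.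
  by rewrite !pow_nat0 /=; ring.
have [ds [r [lds [e z]]]] := IH cs l.
exists (r :: map (Z.mul b) ds), (a * r + b ^ Z.of_nat (S n) * c); split; first by rewrite /= length_map lds.
split=> [x s|hr].
  rewrite /= length_map lds l form_mapZ.
  transitivity (b ^ Z.of_nat (S n) * c * s ^ Z.of_nat (S n) + b * x * (b ^ Z.of_nat n * form cs x s)).
    by rewrite !pow_natS; ring.
  by rewrite e !pow_natS; ring.
move=> /Forall_cons_iff [r0 hds]; constructor.
  have hb : b ^ Z.of_nat (S n) <> 0 by apply: Z.pow_nonzero; lia.
  by apply: (Z.mul_reg_l _ _ _ hb); rewrite -r0 in hr; lia.
apply: z => //; apply/Forall_forall => d hd.
have : 0 = b * d by apply: (proj1 (Forall_forall _ _) hds); exact: in_map.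
by nia.
Qed.

Definition proportional (p q : Z * Z) := fst p * snd q = fst q * snd p.

(** Each root splits off a linear factor, which does not vanish at the other points because they are
    not proportional to it. *)
Lemma form_many_roots cs n (L : list (Z * Z)) : length cs = n -> (n <= length L)%nat ->
  ForallOrdPairs (fun p q => ~ proportional p q) L ->
  Forall (fun p => snd p <> 0 /\ form cs (fst p) (snd p) = 0) L -> Forall (eq 0) cs.
Proof.
elim: n cs L => [|n IH] cs L l lL.
  by case: cs l => // _ _ _; constructor.
case: L lL => [|[a b] L] /= lL; first by lia.
move=> hop; have [h1 h2] : Forall (fun q => ~ proportional (a, b) q) L /\
  ForallOrdPairs (fun p q => ~ proportional p q) L by inversion hop.
move=> /Forall_cons_iff [/= [b0 hab] hL].
have [ds [r [lds [e z]]]] := form_divide a b cs n b0 l.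
have bn : b ^ Z.of_nat n <> 0 by apply: Z.pow_nonzero; lia.
have r0 : r = 0.
  have := e a b; rewrite hab => hh; have {}hh : r * b ^ Z.of_nat n = 0 by lia.
  by move/Z.mul_eq_0: hh => [].
apply: z => //; apply: (IH ds L) => //; first by lia.
apply/Forall_forall => -[x s] hxs.
have [/= s0 hr] := proj1 (Forall_forall _ _) hL _ hxs; split=> //.
have np : ~ proportional (a, b) (x, s) := proj1 (Forall_forall _ _) h1 _ hxs.
have := e x s; rewrite hr r0 /= => hh; have {}hh : (b * x - a * s) * form ds x s = 0 by lia.
move/Z.mul_eq_0: hh => [hh|//]; case: np; rewrite /proportional /=; lia.
Qed.

(** * Siegel's lemma for congruences *)

Section Siegel.
Import all_boot boolp.
Local Open Scope Z_scope.

Fixpoint zsum (n : nat) (f : nat -> Z) : Z :=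
  match n with O => 0 | S n' => zsum n' f + f n' end.

Lemma zsum_ext n f g : (forall i, (i < n)%coq_nat -> f i = g i) -> zsum n f = zsum n g.
Proof. by elim: n => [//|n IH] h /=; rewrite IH ?h // => i hi; apply: h; lia. Qed.

Lemma zsum_add n f g : zsum n (fun i => f i + g i) = zsum n f + zsum n g.
Proof. by elim: n => [//|n IH] /=; rewrite IH; ring. Qed.

Lemma zsum_sub n f g : zsum n (fun i => f i - g i) = zsum n f - zsum n g.
Proof. by elim: n => [//|n IH] /=; rewrite IH; ring. Qed.

Lemma zsum_mulr n f c : zsum n f * c = zsum n (fun i => f i * c).
Proof. by elim: n => [//|n IH] /=; rewrite Z.mul_add_distr_r IH. Qed.

Lemma zsum_mull n f c : c * zsum n f = zsum n (fun i => c * f i).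
Proof. by rewrite Z.mul_comm zsum_mulr; apply: zsum_ext => i _; ring. Qed.

Lemma zsum_exchange n k f : zsum n (fun i => zsum k (fun j => f i j)) = zsum k (fun j => zsum n (fun i => f i j)).
Proof.
elim: n => [|n IH] /=; last by rewrite IH zsum_add.
by elim: k => [//|k IH] /=; rewrite -IH.
Qed.

Lemma zsum_divide n q f : (forall i, (i < n)%coq_nat -> (q | f i)) -> (q | zsum n f).
Proof.
elim: n => [|n IH] h /=; first exact: Z.divide_0_r.
by apply: Z.divide_add_r; [apply: IH => i hi; apply: h; lia|apply: h; lia].
Qed.

Lemma zsum_congr n q f g : (forall i, (i < n)%coq_nat -> congr_mod q (f i) (g i)) ->
  congr_mod q (zsum n f) (zsum n g).
Proof. by move=> h; rewrite /congr_mod -zsum_sub; exact: zsum_divide. Qed.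

Lemma pigeonhole_fin (T : finType) (b : nat) (f : T -> nat) : (b < #|T|)%N ->
  (forall t, (f t < b)%N) -> exists t1 t2, t1 <> t2 /\ f t1 = f t2.
Proof.
move=> hb hf; pose g t : 'I_b := Ordinal (hf t).
have : ~ injective g by move=> /leq_card; rewrite card_ord leqNgt hb.
move=> ninj; apply: NNPP => none; apply: ninj => i j /(congr1 val) /= e.
by apply: NNPP => ne; apply: none; exists i, j.
Qed.

(* A system of n unknowns with K homogeneous congruences is encoded in mixed radix. *)
Fixpoint mixed_radix (K : nat) (md r : nat -> nat) : nat :=
  match K with O => O | S K' => (r K' + md K' * mixed_radix K' md r)%N end.

Lemma mixed_radix_lt K md r : (forall k, (r k < md k)%N) -> (mixed_radix K md r < \prod_(k < K) md k)%N.
Proof.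
move=> h; elim: K => [|K IH] /=; first by rewrite big_ord0.
rewrite big_ord_recr /= (mulnC _ (md K)); apply: (@leq_trans (md K * (mixed_radix K md r).+1)%N).
  by rewrite mulnS ltn_add2r.
by rewrite leq_mul2l IH orbT.
Qed.

Lemma mixed_radix_inj K md r r' : (forall k, (r k < md k)%N) -> (forall k, (r' k < md k)%N) ->
  mixed_radix K md r = mixed_radix K md r' -> forall k, (k < K)%N -> r k = r' k.
Proof.
move=> h h'; elim: K => [//|K IH] /= e k.
have m0 : (0 < md K)%N by apply: leq_ltn_trans (h K).
have e1 : r K = r' K.
  have := congr1 (modn ^~ (md K)) e; rewrite !(addnC (_ K)) !(mulnC (md K)) !modnMDl !modn_small //.
rewrite e1 in e; have {}e := addnI e.
have {}e : mixed_radix K md r = mixed_radix K md r' by apply/eqP; rewrite -(eqn_pmul2l m0) e.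
by rewrite ltnS leq_eqVlt => /orP [/eqP -> //|]; exact: IH.
Qed.

(** The vectors with entries from 0 to [B] outnumber the possible systems of residues, so two of
    them agree everywhere; [v] is their difference. *)
Lemma siegel (n K B : nat) (md : nat -> nat) (c : nat -> nat -> Z) : (forall k, (0 < md k)%N) ->
  (\prod_(k < K) md k < B.+1 ^ n)%N ->
  exists v : nat -> Z, (forall j, Z.abs (v j) <= Z.of_nat B) /\ (exists j, (j < n)%coq_nat /\ v j <> 0) /\
    forall k, (k < K)%coq_nat -> (Z.of_nat (md k) | zsum n (fun j => v j * c j k)).
Proof.
move=> md0 hB.
pose w (t : {ffun 'I_n -> 'I_B.+1}) (j : nat) : nat :=
  if insub j is Some i then nat_of_ord (t i) else O.
pose res t k := Z.to_nat (zsum n (fun j => Z.of_nat (w t j) * c j k) mod Z.of_nat (md k)).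
have res_lt t k : (res t k < md k)%N.
  have mk : 0 < Z.of_nat (md k) by move/ltP: (md0 k); lia.
  by apply/ltP; rewrite /res; have := Z.mod_pos_bound (zsum n (fun j => Z.of_nat (w t j) * c j k)) _ mk; lia.
have [|t [t' [ne e]]] := pigeonhole_fin _ _ (fun t => mixed_radix K md (res t)) _ (fun t => mixed_radix_lt K md _ (res_lt t)).
  by rewrite card_ffun !card_ord.
have {}e := mixed_radix_inj K md _ _ (res_lt t) (res_lt t') e.
have wB u j : (w u j <= B)%N.
  by rewrite /w; case: insub => [i|//]; rewrite -ltnS ltn_ord.
exists (fun j => Z.of_nat (w t j) - Z.of_nat (w t' j)); split.
  by move=> j; move/leP: (wB t j); move/leP: (wB t' j); lia.
split.
  apply: NNPP => none; apply: ne; apply/ffunP => i; apply: val_inj => /=.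
  have hi := ltn_ord i; have : w t i = w t' i.
    apply: NNPP => wne; apply: none; exists (nat_of_ord i); split; [exact/ltP|lia].
  by rewrite /w insubT /= (_ : Sub _ _ = i) //; exact: val_inj.
move=> k /ltP hk; have mk : 0 < Z.of_nat (md k) by move/ltP: (md0 k); lia.
rewrite (zsum_ext _ _ (fun j => Z.of_nat (w t j) * c j k - Z.of_nat (w t' j) * c j k)); last by move=> i _; ring.
rewrite zsum_sub; have := e k hk; rewrite /res; move: (zsum n _) (zsum n _) => a b.
have ha := Z.mod_pos_bound a _ mk; have hb := Z.mod_pos_bound b _ mk => /Z2Nat.inj hh.
apply/Z.mod_divide; first by lia.
by rewrite Zminus_mod hh ?Z.sub_diag ?Z.mod_0_l; lia.
Qed.

(** The exponents add up to 24 + ... + 1 = 300 = 12 * 25, which is why 25 unknowns and coefficients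
    up to [M ^ 12] meet 24 conditions. *)
Lemma siegel_moduli (M : nat) : (\prod_(k < 24) M ^ (24 - k) < (M ^ 12).+1 ^ 25)%N.
Proof.
rewrite -expn_sum; apply: (@leq_ltn_trans ((M ^ 12) ^ 25)%N); last by rewrite ltn_exp2r.
by rewrite -expnM !big_ord_recr big_ord0 /=.
Qed.

Lemma zsum_recl n f : zsum n.+1 f = f 0%N + zsum n (fun i => f i.+1).
Proof. by elim: n => [|n IH]; [rewrite /=; ring|rewrite [LHS]/= -/(zsum n.+1 f) IH /=; ring]. Qed.

Lemma zsum_split n k f : zsum (n + k) f = zsum n f + zsum k (fun i => f (n + i)%N).
Proof.
elim: k => [|k IH]; first by rewrite addn0 /=; ring.
by rewrite addnS /= IH; ring.
Qed.

End Siegel.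

(** * Expansion in one local parameter *)

Lemma congr_mod_trans q a b c : congr_mod q a b -> congr_mod q b c -> congr_mod q a c.
Proof. by move=> [k hk] [l hl]; exists (k + l); lia. Qed.

Lemma congr_mod_sym q a b : congr_mod q a b -> congr_mod q b a.
Proof. by move=> [k hk]; exists (- k); lia. Qed.

Fixpoint peval (c : list Z) (h : Z) : Z :=
  match c with nil => 0 | a :: c' => a + h * peval c' h end.

Lemma peval_add c d : exists e, forall h, peval e h = peval c h + peval d h.
Proof.
elim: c d => [|a c IH] [|b d]; [by exists []|by exists (b :: d)|by exists (a :: c) => h /=; ring|].
by have [e he] := IH d; exists (a + b :: e) => h /=; rewrite he; ring.
Qed.

Lemma peval_mul c d : exists e, forall h, peval e h = peval c h * peval d h.
Proof.
elim: c => [|a c [e he]]; first by exists [].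
have [e1 h1] := peval_add (map (Z.mul a) d) (0 :: e); exists e1 => h; rewrite h1 /= he.
have -> : peval (map (Z.mul a) d) h = a * peval d h by elim: d {he h1} => [|b d IH] /=; rewrite ?IH; ring.
ring.
Qed.

Lemma peval_truncate K c h : exists q,
  peval c h = zsum K (fun k => nth k c 0 * h ^ Z.of_nat k) + h ^ Z.of_nat K * q.
Proof.
elim: K => [|K [q hq]]; first by exists (peval c h); rewrite /= pow_nat0; ring.
suff [q' hq'] : exists q', peval c h = zsum K (fun k => nth k c 0 * h ^ Z.of_nat k) + h ^ Z.of_nat K * (nth K c 0 + h * q').
  by exists q'; rewrite hq' /= pow_natS; ring.
elim: c K {q hq} => [|a c IH] K.
  exists 0; rewrite (_ : zsum _ _ = 0); first by case: K => [|K] /=; ring.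
  by elim: K => [//|K IH] /=; rewrite IH; case: K {IH} => [|K] /=; ring.
case: K => [|K] /=; first by exists (peval c h); rewrite pow_nat0; ring.
have [q' hq'] := IH K; exists q'; rewrite hq' Z.mul_add_distr_l pow_natS.
have -> : zsum K (fun k => nth k (a :: c) 0 * h ^ Z.of_nat k) + nth K (a :: c) 0 * h ^ Z.of_nat K
  = a + h * zsum K (fun k => nth k c 0 * h ^ Z.of_nat k); last by ring.
elim: K {IH hq'} => [|K IH]; first by rewrite /= pow_nat0; ring.
by rewrite [zsum (S K) _]/= IH /= pow_natS; ring.
Qed.

(* The functions on a residue class that are polynomials in the local parameter h modulo W. *)
Section Expansion.
Variables (T : Type) (Cl : T -> Prop) (h : T -> Z) (W : Z).

Definition expandable (f : T -> Z) := exists c, forall t, Cl t -> congr_mod W (f t) (peval c (h t)).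

Lemma expandable_const a : expandable (fun=> a).
Proof. by exists [a] => t _ /=; rewrite Z.mul_0_r Z.add_0_r; exact: congr_mod_refl. Qed.

Lemma expandable_param : expandable h.
Proof.
by exists [0; 1] => t _ /=; rewrite (_ : 0 + _ = h t); [exact: congr_mod_refl|ring].
Qed.

Lemma expandable_add f g : expandable f -> expandable g -> expandable (fun t => f t + g t).
Proof.
move=> [c hc] [d hd]; have [e he] := peval_add c d; exists e => t ht.
by rewrite he; apply: congr_mod_add; [exact: hc|exact: hd].
Qed.

Lemma expandable_mul f g : expandable f -> expandable g -> expandable (fun t => f t * g t).
Proof.
move=> [c hc] [d hd]; have [e he] := peval_mul c d; exists e => t ht.
by rewrite he; apply: congr_mod_mul; [exact: hc|exact: hd].
Qed.

Lemma expandable_congr f g : (forall t, Cl t -> congr_mod W (f t) (g t)) -> expandable g -> expandable f.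
Proof. by move=> hfg [c hc]; exists c => t ht; apply: congr_mod_trans (hfg t ht) (hc t ht). Qed.

Lemma expandable_pow f n : expandable f -> expandable (fun t => f t ^ Z.of_nat n).
Proof.
move=> hf; elim: n => [|n IH].
  by apply: expandable_congr (expandable_const 1) => t _; exact: congr_mod_refl.
apply: expandable_congr (expandable_mul _ _ hf IH) => t _; rewrite pow_natS; exact: congr_mod_refl.
Qed.

Lemma expandable_form cs f : expandable f -> expandable (fun t => form cs (f t) 1).
Proof.
move=> hf; elim: cs => [|c cs IH]; first exact: expandable_const.
apply: expandable_add; first by apply: expandable_mul; [exact: expandable_const|apply: (expandable_pow (fun=> 1)); exact: expandable_const].
exact: expandable_mul.
Qed.

(* Newton-type iteration for u = u0 + d with D u^2 = phi: d = a (phi - D u0^2 - D d^2), where a inverts 2 D u0. *)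
Lemma expandable_sqrt (M D u0 a : Z) n (u phi : T -> Z) : (0 < n)%nat -> expandable phi -> W = M ^ Z.of_nat n ->
  congr_mod W (a * (2 * D * u0)) 1 ->
  (forall t, Cl t -> congr_mod W (D * (u t * u t)) (phi t)) ->
  (forall t, Cl t -> (M | u t - u0)) -> expandable u.
Proof.
move=> hn hphi hW ha hu hM.
have step i : exists g, expandable g /\ forall t, Cl t -> (M | g t) /\
    exists q, congr_mod W (u t - u0 - g t) (M ^ Z.of_nat i * q).
  elim: i => [|i [g [hg hgM]]].
    exists (fun=> 0); split; first exact: expandable_const.
    move=> t ht; split; first exact: Z.divide_0_r.
    by exists (u t - u0); rewrite pow_nat0 (_ : 1 * _ = u t - u0 - 0); [exact: congr_mod_refl|ring].
  exists (fun t => a * (phi t + - D * (u0 * u0) + - D * (g t * g t))); split.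
    apply: expandable_mul; first exact: expandable_const.
    apply: expandable_add; first by apply: expandable_add => //; exact: expandable_const.
    by apply: expandable_mul; [exact: expandable_const|exact: expandable_mul].
  move=> t ht; have [[r2 gM] [q [k3 hk3]]] := hgM t ht; have [r1 eM] := hM t ht.
  have [k1 hk1] := hu t ht; have [k2 hk2] := ha.
  (* The new error is the old one multiplied by [(u t - u0) + g t], up to a constant factor and
     modulo [W]. As [M] divides this sum, each step gains a factor [M]. *)
  have key : u t - u0 - a * (phi t + - D * (u0 * u0) + - D * (g t * g t))
      = M ^ Z.of_nat (S i) * (- (a * D * q * (r1 + r2)))
        + (- k2 * (u t - u0) - a * D * k3 * (u t - u0 + g t) + a * k1) * W.
    have -> : phi t = D * (u t * u t) - k1 * W by lia.
    transitivity ((u t - u0) - (a * (2 * D * u0)) * (u t - u0)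
        - a * D * ((u t - u0 - g t) * (u t - u0 + g t)) + a * k1 * W); first by ring.
    have -> : a * (2 * D * u0) = 1 + k2 * W by lia.
    have -> : u t - u0 - g t = M ^ Z.of_nat i * q + k3 * W by lia.
    have e1 : u t - u0 + g t = (r1 + r2) * M by rewrite eM gM; ring.
    transitivity (- (k2 * W) * (u t - u0) - a * D * (M ^ Z.of_nat i * q * (u t - u0 + g t))
      - a * D * (k3 * W) * (u t - u0 + g t) + a * k1 * W); first by ring.
    by rewrite pow_natS e1; ring.
  split; last by exists (- (a * D * q * (r1 + r2))); rewrite key;
    exists (- k2 * (u t - u0) - a * D * k3 * (u t - u0 + g t) + a * k1); ring.
  have [w hw] : (M | W).
    by rewrite hW; case: (n) hn => [|n' _]; [lia|rewrite pow_natS; exact: Z.divide_factor_l].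
  set z := a * _ in key *; have -> : z = (u t - u0) - (u t - u0 - z) by ring.
  apply: Z.divide_sub_r; first exact: hM.
  rewrite key pow_natS; apply: Z.divide_add_r; last by apply: Z.divide_mul_r; exists w.
  by apply: Z.divide_mul_l; exact: Z.divide_factor_l.
have [g [hg hgM]] := step n.
apply: (expandable_congr _ (fun t => u0 + g t)); last by apply: expandable_add => //; exact: expandable_const.
move=> t ht; have [_ [q [k hk]]] := hgM t ht; rewrite -hW in hk; exists (q + k); lia.
Qed.
End Expansion.

Lemma congr_mod_weaken q q' a b : (q | q') -> congr_mod q' a b -> congr_mod q a b.
Proof. exact: Z.divide_trans. Qed.

Lemma rel_prime_pow a b n : rel_prime a b -> rel_prime a (b ^ Z.of_nat n).
Proof.
move=> h; elim: n => [|n IH]; first by rewrite pow_nat0; apply: rel_prime_sym; exact: rel_prime_1.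
by rewrite pow_natS; apply: rel_prime_mult.
Qed.

Lemma rel_prime_congr a b q : congr_mod q a b -> rel_prime b q -> rel_prime a q.
Proof.
move=> h rp; rewrite (_ : a = (a - b) + b); last by ring.
exact: rel_prime_addl.
Qed.

Lemma inverse_mod a W : rel_prime a W -> exists i, congr_mod W (a * i) 1.
Proof. by move/rel_prime_bezout => [u v e]; exists u; exists (- v); lia. Qed.

Lemma form_scaleS cs n t x s : length cs = S n -> form cs (t * x) (t * s) = t ^ Z.of_nat n * form cs x s.
Proof.
case: cs => [//|c cs] /= [l]; rewrite l Z.pow_mul_l.
transitivity (c * (t ^ Z.of_nat n * s ^ Z.of_nat n) + x * (t * form cs (t * x) (t * s))); first by ring.
by rewrite form_scale l; ring.
Qed.

Lemma form_bound cs B T x s : 1 <= T -> Z.abs x <= T -> Z.abs s <= T -> Forall (fun c => Z.abs c <= B) cs ->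
  T * Z.abs (form cs x s) <= Z.of_nat (length cs) * B * T ^ Z.of_nat (length cs).
Proof.
move=> T1 hx hs; elim: cs => [|c cs IH] /=; first by rewrite /= => _; lia.
move=> /Forall_cons_iff [hc hcs]; have {}IH := IH hcs.
have hp : Z.abs (s ^ Z.of_nat (length cs)) <= T ^ Z.of_nat (length cs).
  rewrite Z.abs_pow; apply: Z.pow_le_mono_l; lia.
have p0 : 0 <= T ^ Z.of_nat (length cs) by apply: Z.pow_nonneg; lia.
have h1 : Z.abs (c * s ^ Z.of_nat (length cs)) <= B * T ^ Z.of_nat (length cs).
  by rewrite Z.abs_mul; apply: Z.mul_le_mono_nonneg => //; lia.
have h2 : Z.abs (x * form cs x s) <= T * Z.abs (form cs x s).
  by rewrite Z.abs_mul; apply: Z.mul_le_mono_nonneg_r; lia.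
rewrite pow_natS Nat2Z.inj_succ; move: (T ^ _) p0 h1 IH => P p0 h1 IH.
have h3 := Z.abs_triangle (c * s ^ Z.of_nat (length cs)) (x * form cs x s).
have : T * Z.abs (c * s ^ Z.of_nat (length cs) + x * form cs x s) <= T * (B * P + Z.of_nat (length cs) * B * P).
  by apply: Z.mul_le_mono_nonneg_l; lia.
by lia.
Qed.

Lemma form_zsum v i n xi : form (map v (List.seq i n)) xi 1 = zsum n (fun j => v (i + j)%nat * xi ^ Z.of_nat j).
Proof.
elim: n i => [//|n IH] i; rewrite zsum_recl /= IH Z.pow_1_l; last by lia.
rewrite Nat.add_0_r pow_nat0 (Z.mul_comm xi) zsum_mulr; f_equal.
by apply: zsum_ext => j _; rewrite pow_natS Nat.add_succ_r /=; ring.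
Qed.

Lemma primitive_proportional x s x' s' : 0 < s -> 0 < s' -> rel_prime x s -> rel_prime x' s' ->
  proportional (x, s) (x', s') -> (x, s) = (x', s').
Proof.
rewrite /proportional /= => s0 s0' rp rp' e.
have d1 : (s | s') by apply: (Gauss s x s'); [exists x'; lia|exact: rel_prime_sym].
have d2 : (s' | s) by apply: (Gauss s' x' s); [exists x; lia|exact: rel_prime_sym].
have es : s = s' by apply: Z.divide_antisym_nonneg => //; lia.
by subst s'; congr pair; nia.
Qed.

Lemma length_filter_negb (A : Type) (f : A -> bool) l :
  length l = (length (filter f l) + length (filter (fun p => negb (f p)) l))%nat.
Proof. by elim: l => [//|a l IH] /=; case: (f a) => /=; rewrite IH; lia. Qed.

Lemma length_fibres (A : Type) (key : A -> Z) (g : Z -> nat) (l : list Z) (L : list A) :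
  (forall p, In p L -> In (key p) l) ->
  (forall r, In r l -> (length (filter (fun p => (key p =? r)%Z) L) <= g r)%nat) ->
  (length L <= list_sum (map g l))%nat.
Proof.
elim: l L => [|r l IH] L hk hn.
  by case: L hk hn => [|a L] hk _ /=; [lia|case: (hk a (or_introl (eq_refl _)))].
rewrite (length_filter_negb _ (fun p => (key p =? r)%Z) L) /=.
have h1 := hn r (or_introl (eq_refl _)).
suff : (length (filter (fun p => negb (key p =? r)%Z) L) <= list_sum (map g l))%nat by lia.
apply: IH => [p /filter_In [hp /negP hne]|r' hr'].
  by case: (hk p hp) => // e; case: hne; apply/Z.eqb_eq.
apply: Nat.le_trans (hn r' (or_intror hr')); elim: (L) => [//|a l' IHl] /=.
by case: (key a =? r)%Z => /=; case: (key a =? r')%Z => /=; lia.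
Qed.

Lemma list_sum_const (A : Type) (n : nat) (l : list A) : list_sum (map (fun _ => n) l) = (n * length l)%nat.
Proof. by elim: l => [|a l IH] /=; lia. Qed.

Local Opaque zsum.

(** * The determinant method on D y^2 = F(x, s) *)

Section Fibre.
Variables (F : list Z) (BF CY : Z).
Hypothesis lF : length F = 19%nat.
Hypothesis hBF : Forall (fun c => Z.abs c <= BF) F.
Hypothesis hCY : 0 <= CY /\ 19 * BF <= CY * CY.
Hypothesis Fpos : exists J, 0 < J /\ forall i, 0 <= i -> 0 < form F (J + i) 1.
Hypothesis Fneg : exists J, 0 < J /\ forall i, 0 <= i -> form F 1 (J + i) < 0.

Variables (q : Z) (k : nat) (D T : Z).
Hypothesis q1 : 1 < q.
Hypothesis D0 : D <> 0.
Hypothesis T1 : 1 <= T.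
Let M := q ^ Z.of_nat k.
Hypothesis hM : (17 + 8 * CY) * T ^ Z.of_nat 16 < M ^ Z.of_nat 12.

Definition solution (p : Z * Z * Z) : Prop :=
  let '(x, s, y) := p in
  0 < x <= T /\ 0 < s <= T /\ rel_prime x s /\ rel_prime s q /\ rel_prime (form F x s) q /\
  rel_prime 2 q /\ D * (y * y) = form F x s.

Let W := M ^ Z.of_nat 24.

Let Mpos : 0 < M.
Proof. apply: Z.pow_pos_nonneg; lia. Qed.

Let rp_M a : rel_prime a q -> rel_prime a M.
Proof. exact: rel_prime_pow. Qed.

Let rp_W a : rel_prime a q -> rel_prime a W.
Proof. by move=> h; apply/rel_prime_pow/rp_M. Qed.

Variable tau : Z -> Z.
Hypothesis htau : forall s, rel_prime s q -> congr_mod W (s * tau s) 1.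

(** Modulo [W] these are the affine coordinates x / s and y / s^9 of the curve
    [D root^2 = F(ratio, 1)]. *)
Definition ratio (p : Z * Z * Z) : Z := let '(x, s, _) := p in x * tau s.
Definition root (p : Z * Z * Z) : Z := let '(_, s, y) := p in y * tau s ^ Z.of_nat 9.

Variable p0 : Z * Z * Z.
Hypothesis sol0 : solution p0.

(** For [root] a class modulo [q] is enough: [ratio] determines it modulo [M] up to sign, and [q]
    separates the signs. So there are at most [M * q] classes instead of [M^2]. *)
Definition in_class (p : Z * Z * Z) : Prop :=
  solution p /\ congr_mod M (ratio p) (ratio p0) /\ congr_mod q (root p) (root p0).

Let MW : (M | W).
Proof. rewrite /W pow_natS; exact: Z.divide_factor_l. Qed.

Let tau_scale cs n x s : length cs = S n -> rel_prime s q ->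
  congr_mod W (tau s ^ Z.of_nat n * form cs x s) (form cs (x * tau s) 1).
Proof.
move=> l rp; rewrite -(form_scaleS cs n (tau s) x s l) (Z.mul_comm (tau s) x).
apply: congr_mod_form; first exact: congr_mod_refl.
by rewrite Z.mul_comm; exact: htau.
Qed.

Let root_sqr p : solution p -> congr_mod W (D * (root p * root p)) (form F (ratio p) 1).
Proof.
case: p => [[x s] y] [_ [_ [_ [rp [_ [_ e]]]]]]; rewrite /root /ratio.
apply: congr_mod_trans (tau_scale F 18 x s lF rp).
rewrite -e (_ : D * _ = tau s ^ Z.of_nat 18 * (D * (y * y))); first exact: congr_mod_refl.
by rewrite -[18%nat]/(9 + 9)%nat pow_natD; ring.
Qed.

Let tau_prime s : rel_prime s q -> rel_prime (tau s) q.
Proof.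
move=> rp; apply: rel_prime_of_divisors => d dt dq.
have [a ha] := htau s rp.
(* The bound [hM] excludes [k = 0], for which [M] would be 1. *)
have dW : (d | W).
  rewrite /W /M; have : (0 < k)%nat.
    move: hM; rewrite /M; case: (k) => [|k' _]; last by lia.
    rewrite pow_nat0 Z.pow_1_l; last by lia.
    have : 1 <= T ^ Z.of_nat 16 by rewrite -(Z.pow_1_l (Z.of_nat 16)); [apply: Z.pow_le_mono_l|]; lia.
    by nia.
  case: (k) => [|k' _]; first by lia.
  by rewrite !pow_natS; do 2! apply: Z.divide_mul_l.
rewrite (_ : 1 = s * tau s - a * W); last by lia.
by apply: Z.divide_sub_r; apply: Z.divide_mul_r.
Qed.

Let D_prime : rel_prime D q /\ rel_prime (root p0) q.
Proof.
case: (p0) sol0 => [[x s] y] [_ [_ [_ [rp [rpF [_ e]]]]]]; rewrite -e in rpF.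
have dv a b : rel_prime (a * b) q -> rel_prime a q /\ rel_prime b q.
  move=> h; split; apply: rel_prime_sym; apply: (rel_prime_sym _ _) => //.
    by apply: (rel_prime_div _ _ _ h); exact: Z.divide_factor_l.
  by apply: (rel_prime_div _ _ _ h); exact: Z.divide_factor_r.
have [h1 /dv [h2 _]] := dv _ _ rpF; split=> //.
apply: rel_prime_sym; apply: rel_prime_mult; apply: rel_prime_sym => //.
apply: rel_prime_sym; apply: rel_prime_pow; apply: rel_prime_sym; exact: tau_prime.
Qed.

Let param (p : Z * Z * Z) := ratio p - ratio p0.

Let ratio_expandable : expandable _ in_class param W ratio.
Proof.
apply: (expandable_congr _ _ _ _ _ (fun p => param p + ratio p0)).
  by move=> p _; rewrite /param (_ : _ + _ = ratio p); [exact: congr_mod_refl|ring].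
by apply: expandable_add; [exact: expandable_param|exact: expandable_const].
Qed.

Let root_expandable : expandable _ in_class param W root.
Proof.
have [rD rr] := D_prime.
have rp2 : rel_prime 2 q by case: (p0) sol0 => [[x s] y] [_ [_ [_ [_ [_ []]]]]].
have rp : rel_prime (2 * D * root p0) q.
  by do 2! (apply: rel_prime_sym; apply: rel_prime_mult; apply: rel_prime_sym => //).
have [a ha] := inverse_mod _ _ (rp_W _ rp).
apply: (expandable_sqrt _ _ _ _ M D (root p0) a 24 root (fun p => form F (ratio p) 1)) => //.
- lia.
- exact: expandable_form.
- by rewrite Z.mul_comm.
- by move=> p [hp _]; exact: root_sqr.
move=> p [hp [hr hy]].
have h1 : congr_mod M (D * (root p * root p)) (D * (root p0 * root p0)).
  apply: congr_mod_trans (congr_mod_weaken _ _ _ _ MW (root_sqr p hp)) _.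
  apply: congr_mod_trans (congr_mod_sym _ _ _ (congr_mod_weaken _ _ _ _ MW (root_sqr p0 sol0))).
  by apply: congr_mod_form => //; exact: congr_mod_refl.
(* [M] divides [D (root - root0) (root + root0)], and the last factor is congruent modulo [q] to the
   unit [2 root0]. *)
apply: (Gauss M (D * (root p + root p0))).
  by case: h1 => w hw; exists w; lia.
apply: rel_prime_sym; apply: rp_M.
apply: rel_prime_sym; apply: rel_prime_mult; apply: rel_prime_sym => //.
apply: (rel_prime_congr _ (2 * root p0)).
  by case: hy => w hw; exists w; lia.
by apply: rel_prime_sym; apply: rel_prime_mult; apply: rel_prime_sym.
Qed.

(** The monomials of weight at most 16 when y has weight 9: 17 of them without y, and 8 with it. *)
Let basis (j : nat) (p : Z * Z * Z) : Z :=
  if Nat.ltb j 17 then ratio p ^ Z.of_nat j else root p * ratio p ^ Z.of_nat (j - 17).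

Let basis_expandable j : expandable _ in_class param W (basis j).
Proof.
rewrite /basis; case: (Nat.ltb j 17); first exact: expandable_pow.
by apply: expandable_mul => //; exact: expandable_pow.
Qed.

(* The 25 coefficients of P(x,s) + y Q(x,s) solve the congruences that kill the terms of order < 24 in the
   local parameter, so the value is divisible by M^24 on the class; being smaller, it vanishes. *)
Lemma auxiliary_form : exists v : nat -> Z, (exists j, (j < 25)%nat /\ v j <> 0) /\
  forall x s y, in_class (x, s, y) ->
    form (map v (List.seq 0 17)) x s + y * form (map v (List.seq 17 8)) x s = 0.
Proof.
have [c hc] := skolem _ _ _ basis_expandable.
pose Mn := Z.to_nat M.
have MnE n : Z.of_nat (ssrnat.expn Mn n) = M ^ Z.of_nat n.
  elim: n => [|n IH]; first by rewrite pow_nat0.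
  by rewrite ssrnat.expnS pow_natS -IH -ssrnat.multE Nat2Z.inj_mul /Mn Z2Nat.id; lia.
(* Since [M] divides the parameter [h], the coefficient of [h ^ k] has to vanish only modulo
   [M ^ (24 - k)]. *)
have [|v [vB [vn0 hv]]] := siegel 25 24 (ssrnat.expn Mn 12) (fun k => ssrnat.expn Mn (ssrnat.subn 24 k))
    (fun j k => nth k (c j) 0) _ (siegel_moduli Mn).
  by move=> i; rewrite ssrnat.expn_gt0; apply/orP; left; apply/ssrnat.ltP; rewrite /Mn; lia.
exists v; split=> // x s y hcl.
have [hsol [hr hy]] := hcl; have [hx [hs [cop [rp [rpF [_ e]]]]]] := hsol.
set H := _ + _.
have [h hE] : exists h, h = param (x, s, y) by exists (param (x, s, y)).
have [h1 hh] : (M | h) by rewrite hE; exact: hr.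
have hW n : (n <= 24)%nat -> (W | M ^ Z.of_nat (24 - n) * h ^ Z.of_nat n).
  move=> hn; rewrite hh Z.pow_mul_l; exists (h1 ^ Z.of_nat n).
  rewrite /W (_ : 24%nat = (24 - n + n)%nat) ?pow_natD; [|lia].
  by rewrite (_ : (24 - n + n - n)%nat = (24 - n)%nat); [ring|lia].
have key : (W | zsum 25 (fun j => v j * basis j (x, s, y))).
  have [e2 he2] : exists e2 : nat -> Z, forall j, peval (c j) h = zsum 24 (fun k => nth k (c j) 0 * h ^ Z.of_nat k) + h ^ Z.of_nat 24 * e2 j.
    by apply: (skolem _ _ (fun j qq => peval (c j) h = _ + _ * qq)) => j; exact: peval_truncate.
  have c1 : congr_mod W (zsum 25 (fun j => v j * basis j (x, s, y)))
     (zsum 25 (fun j => zsum 24 (fun k => v j * nth k (c j) 0 * h ^ Z.of_nat k) + h ^ Z.of_nat 24 * (v j * e2 j))).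
    apply: zsum_congr => j _; rewrite (_ : _ + _ = v j * peval (c j) h).
      by apply: congr_mod_mul; [exact: congr_mod_refl|rewrite hE; exact: hc].
    have eA : v j * zsum 24 (fun k => nth k (c j) 0 * h ^ Z.of_nat k) = zsum 24 (fun k => v j * nth k (c j) 0 * h ^ Z.of_nat k).
      by rewrite zsum_mull; apply: zsum_ext => i _; ring.
    by rewrite he2 Z.mul_add_distr_l eA (Z.mul_shuffle3 (v j)).
  have c2 : (W | zsum 25 (fun j => zsum 24 (fun k => v j * nth k (c j) 0 * h ^ Z.of_nat k) + h ^ Z.of_nat 24 * (v j * e2 j))).
    rewrite zsum_add; apply: Z.divide_add_r; last first.
      apply: zsum_divide => j _; apply: Z.divide_mul_l.
      by have := hW 24%nat (le_n 24); rewrite Nat.sub_diag pow_nat0 Z.mul_1_l.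
    rewrite zsum_exchange; apply: zsum_divide => i hi.
    rewrite -(zsum_mulr 25 (fun j => v j * nth i (c j) 0)).
    apply: Z.divide_trans (hW i _) _; first by lia.
    apply: divide_mul2; last exact: Z.divide_refl.
    by rewrite -MnE; exact: hv.
  by rewrite (_ : zsum _ _ = (zsum 25 (fun j => v j * basis j (x, s, y)) -
      zsum 25 (fun j => zsum 24 (fun k => v j * nth k (c j) 0 * h ^ Z.of_nat k) + h ^ Z.of_nat 24 * (v j * e2 j))) +
      zsum 25 (fun j => zsum 24 (fun k => v j * nth k (c j) 0 * h ^ Z.of_nat k) + h ^ Z.of_nat 24 * (v j * e2 j))); [exact: Z.divide_add_r|ring].
(* The factor [tau s ^ 16] passes to affine coordinates: it splits as 9 for y and 7 for Q. *)
have key2 : (W | tau s ^ Z.of_nat 16 * H).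
  rewrite (_ : tau s ^ Z.of_nat 16 * H = tau s ^ Z.of_nat 16 * form (map v (List.seq 0 17)) x s
     + root (x, s, y) * (tau s ^ Z.of_nat 7 * form (map v (List.seq 17 8)) x s)); last first.
    by rewrite /H /root -[16%nat]/(9 + 7)%nat pow_natD; ring.
  have c1 : congr_mod W (tau s ^ Z.of_nat 16 * form (map v (List.seq 0 17)) x s
     + root (x, s, y) * (tau s ^ Z.of_nat 7 * form (map v (List.seq 17 8)) x s))
     (zsum 25 (fun j => v j * basis j (x, s, y))).
    rewrite -[25%nat]/(17 + 8)%nat (zsum_split 17 8); apply: congr_mod_add.
      apply: congr_mod_trans (tau_scale _ 16 x s _ rp) _; first by rewrite length_map length_seq.
      rewrite form_zsum (zsum_ext 17 (fun j => v j * basis j (x, s, y)) (fun j => v (0 + j)%nat * (x * tau s) ^ Z.of_nat j)).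
        exact: congr_mod_refl.
      by move=> j hj; rewrite /basis (proj2 (Nat.ltb_lt j 17)).
    rewrite (zsum_ext 8 _ (fun j => v (17 + j)%nat * (x * tau s) ^ Z.of_nat j * root (x, s, y))).
      rewrite -zsum_mulr -form_zsum Z.mul_comm; apply: congr_mod_mul; last exact: congr_mod_refl.
      by apply: tau_scale => //; rewrite length_map length_seq.
    move=> j hj; rewrite /basis -ssrnat.plusE (proj2 (Nat.ltb_ge (17 + j) 17)); last by lia.
    by rewrite (_ : (17 + j - 17)%nat = j); [rewrite /ratio; ring|lia].
  by case: c1 => w hw; case: key => w' hw'; exists (w + w'); lia.
have WH : (W | H).
  apply: (Gauss W (tau s ^ Z.of_nat 16)) => //; apply: rel_prime_pow.
  by apply: rel_prime_sym; apply: rp_W; exact: tau_prime.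
have B0 : 0 <= M ^ Z.of_nat 12 by apply: Z.pow_nonneg; lia.
have fb cs : (exists i n, cs = map v (List.seq i n)) -> T * Z.abs (form cs x s) <= Z.of_nat (length cs) * M ^ Z.of_nat 12 * T ^ Z.of_nat (length cs).
  move=> [i [n ->]]; apply: form_bound; try lia.
  by apply/Forall_forall => a /in_map_iff [j [<- _]]; rewrite -MnE; exact: vB.
have b1 : Z.abs (form (map v (List.seq 0 17)) x s) <= 17 * (M ^ Z.of_nat 12 * T ^ Z.of_nat 16).
  have := fb _ (ex_intro _ 0%nat (ex_intro _ 17%nat (eq_refl _))); rewrite length_map length_seq (pow_natS T 16) => hf.
  by apply: (proj2 (Z.mul_le_mono_pos_l _ _ T ltac:(lia))); lia.
have b2 : Z.abs (form (map v (List.seq 17 8)) x s) <= 8 * (M ^ Z.of_nat 12 * T ^ Z.of_nat 7).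
  have := fb _ (ex_intro _ 17%nat (ex_intro _ 8%nat (eq_refl _))); rewrite length_map length_seq (pow_natS T 7) => hf.
  by apply: (proj2 (Z.mul_le_mono_pos_l _ _ T ltac:(lia))); lia.
(* As [|D| >= 1], the value [|F(x, s)| <= 19 BF T^18] bounds [y^2]. *)
have b3 : Z.abs y <= CY * T ^ Z.of_nat 9.
  have t9 : 0 <= T ^ Z.of_nat 9 by apply: Z.pow_nonneg; lia.
  have hf : T * Z.abs (form F x s) <= 19 * BF * T ^ Z.of_nat 19.
    by have := form_bound F BF T x s T1 ltac:(lia) ltac:(lia) hBF; rewrite lF.
  rewrite (pow_natS T 18) in hf.
  have {}hf : Z.abs (form F x s) <= 19 * BF * T ^ Z.of_nat 18.
    by apply: (proj2 (Z.mul_le_mono_pos_l _ _ T ltac:(lia))); lia.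
  rewrite -e Z.abs_mul in hf.
  have D1 : 1 <= Z.abs D by lia.
  have y2 : Z.abs (y * y) <= (CY * T ^ Z.of_nat 9) * (CY * T ^ Z.of_nat 9).
    apply: Z.le_trans (_ : 19 * BF * T ^ Z.of_nat 18 <= _).
      apply: Z.le_trans hf; rewrite -{1}(Z.mul_1_l (Z.abs (y * y))); apply: Z.mul_le_mono_nonneg_r; lia.
    rewrite -[18%nat]/(9 + 9)%nat pow_natD (_ : CY * _ * _ = CY * CY * (T ^ Z.of_nat 9 * T ^ Z.of_nat 9)); last by ring.
    by apply: Z.mul_le_mono_nonneg_r; [exact: Z.square_nonneg|lia].
  apply: Z.square_le_simpl_nonneg; first by apply: Z.mul_nonneg_nonneg; lia.
  by rewrite -Z.abs_mul.
(* [|H|] is at most [M^12 (17 + 8 CY) T^16], which [hM] makes smaller than [M^24]. *)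
have small : Z.abs H < W.
  have b4 : Z.abs (y * form (map v (List.seq 17 8)) x s) <= (CY * T ^ Z.of_nat 9) * (8 * (M ^ Z.of_nat 12 * T ^ Z.of_nat 7)).
    by rewrite Z.abs_mul; apply: Z.mul_le_mono_nonneg => //; lia.
  have e16 : T ^ Z.of_nat 16 = T ^ Z.of_nat 9 * T ^ Z.of_nat 7 by rewrite -[16%nat]/(9 + 7)%nat pow_natD.
  have eW : W = M ^ Z.of_nat 12 * M ^ Z.of_nat 12 by rewrite /W -[24%nat]/(12 + 12)%nat pow_natD.
  have M12 : 0 < M ^ Z.of_nat 12 by apply: Z.pow_pos_nonneg; lia.
  have hlt : M ^ Z.of_nat 12 * ((17 + 8 * CY) * T ^ Z.of_nat 16) < W by rewrite eW; exact: (proj1 (Z.mul_lt_mono_pos_l _ _ _ M12)).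
  have := Z.abs_triangle (form (map v (List.seq 0 17)) x s) (y * form (map v (List.seq 17 8)) x s).
  move: b1 b4 hlt; rewrite e16; move: (T ^ _) (T ^ _) (M ^ _) => t9 t7 mm b1 b4 hlt hH; rewrite -/H in hH; lia.
have W0 : 0 < W by apply: Z.pow_pos_nonneg; lia.
move: W0 WH small; move: (W) (H) => w h0 W0 [c0 ->]; rewrite Z.abs_mul (Z.abs_eq w); last by lia.
move=> small; have [->|cn] := Z.eq_dec c0 0; first exact: Z.mul_0_l.
have h1w : 1 * w <= Z.abs c0 * w by apply: Z.mul_le_mono_nonneg_r; lia.
lia.
Qed.

Let primitive_distinct (L : list (Z * Z)) : NoDup L ->
  Forall (fun p => 0 < snd p /\ rel_prime (fst p) (snd p)) L ->
  ForallOrdPairs (fun p q => ~ proportional p q) L.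
Proof.
elim: L => [|[x s] L IH]; first by move=> _ _; constructor.
move=> /NoDup_cons_iff [nin nd] /Forall_cons_iff [/= [s0 rp] hL].
constructor; last exact: IH.
apply/Forall_forall => -[x' s'] hin hp; apply: nin.
have [/= s0' rp'] := proj1 (Forall_forall _ _) hL _ hin.
by rewrite (primitive_proportional x s x' s').
Qed.

Lemma form_zero_of_line cs (p : nat -> Z * Z) n : length cs = n ->
  (forall i j, i <> j -> ~ proportional (p i) (p j)) ->
  (forall i, snd (p i) <> 0 /\ form cs (fst (p i)) (snd (p i)) = 0) -> Forall (eq 0) cs.
Proof.
move=> l np hz; apply: (form_many_roots cs n (map p (List.seq 0 n))) => //; first by rewrite length_map length_seq.
  elim: n 0%nat {l} => [|n IH] i /=; first by constructor.
  constructor; last exact: IH.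
  apply/Forall_forall => z /in_map_iff [j [<- /in_seq hj]]; apply: np; lia.
by apply/Forall_forall => z /in_map_iff [j [<- _]].
Qed.

Lemma form_zero cs x s : Forall (eq 0) cs -> form cs x s = 0.
Proof. by elim: cs => [//|c cs IH] /Forall_cons_iff [<- h] /=; rewrite IH //; ring. Qed.

(** Elimination of [y] leaves the form [Q^2 F - D P^2] of degree 32, which has a root at every pair
    of the class. *)
Lemma class_bound (L : list (Z * Z)) (y : Z * Z -> Z) : NoDup L ->
  (forall p, In p L -> in_class (p, y p)) -> (length L <= 32)%nat.
Proof.
move=> nd hL; have [v [[j0 [hj0 vj0]] hv]] := auxiliary_form.
set P := map v (List.seq 0 17) in hv; set Q := map v (List.seq 17 8) in hv.
have lP : length P = 17%nat by rewrite length_map length_seq.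
have lQ : length Q = 8%nat by rewrite length_map length_seq.
have ne (cs : list Z) n : length cs = S n -> cs <> [] by case: cs.
have [q2 [l2 e2]] := form_mul Q Q (ne _ _ lQ) (ne _ _ lQ).
have [q3 [l3 e3]] := form_mul q2 F (ne q2 14%nat ltac:(lia)) (ne _ _ lF).
have [p2 [l4 e4]] := form_mul P P (ne _ _ lP) (ne _ _ lP).
have [G [lG eG]] := form_add q3 (map (Z.mul (- D)) p2) ltac:(rewrite length_map; lia).
have GE x s : form G x s = form Q x s * form Q x s * form F x s - D * (form P x s * form P x s).
  by rewrite eG form_mapZ e3 e2 e4; ring.
case: (Compare_dec.le_lt_dec (length L) 32) => // h32; exfalso.
have sub p : In p L -> 0 < snd p /\ rel_prime (fst p) (snd p) /\ form G (fst p) (snd p) = 0.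
  case: p => x s hin; have hcl := hL _ hin; have h0 := hv _ _ _ hcl.
  case: hcl => [[hx [hs [cop [_ [_ [_ e]]]]]] _]; split; first exact: (proj1 hs).
  split=> //=; rewrite GE -e.
  rewrite (_ : form P x s = - (y (x, s) * form Q x s)); last exact: (proj1 (Z.add_move_0_r _ _)).
  ring.
have hG : Forall (eq 0) G.
  apply: (form_many_roots G 33 L); [lia|lia| |].
    by apply: primitive_distinct => //; apply/Forall_forall => p /sub [h1 [h2 _]].
  by apply/Forall_forall => p /sub [h1 [_ h2]]; split=> //; lia.
have G0 x s : form Q x s * form Q x s * form F x s = D * (form P x s * form P x s).
  by have := form_zero G x s hG; rewrite GE; lia.
(* From [Q^2 F = D P^2] identically, [P] and [Q] vanish wherever [F] and [D] have opposite signs.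
   Since [F] takes both signs at infinitely many points, they would vanish altogether. *)
suff [hP hQ] : Forall (eq 0) P /\ Forall (eq 0) Q.
  apply: vj0; case: (Compare_dec.le_lt_dec 17 j0) => h.
    by symmetry; apply: (proj1 (Forall_forall _ _) hQ); apply: in_map; apply/in_seq; lia.
  by symmetry; apply: (proj1 (Forall_forall _ _) hP); apply: in_map; apply/in_seq; lia.
have sq0 a b c d : 0 < b -> d <= 0 -> a * a * b = d * (c * c) -> d <> 0 -> a = 0 /\ c = 0.
  move=> b0 d0 e d1; have h1 : 0 <= a * a * b by apply: Z.mul_nonneg_nonneg; [exact: Z.square_nonneg|lia].
  have h2 : d * (c * c) <= 0 by apply: Z.mul_nonpos_nonneg; [|exact: Z.square_nonneg].
  have h3 : a * a * b = 0 by lia.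
  have h4 : d * (c * c) = 0 by lia.
  by split; nia.
have zero pt : (forall i j : nat, i <> j -> ~ proportional (pt i) (pt j)) ->
    (forall i, snd (pt i) <> 0 /\ form Q (fst (pt i)) (snd (pt i)) = 0 /\ form P (fst (pt i)) (snd (pt i)) = 0) ->
    Forall (eq 0) P /\ Forall (eq 0) Q.
  move=> np hz; split.
    by apply: (form_zero_of_line P pt 17) => // i; have [? [? ?]] := hz i.
  by apply: (form_zero_of_line Q pt 8) => // i; have [? [? ?]] := hz i.
case: (Z_lt_le_dec D 0) => hD.
  have [J [J0 hJ]] := Fpos.
  apply: (zero (fun i => (J + Z.of_nat i, 1))) => [i j ij|i]; first by rewrite /proportional /=; lia.
  by split=> //=; have := sq0 _ _ _ _ (hJ (Z.of_nat i) (Zle_0_nat i)) (Z.lt_le_incl _ _ hD) (G0 _ _) D0.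
have [J [J0 hJ]] := Fneg.
apply: (zero (fun i => (1, J + Z.of_nat i))) => [i j ij|i]; first by rewrite /proportional /=; lia.
split=> /=; first by lia.
apply: (sq0 _ (- form F 1 (J + Z.of_nat i)) _ (- D)); [|lia| |lia].
  by have := hJ (Z.of_nat i) (Zle_0_nat i); lia.
by rewrite Z.mul_opp_r (G0 1 (J + Z.of_nat i)) Z.mul_opp_l.
Qed.

End Fibre.

Lemma fibre_bound (F : list Z) (BF CY q : Z) (k : nat) (D T : Z) (L : list (Z * Z)) :
  length F = 19%nat -> Forall (fun c => Z.abs c <= BF) F -> 0 <= CY /\ 19 * BF <= CY * CY ->
  (exists J, 0 < J /\ forall i, 0 <= i -> 0 < form F (J + i) 1) ->
  (exists J, 0 < J /\ forall i, 0 <= i -> form F 1 (J + i) < 0) ->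
  1 < q -> rel_prime 2 q -> D <> 0 -> 1 <= T ->
  (17 + 8 * CY) * T ^ Z.of_nat 16 < (q ^ Z.of_nat k) ^ Z.of_nat 12 ->
  NoDup L ->
  (forall x s, In (x, s) L -> 0 < x <= T /\ 0 < s <= T /\ rel_prime x s /\ rel_prime s q /\
     rel_prime (form F x s) q /\ exists y, D * (y * y) = form F x s) ->
  Z.of_nat (length L) <= 32 * (q * q ^ Z.of_nat k).
Proof.
move=> lF hBF hCY Fpos Fneg q1 rp2 D0 T1 hM nd hL.
set W := (q ^ Z.of_nat k) ^ Z.of_nat 24.
have [tau htau] : exists tau, forall s, rel_prime s q -> congr_mod W (s * tau s) 1.
  apply: (skolem _ _ (fun s t => rel_prime s q -> congr_mod W (s * t) 1)) => s.
  case: (classic (rel_prime s q)) => [rp|nrp]; last by exists 0.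
  by have [i hi] := inverse_mod s W (rel_prime_pow _ _ _ (rel_prime_pow _ _ _ rp)); exists i.
have [y hy] : exists y : Z * Z -> Z, forall p, In p L -> D * (y p * y p) = form F (fst p) (snd p).
  apply: (skolem _ _ (fun p z => In p L -> D * (z * z) = form F (fst p) (snd p))) => -[x s].
  case: (classic (In (x, s) L)) => [hin|nin]; last by exists 0.
  by have [_ [_ [_ [_ [_ [z hz]]]]]] := hL x s hin; exists z.
set M := q ^ Z.of_nat k; have M0 : 0 < M by apply: Z.pow_pos_nonneg; lia.
pose rt p := ratio tau (p, y p); pose ro p := root tau (p, y p).
(* The class of a pair, coded as one integer below [M * q]. *)
pose key p := (rt p mod M) * q + ro p mod q.
have sol p : In p L -> solution F q D T (p, y p).
  case: p => x s hin; have [h1 [h2 [h3 [h4 [h5 _]]]]] := hL x s hin.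
  by do 6! split=> //; exact: hy.
pose keys := map Z.of_nat (List.seq 0 (Z.to_nat (M * q))).
have -> : 32 * (q * M) = Z.of_nat (list_sum (map (fun _ => 32%nat) keys)).
  by rewrite list_sum_const /keys length_map length_seq Nat2Z.inj_mul Z2Nat.id; lia.
apply: (proj1 (Nat2Z.inj_le _ _)); apply: (length_fibres _ key) => [p hp|r _].
  have b1 := Z.mod_pos_bound (rt p) M M0; have b2 := Z.mod_pos_bound (ro p) q ltac:(lia).
  have hk : 0 <= key p < M * q by rewrite /key; nia.
  apply/in_map_iff; exists (Z.to_nat (key p)); rewrite Z2Nat.id; last by lia.
  by split=> //; apply/in_seq; lia.
case E : (filter _ L) => [|p0 L0]; first by move=> /=; lia.
have hp0 : In p0 (filter (fun p => (key p =? r)%Z) L) by rewrite E; left.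
rewrite -E; move/filter_In: hp0 => [hp0 /Z.eqb_eq k0].
apply: (class_bound F BF CY lF hBF hCY Fpos Fneg q k D T q1 D0 T1 hM tau htau (p0, y p0) (sol _ hp0) _ y).
  exact: NoDup_filter.
move=> p /filter_In [hp /Z.eqb_eq kp]; split; first exact: sol.
have b1 := Z.mod_pos_bound (ro p0) q ltac:(lia); have b2 := Z.mod_pos_bound (ro p) q ltac:(lia).
have [e1 e2] : rt p mod M = rt p0 mod M /\ ro p mod q = ro p0 mod q.
  by apply: (Z.div_mod_unique q); [left|left|rewrite !(Z.mul_comm q) -/(key p) -/(key p0) kp].
by split; apply/Z.mod_divide; try lia; rewrite Zminus_mod ?e1 ?e2 Z.sub_diag Z.mod_0_l; lia.
Qed.

(** * Counting *)

Local Arguments Nat.div : simpl never.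

Lemma NoDup_list_prod (A B : Type) (l : list A) (l' : list B) : NoDup l -> NoDup l' -> NoDup (list_prod l l').
Proof.
move=> nd nd'; elim: l nd => [|a l IH] /=; first by move=> _; constructor.
move=> /NoDup_cons_iff [na nd]; apply: NoDup_app; [|exact: IH|].
  by apply: NoDup_map_NoDup_ForallPairs => // x y _ _ [].
by move=> z /in_map_iff [y [<- _]] /in_prod_iff [].
Qed.

(* Uses (k + 1)^2 <= 1 + 3 k^2 and 1 / d^2 <= 1 / (d - 1) - 1 / d. *)
Lemma inverse_square_sum (n R : nat) :
  (INR (list_sum (map (fun d => (n / d + 1) * (n / d + 1))%nat (List.seq 11 R)))
   <= INR R + 3 * (INR n * INR n) * (1 / 10 - 1 / (INR R + 10)))%R.
Proof.
elim: R => [|R IH]; first by rewrite /=; lra.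
rewrite seq_S map_app list_sum_app plus_INR S_INR.
set d := (11 + R)%nat; set k := (n / d)%nat.
have -> : list_sum (map (fun d => ((n / d + 1) * (n / d + 1))%nat) [d]) = ((k + 1) * (k + 1))%nat by rewrite /= -/k; lia.
have dE : INR d = (INR R + 11)%R by rewrite /d plus_INR (INR_IZR_INZ 11); change (Z.of_nat 11) with 11; lra.
have R0 := pos_INR R; have n0 := pos_INR n; have k0 := pos_INR k.
have h1 : (INR k * INR d <= INR n)%R.
  by rewrite -mult_INR; apply: le_INR; rewrite Nat.mul_comm; apply: Nat.Div0.mul_div_le.
have h2 : (INR ((k + 1) * (k + 1)) <= 1 + 3 * (INR k * INR k))%R.
  rewrite mult_INR plus_INR; change (INR 1) with 1%R.
  have : (INR k <= INR k * INR k)%R by rewrite -mult_INR; apply: le_INR; nia.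
  by nra.
have h3 : (INR k * INR k <= INR n * INR n * (1 / (INR R + 10) - 1 / (INR R + 11)))%R.
  have kn : (INR k <= INR n / INR d)%R.
    by apply: (Rmult_le_reg_r (INR d)); [rewrite dE; lra|rewrite /Rdiv Rmult_assoc Rinv_l ?Rmult_1_r //; rewrite dE; lra].
  have : (INR k * INR k <= (INR n / INR d) * (INR n / INR d))%R by apply: Rmult_le_compat.
  have : (INR n / INR d * (INR n / INR d) = INR n * INR n * (1 / (INR R + 11) * (1 / (INR R + 11))))%R by rewrite dE; field; lra.
  have : (1 / (INR R + 11) * (1 / (INR R + 11)) <= 1 / (INR R + 10) - 1 / (INR R + 11))%R.
    have -> : (1 / (INR R + 10) - 1 / (INR R + 11) = 1 / (INR R + 11) * (1 / (INR R + 10)))%R by field; lra.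
    apply: Rmult_le_compat_l; first by apply: Rlt_le; apply: Rdiv_lt_0_compat; lra.
    by rewrite /Rdiv !Rmult_1_l; apply: Rinv_le_contravar; lra.
  have : (0 <= INR n * INR n)%R by apply: Rmult_le_pos.
  move: (1 / _ * _)%R (_ - _)%R => u v h ? -> ?; nra.
have -> : (INR R + 1 + 10 = INR R + 11)%R by lra.
have -> : (INR R + 1 + 3 * (INR n * INR n) * (1 / 10 - 1 / (INR R + 11)) =
  (INR R + 3 * (INR n * INR n) * (1 / 10 - 1 / (INR R + 10))) +
  (1 + 3 * (INR n * INR n * (1 / (INR R + 10) - 1 / (INR R + 11)))))%R by field; lra.
lra.
Qed.

Section CoprimePairs.
Variables (Q a b A B : Z) (n : nat).
Hypotheses (Q0 : 0 < Q) (a0 : 0 < a) (A0 : 0 <= A).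
Hypotheses (ab : rel_prime a b) (Q210 : (210 | Q)).

Let point (p : Z * Z) : Z * Z := (a + Q * (A + fst p), b + Q * (B + snd p)).
Let content (p : Z * Z) : Z := Z.gcd (fst (point p)) (snd (point p)).
Let range := map Z.of_nat (List.seq 0 n).

Let in_range i : In i range -> 0 <= i < Z.of_nat n.
Proof. by move=> /in_map_iff [k [<- /in_seq h]]; lia. Qed.

Let content_coprime p : rel_prime (content p) Q.
Proof.
constructor; try exact: Z.divide_1_l.
move=> d dc dQ; have [_ _ h] := ab; apply: h.
  have := Z.divide_trans _ _ _ dc (Z.gcd_divide_l _ _); rewrite /= => h.
  by rewrite (_ : a = a + Q * (A + fst p) - Q * (A + fst p)); [apply: Z.divide_sub_r => //; exact: Z.divide_mul_l|ring].
have := Z.divide_trans _ _ _ dc (Z.gcd_divide_r _ _); rewrite /= => h.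
by rewrite (_ : b = b + Q * (B + snd p) - Q * (B + snd p)); [apply: Z.divide_sub_r => //; exact: Z.divide_mul_l|ring].
Qed.

(** The numbers from 2 to 10 have a factor in common with 210. Starting at 11 keeps the share of the
    pairs lost to a common factor near 3/10. *)
Let content_large p : content p <> 0 -> content p = 1 \/ 11 <= content p.
Proof.
move=> c0; have h0 : 0 <= content p by exact: Z.gcd_nonneg.
have h : Z.gcd (content p) 210 = 1.
  apply/Zgcd_1_rel_prime; have [_ _ h] := content_coprime p.
  by constructor; try exact: Z.divide_1_l; move=> d dc d210; apply: h => //; exact: Z.divide_trans Q210.
move: h0 c0 h; move: (content p) => c h0 c0 h.
have [|h1] := Z.le_gt_cases 11 c; first by right.
left; have : c = 1 \/ c = 2 \/ c = 3 \/ c = 4 \/ c = 5 \/ c = 6 \/ c = 7 \/ c = 8 \/ c = 9 \/ c = 10 by lia.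
by move=> hc; move: h; do 9! (case: hc => [->|hc] //); rewrite hc.
Qed.

(** The content [d] is prime to [Q], so it fixes [i] and [j] modulo [d]; only their quotients by [d]
    remain free. *)
Let fixed_content (L : list (Z * Z)) (d : nat) : NoDup L -> (0 < d)%nat ->
  (forall p, In p L -> In p (list_prod range range) /\ content p = Z.of_nat d) ->
  (length L <= (n / d + 1) * (n / d + 1))%nat.
Proof.
move=> nd d0 hL; pose D := Z.of_nat d; have D0 : 0 < D by rewrite /D; lia.
pose f (p : Z * Z) := (fst p / D, snd p / D).
pose quotients := map Z.of_nat (List.seq 0 (n / d + 1)).
have same k i i' : (D | k + Q * (A + i)) -> (D | k + Q * (A + i')) -> rel_prime D Q -> i / D = i' / D -> i = i'.
  move=> h h' rp e.
  have [c hc] : (D | i - i').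
    apply: (Gauss D Q) => //.
    rewrite (_ : Q * _ = (k + Q * (A + i)) - (k + Q * (A + i'))); first exact: Z.divide_sub_r.
    by ring.
  have := Z.div_mod i D ltac:(lia); have := Z.div_mod i' D ltac:(lia).
  have := Z.mod_pos_bound i D D0; have := Z.mod_pos_bound i' D D0; rewrite e => *.
  have [c0|[c1|c1]] : c = 0 \/ 1 <= c \/ c <= -1 by lia.
  - by rewrite c0 in hc; lia.
  - by have : 1 * D <= c * D by [apply: Z.mul_le_mono_nonneg_r; lia]; lia.
  - by have : c * D <= -1 * D by [apply: Z.mul_le_mono_nonneg_r; lia]; lia.
have quot i : In i range -> In (i / D) quotients.
  move=> /in_map_iff [k [<- /in_seq h]]; rewrite -Nat2Z.inj_div; apply: in_map; apply/in_seq.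
  by have := Nat.Div0.div_le_mono k n d ltac:(lia); lia.
have <- : length (map f L) = length L by rewrite length_map.
have -> : ((n / d + 1) * (n / d + 1))%nat = length (list_prod quotients quotients).
  by rewrite length_prod /quotients length_map length_seq.
apply: NoDup_incl_length.
  apply: NoDup_map_NoDup_ForallPairs => // -[i j] [i' j'] hp hp' [e1 e2].
  have [_ c] := hL _ hp; have [_ c'] := hL _ hp'.
  have rp : rel_prime D Q by rewrite /D -c; exact: content_coprime.
  have g1 := Z.gcd_divide_l (fst (point (i, j))) (snd (point (i, j))).
  have g2 := Z.gcd_divide_r (fst (point (i, j))) (snd (point (i, j))).
  have g1' := Z.gcd_divide_l (fst (point (i', j'))) (snd (point (i', j'))).
  have g2' := Z.gcd_divide_r (fst (point (i', j'))) (snd (point (i', j'))).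
  rewrite -/(content _) c /= in g1 g2; rewrite -/(content _) c' /= in g1' g2'.
  rewrite (same a i i') //.
  (* The constant absorbs [Q * (B - A)], as [same] is stated with the shift [A]. *)
  rewrite (same (b + Q * (B - A)) j j') //.
    by rewrite (_ : _ + _ = b + Q * (B + j)) //; ring.
  by rewrite (_ : _ + _ = b + Q * (B + j')) //; ring.
move=> q /in_map_iff [[i j] [<- /hL [/in_prod_iff [hi hj] _]]].
by apply/in_prod_iff; split; exact: quot.
Qed.

(** The contents above 1 lie between 11 and [T], and the sum over them removes at most
    [T + 3/10 n^2] of the [n^2] pairs. *)
Lemma coprime_pairs (T : nat) : a + Q * (A + Z.of_nat n) <= Z.of_nat T ->
  exists L : list (Z * Z), NoDup L /\
    (forall x s, In (x, s) L -> rel_prime x s /\ exists i j, 0 <= i < Z.of_nat n /\ 0 <= j < Z.of_nat n /\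
      x = a + Q * (A + i) /\ s = b + Q * (B + j)) /\
    7 * (Z.of_nat n * Z.of_nat n) <= 10 * (Z.of_nat (length L) + Z.of_nat T).
Proof.
move=> hT; have ndr : NoDup range.
  by apply: NoDup_map_NoDup_ForallPairs (seq_NoDup _ _) => x y _ _; lia.
pose pairs := list_prod range range; have ndp : NoDup pairs by exact: NoDup_list_prod.
pose good p := content p =? 1.
have pinj : ForallPairs (fun p q => point p = point q -> p = q) (filter good pairs).
  by move=> [i j] [i' j'] _ _ [e1 e2]; congr (_, _); nia.
exists (map point (filter good pairs)); split; [|split].
- by apply: NoDup_map_NoDup_ForallPairs => //; exact: NoDup_filter.
- move=> x s /in_map_iff [[i j] [[<- <-] /filter_In [/in_prod_iff [hi hj] /Z.eqb_eq h]]].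
  split; first by apply/Zgcd_1_rel_prime.
  by exists i, j; split; [exact: in_range|split; [exact: in_range|]].
rewrite length_map.
have tot : (n * n = length (filter good pairs) + length (filter (fun p => negb (good p)) pairs))%nat.
  by rewrite -length_filter_negb /pairs length_prod /range length_map length_seq.
have bad : (length (filter (fun p => negb (good p)) pairs) <=
    list_sum (map (fun d => (n / d + 1) * (n / d + 1)) (List.seq 11 T)))%nat.
  have := length_fibres _ content (fun z => (n / Z.to_nat z + 1) * (n / Z.to_nat z + 1))%nat (map Z.of_nat (List.seq 11 T))
    (filter (fun p => negb (good p)) pairs).
  rewrite map_map (map_ext _ (fun d => (n / d + 1) * (n / d + 1))%nat); last by move=> d; rewrite Nat2Z.id.
  apply=> [p /filter_In [hp /negP hg]|r /in_map_iff [d [<- /in_seq hd]]].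
    have hc : content p <> 1 by move=> h; apply: hg; apply/Z.eqb_eq.
    have [hi _] : In (fst p) range /\ In (snd p) range by case: (p) hp => i j /in_prod_iff.
    have {}hi := in_range _ hi.
    have pos : 0 < fst (point p) by rewrite /=; nia.
    have le : content p <= fst (point p) by apply: Z.divide_pos_le => //; exact: Z.gcd_divide_l.
    have c0 : content p <> 0 by move=> /Z.gcd_eq_0_l h; lia.
    have [//|c11] := content_large p c0.
    have leT : content p <= Z.of_nat T by apply: Z.le_trans le _; apply: Z.le_trans hT; rewrite /=; nia.
    apply/in_map_iff; exists (Z.to_nat (content p)); split; first by rewrite Z2Nat.id; lia.
    by apply/in_seq; lia.
  rewrite Nat2Z.id; apply: fixed_content; [|lia|].
    by do 2! apply: NoDup_filter.
  by move=> p /filter_In [/filter_In [hp _] /Z.eqb_eq].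
have T0 := pos_INR T.
have : (INR (length (filter (fun p => negb (good p)) pairs)) <= INR T + 3 / 10 * (INR n * INR n))%R.
  apply: Rle_trans (le_INR _ _ bad) _; apply: Rle_trans (inverse_square_sum n T) _.
  have : (0 <= INR n * INR n)%R by apply: Rmult_le_pos; exact: pos_INR.
  have : (0 < 1 / (INR T + 10))%R by apply: Rdiv_lt_0_compat; lra.
  move: (1 / (_ + _))%R (INR n * INR n)%R => u v; nra.
move: tot => /(f_equal INR); rewrite mult_INR plus_INR => tot hbad.
apply: le_IZR; rewrite !mult_IZR plus_IZR -!INR_IZR_INZ; lra.
Qed.

End CoprimePairs.

(** * Signs and residues of the form of degree 18 *)

Definition family_form : list Z := [-19432911493156020847253567; 0; -2089921679024154371863488; 0;
  -9688932392471075902284; 0; -13700086600601517045; 0; 9618186674345004; 0; 42193039086072; 0;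
  37321328343; 0; 3964464; 0; 0; 0; 1].
(** Expansion about x = 26 s, and about s = x with the sign reversed, gives positive coefficients
    only. This settles the sign of K on two cones. *)
Definition family_form_pos : list Z := [1719566462882962489487890625; 2944286945126841807675000000;
  733217213005883676591750000; 92487575249659733286000000; 7511717106877596997185000;
  435419916571928670232500; 19128027138103160736075; 668272500515903774400; 19590251596375256604;
  513564567184409728; 12658652681918832; 292611890096136; 6015911761431; 103242694464; 1402311024;
  14342016; 103428; 468; 1].
Definition family_form_neg : list Z := [21532535794998829857812500; 383366963099209012481250000;
  3224908656555199856577000000; 17031141702922205106012000000; 63278072025726342319944221250;
  175649371658030461609874418750; 377517770285407408171006148925; 642374942631518561920779868200;
  877271735771646624345305560221; 968756261061854656967133402688; 867091133448667549444008362940;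
  627565280187966612418143867708; 364557108121320133433715390837; 167671677458667807662574747312;
  59715509459472714788295435864; 15890694525279699481308726480; 2975325380131895344001659239;
  349792406876808375250564206; 19432911493156020847253567].
Ltac ring_family := cbv [Kform discK family_form family_form_pos family_form_neg form length]; ring_form.

Lemma family_formE x s : form family_form x s = Kform x s.
Proof. ring_family. Qed.

Lemma family_form_posE y s : Kform (26 * s + y) s = form family_form_pos y s.
Proof. ring_family. Qed.

Lemma family_form_negE x y : Kform x (x + y) = - form family_form_neg y x.
Proof. ring_family. Qed.

Lemma form_nonneg cs x s : 0 <= x -> 0 <= s -> Forall (Z.le 0) cs -> 0 <= form cs x s.
Proof.
move=> x0 s0; elim: cs => [|c cs IH] /=; first by move=> _; lia.
move=> /Forall_cons_iff [c0 h]; apply: Z.add_nonneg_nonneg; apply: Z.mul_nonneg_nonneg => //; [|exact: IH].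
exact: Z.pow_nonneg.
Qed.

Lemma form_positive c cs x s : 0 <= x -> 0 < s -> 0 < c -> Forall (Z.le 0) cs -> 0 < form (c :: cs) x s.
Proof.
move=> x0 s0 c0 h /=; apply: Z.add_pos_nonneg.
  by apply: Z.mul_pos_pos => //; apply: Z.pow_pos_nonneg => //; lia.
by apply: Z.mul_nonneg_nonneg => //; apply: form_nonneg => //; lia.
Qed.

Lemma Kform_pos x s : 0 < s -> 26 * s <= x -> 0 < Kform x s.
Proof.
move=> s0 h; rewrite (_ : x = 26 * s + (x - 26 * s)) ?family_form_posE; last by ring.
by apply: form_positive => //; [lia|repeat constructor].
Qed.

Lemma Kform_neg x s : 0 < x -> x <= s -> Kform x s < 0.
Proof.
move=> s0 h; rewrite (_ : s = x + (s - x)) ?family_form_negE; last by ring.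
suff : 0 < form family_form_neg (s - x) x by lia.
by apply: form_positive => //; [lia|repeat constructor].
Qed.

Lemma Kform_residue x s : congr_mod Qmod x 9 -> congr_mod Qmod s 7 -> congr_mod Qmod (Kform x s) (Kform 9 7).
Proof. by move=> hx hs; rewrite -!family_formE; exact: congr_mod_form. Qed.

(** The prime 13 suits the expansion, since 7 and [Kform 9 7] are units modulo 13; modulo 7, the
    first prime of the characters, [s] would vanish. *)
Lemma family_coprime_13 x s : congr_mod Qmod x 9 -> congr_mod Qmod s 7 ->
  rel_prime s 13 /\ rel_prime (Kform x s) 13.
Proof.
have h13 : (13 | Qmod) by exists (Qmod / 13); vm_compute.
move=> hx hs; split.
  by apply: (rel_prime_congr _ 7); [exact: congr_mod_weaken h13 hs|apply/Zgcd_1_rel_prime].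
apply: (rel_prime_congr _ (Kform 9 7)); first exact: congr_mod_weaken h13 (Kform_residue _ _ hx hs).
by apply/Zgcd_1_rel_prime; vm_compute.
Qed.

(** K is 12 modulo 16, so [K / 4] is odd and 3 modulo 4. Then [g] is odd, [g^2] is 1 modulo 4, and
    [m] inherits the residue 3 that makes [4 * m] fundamental. *)
Lemma family_squarefree_part x s : congr_mod Qmod x 9 -> congr_mod Qmod s 7 ->
  exists m g, Kform x s = 4 * (m * (g * g)) /\ squarefree m /\ m mod 4 = 3.
Proof.
move=> hx hs.
have h16 : congr_mod 16 (Kform x s) 12.
  apply: congr_mod_trans (congr_mod_weaken 16 Qmod _ _ _ (Kform_residue _ _ hx hs)) _.
    by exists (Qmod / 16); vm_compute.
  by exists ((Kform 9 7 - 12) / 16); vm_compute.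
have [k hk] := h16.
have [|m [g [hu [sf g0]]]] := squarefree_part (4 * k + 3); first by lia.
exists m, g; split; [lia|split=> //].
have hm := Z.div_mod m 4 ltac:(lia); have hg := Z.div_mod g 2 ltac:(lia).
have bm := Z.mod_pos_bound m 4 ltac:(lia); have bg := Z.mod_pos_bound g 2 ltac:(lia).
move: hm hg bm bg; move: (m / 4) (m mod 4) (g / 2) (g mod 2) => m1 r g1 e hm hg bm bg.
have [e0|e1] : e = 0 \/ e = 1 by lia.
  have : 4 * k + 3 = 2 * (2 * (m * (g1 * g1))) by rewrite hu hg e0; ring.
  lia.
have : 4 * k + 3 = r + 4 * (m1 * (g * g) + r * (g1 * g1 + g1)) by rewrite hu {1}hm hg e1; ring.
lia.
Qed.

Lemma family_field x s : congr_mod Qmod x 9 -> congr_mod Qmod s 7 -> rel_prime x s ->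
  exists D, fundamental_disc D /\ (exists y, D * (y * y) = Kform x s) /\
    (Kform x s < 0 -> D < 0 /\ rk3_cl_ge D 5) /\ (0 < Kform x s -> 0 < D /\ rk3_cl_ge D 4).
Proof.
move=> hx hs cop; have [m [g [hK [sf m3]]]] := family_squarefree_part x s hx hs.
exists (4 * m); split; [split|split; [|split]].
- by lia.
- by right; exists m; split=> //; split=> //; right.
- by exists g; rewrite hK; ring.
- move=> K0; have m0 : m < 0 by nia.
  by split; [lia|exact: (family_rank x s hx hs cop m g hK sf m3 1 5 (unit_rank_imaginary m m0))].
move=> K0; have m0 : 0 < m by nia.
by split; [lia|exact: (family_rank x s hx hs cop m g hK sf m3 3 4 (unit_rank_real m sf (or_intror m3) m0))].
Qed.

Lemma power_between (q n : Z) : 1 < q -> 1 <= n -> exists k : nat, n <= q ^ Z.of_nat k <= q * n.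
Proof.
move=> q1 n1; rewrite (_ : n = (n - 1) + 1); last by ring.
move: (n - 1) (Z.le_0_sub 1 n); move=> m [_ /(_ n1)]; move: m; apply: natlike_ind => [|m m0 [k hk]].
  by exists 0%nat; rewrite pow_nat0; lia.
have [h|h] := Z.le_gt_cases (m + 1 + 1) (q ^ Z.of_nat k); first by exists k; nia.
exists (S k); rewrite pow_natS (_ : q ^ Z.of_nat k = m + 1); last by lia.
nia.
Qed.

Lemma distinct_values (A : Type) (f : A -> Z) (n : nat) (L : list A) :
  (forall D, (length (filter (fun p => (f p =? D)%Z) L) <= n)%nat) ->
  exists l, NoDup l /\ (forall D, In D l -> exists p, In p L /\ f p = D) /\ (length L <= n * length l)%nat.
Proof.
move=> h; exists (nodup Z.eq_dec (map f L)); split; first exact: NoDup_nodup; split.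
  by move=> D /nodup_In /in_map_iff [p [? ?]]; exists p.
rewrite -(list_sum_const _ n); apply: (length_fibres _ f (fun _ => n)) => // p hp.
by apply/nodup_In; exact: in_map.
Qed.

Lemma window_bound Q a A B n i : 9 <= Q -> 0 < a -> a <= 9 -> 0 <= A -> 0 <= B -> 1 <= n -> 0 <= i <= n ->
  0 < a + Q * (A * n + i) <= Q * (A + B + 2) * n.
Proof.
move=> Q9 a0 a9 A0 B0 n1 hi.
have h0 : 0 <= A * n by apply: Z.mul_nonneg_nonneg; lia.
have h1 : 0 <= B * n by apply: Z.mul_nonneg_nonneg; lia.
have h2 : 0 <= Q * (A * n + i) by apply: Z.mul_nonneg_nonneg; lia.
have h3 : 9 * n <= Q * n by apply: Z.mul_le_mono_nonneg_r; lia.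
have h4 : Q * (A * n + i) <= Q * (A * n + B * n + n) by apply: Z.mul_le_mono_nonneg_l; lia.
lia.
Qed.

Section FamilyCount.
Variables (BF CY A B : Z) (P : Z -> Prop).
Hypothesis hBF : Forall (fun c => Z.abs c <= BF) family_form.
Hypothesis hCY : 0 <= CY /\ 19 * BF <= CY * CY.
Hypotheses (A0 : 0 <= A) (B0 : 0 <= B).

(** The shifts [A * n] and [B * n] move the square of side [n] into a cone where K has constant
    sign. *)
Let px n i := 9 + Qmod * (A * n + i).
Let ps n j := 7 + Qmod * (B * n + j).

Hypothesis hP : forall n i j, 0 <= i < n -> 0 <= j < n -> rel_prime (px n i) (ps n j) ->
  exists D, P D /\ D <> 0 /\ exists y, D * (y * y) = Kform (px n i) (ps n j).

Let C1 := Qmod * (A + B + 2).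
Let W := 17 + 8 * CY.
(** With [T = C1 U^3] a modulus of size [C4 U^4] is large enough, as [(U^4)^12 = (U^3)^16]. Taking
    the side of the square to be a cube keeps [T^(4/3)] integral up to constants. *)
Let C4 := W * C1 ^ Z.of_nat 16 + 1.

Let Qmod9 : 9 <= Qmod.
Proof. by []. Qed.

Let C1pos : 1 <= C1.
Proof. rewrite /C1; move: Qmod9; move: (Qmod) => Q *; nia. Qed.

Let C4pos : 1 <= C4.
Proof.
have : 0 <= W * C1 ^ Z.of_nat 16; last by rewrite /C4; lia.
by apply: Z.mul_nonneg_nonneg; [rewrite /W; lia|apply: Z.pow_nonneg; lia].
Qed.

Let pow_cube U a b : a = (3 * b)%nat -> (U * U * U) ^ Z.of_nat b = U ^ Z.of_nat a.
Proof.
move=> ->; elim: b => [|b IH]; first by rewrite !pow_nat0.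
rewrite (_ : (3 * S b = S (S (S (3 * b))))%nat); last by lia.
by rewrite !pow_natS IH; ring.
Qed.

Let modulus_bound U M : 1 <= U -> C4 * (U * U * U * U) <= M ->
  W * (C1 * (U * U * U)) ^ Z.of_nat 16 < M ^ Z.of_nat 12.
Proof.
move=> U1 hM; have U4 : 1 <= U * U * U * U by nia.
apply: Z.lt_le_trans (_ : (C4 * (U * U * U * U)) ^ Z.of_nat 12 <= _); last first.
  by apply: Z.pow_le_mono_l; split=> //; apply: Z.mul_nonneg_nonneg; lia.
rewrite (Z.pow_mul_l C1) (pow_cube U 48 16) // (Z.pow_mul_l C4).
have -> : (U * U * U * U) ^ Z.of_nat 12 = U ^ Z.of_nat 48.
  by rewrite !Z.pow_mul_l -!pow_natD.
have u48 : 0 < U ^ Z.of_nat 48 by apply: Z.pow_pos_nonneg; lia.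
have : C4 ^ Z.of_nat 1 <= C4 ^ Z.of_nat 12 by apply: Z.pow_le_mono_r; lia.
rewrite Z.pow_1_r.
rewrite Z.mul_assoc => h; apply: (proj1 (Z.mul_lt_mono_pos_r _ _ _ u48)).
by apply: Z.lt_le_trans h; rewrite /C4; lia.
Qed.

Lemma family_count : exists (C C' : Z) (U0 : nat), 0 < C /\ 0 < C' /\ forall U : nat, (U0 <= U)%nat ->
  exists l, NoDup l /\ (forall D, In D l -> P D /\ Z.abs D <= C * Z.of_nat U ^ Z.of_nat 54) /\
    Z.of_nat U ^ Z.of_nat 2 <= C' * Z.of_nat (length l).
Proof.
have C1E : Qmod * (A + B + 2) = C1 by [].
have C1E' : Qmod * (B + A + 2) = C1 by rewrite /C1; ring.
(* 10816 = 2 * 32 * 13 * 13: half of the pairs are kept, a class has 32 points, [root] has 13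
   residues, and rounding the modulus up to a power of 13 costs another 13. From [5 * C1] on, [T] is
   at most a fifth of the number of pairs. *)
exists (19 * BF * C1 ^ Z.of_nat 18), (10816 * C4), (Z.to_nat (5 * C1)).
clearbody C4; clearbody C1.
have BF0 : 0 < BF.
  by move: hBF; rewrite /family_form => /Forall_cons_iff [h _]; lia.
split; first by apply: Z.mul_pos_pos; [lia|apply: Z.pow_pos_nonneg; lia].
split; first by lia.
move=> U hU; have u5 : 5 * C1 <= Z.of_nat U by lia.
have [n nE] : exists n, Z.of_nat n = Z.of_nat U * Z.of_nat U * Z.of_nat U by exists (U * U * U)%nat; rewrite !Nat2Z.inj_mul.
move: (Z.of_nat U) nE u5 => u nE u5 {hU}.
have u3 : u <= u * u * u by nia.
have w1 : 1 <= u * u * u by lia.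
have u4 : 1 <= u * u * u * u by nia.
have [T TE] : exists T, T = C1 * (u * u * u) by eexists.
have T1 : 1 <= T by rewrite TE; nia.
have big a E E' i : 0 < a -> a <= 9 -> 0 <= E -> 0 <= E' -> 0 <= i <= u * u * u ->
    Qmod * (E + E' + 2) = C1 -> 0 < a + Qmod * (E * (u * u * u) + i) <= T.
  move=> a0 a9 E0 E0' hi e; rewrite TE -e; exact: window_bound.
have [L [nd [hL cnt]]] := coprime_pairs Qmod 9 7 (A * Z.of_nat n) (B * Z.of_nat n) n
  ltac:(by []) ltac:(by []) ltac:(by apply: Z.mul_nonneg_nonneg; lia) (proj1 (Zgcd_1_rel_prime 9 7) (eq_refl _))
  ltac:(by exists (Qmod / 210); vm_compute) (Z.to_nat T)
  ltac:(by rewrite nE Z2Nat.id; [apply: (proj2 (big 9 A B _ _ _ _ _ _ _)) => //; lia|exact: Z.le_trans T1]).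
rewrite Z2Nat.id in cnt; last by lia.
have Lbig : u * u * u * (u * u * u) <= 2 * Z.of_nat (length L).
  move: cnt u5 u3; rewrite nE TE; move: (u * u * u) (Z.of_nat _) => w l cnt u5 u3.
  have : 5 * C1 * w <= w * w by apply: Z.mul_le_mono_nonneg_r; lia.
  lia.
have residues x s : In (x, s) L -> congr_mod Qmod x 9 /\ congr_mod Qmod s 7 /\ rel_prime x s.
  move=> /hL [rp [i [j [_ [_ [ex es]]]]]]; split; [|split=> //].
    by exists (A * Z.of_nat n + i); rewrite ex; ring.
  by exists (B * Z.of_nat n + j); rewrite es; ring.
have size x s : In (x, s) L -> 0 < x <= T /\ 0 < s <= T.
  move=> /hL [rp [i [j [hi [hj [-> ->]]]]]]; rewrite nE in hi hj *.
  by split; [apply: (big 9 A B)|apply: (big 7 B A)]; rewrite ?(Z.add_comm B A) //; lia.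
have [f hf] : exists f : Z * Z -> Z, forall p, In p L -> P (f p) /\ f p <> 0 /\ exists y, f p * (y * y) = Kform (fst p) (snd p).
  apply: (skolem _ _ (fun p D => In p L -> P D /\ D <> 0 /\ exists y, D * (y * y) = Kform (fst p) (snd p))) => -[x s].
  case: (classic (In (x, s) L)) => [hin|nin]; last by exists 0.
  have [rp [i [j [hi [hj [ex es]]]]]] := hL x s hin; rewrite ex es in rp *.
  by have [D hD] := hP (Z.of_nat n) i j hi hj rp; exists D.
have [k hk] := power_between 13 (C4 * (u * u * u * u)) ltac:(by []) ltac:(by apply: (proj2 (Z.le_succ_l 0 _)); apply: Z.mul_pos_pos; lia).
have fib D : (length (filter (fun p => (f p =? D)%Z) L) <= Z.to_nat (32 * (13 * 13 ^ Z.of_nat k)))%nat.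
  case E : (filter _ L) => [|p0 L0]; first by move=> /=; lia.
  have : In p0 (filter (fun p => (f p =? D)%Z) L) by rewrite E; left.
  move=> /filter_In [hp0 /Z.eqb_eq fp0]; rewrite -E.
  have D0 : D <> 0 by rewrite -fp0; have [_ []] := hf _ hp0.
  apply: (proj2 (Nat2Z.inj_le _ _)); rewrite Z2Nat.id; last by have := Z.pow_nonneg 13 (Z.of_nat k); lia.
  apply: (fibre_bound family_form BF CY 13 k D T) => //.
  - exists 26; split=> // i i0; rewrite family_formE; apply: Kform_pos; lia.
  - exists 1; split=> // i i0; rewrite family_formE; apply: Kform_neg; lia.
  - by apply/Zgcd_1_rel_prime.
  - by rewrite TE; apply: modulus_bound; [lia|exact: (proj1 hk)].
  - exact: NoDup_filter.
  move=> x s /filter_In [hin /Z.eqb_eq fD]; have [cx [cs rp]] := residues x s hin.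
  have [r1 r2] := family_coprime_13 x s cx cs; have [s1 s2] := size x s hin.
  do 5! split=> //; first by rewrite family_formE.
  by have [_ [_ [y hy]]] := hf _ hin; exists y; rewrite -fD hy family_formE.
(* About [U^6] pairs with fibres of order [U^4] leave [U^2] discriminants. *)
have [l [ndl [hl ll]]] := distinct_values _ f _ L fib.
exists l; split=> //; split.
  move=> D /hl [[x s] [hin <-]]; have [PD [D0 [y hy]]] := hf _ hin; split=> //.
  have [cx [cs rp]] := residues x s hin; have [r1 r2] := family_coprime_13 x s cx cs.
  have [s1 s2] := size x s hin.
  have K0 : Kform x s <> 0.
    by move=> e; move: r2; rewrite e => /Zgcd_1_rel_prime.
  rewrite /fst /snd in hy; have y0 : y <> 0 by move=> e; apply: K0; rewrite -hy e; ring.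
  have le : Z.abs (f (x, s)) <= Z.abs (Kform x s).
    rewrite -hy Z.abs_mul -[X in X <= _]Z.mul_1_r.
    apply: Z.mul_le_mono_nonneg_l; first exact: Z.abs_nonneg.
    by apply: (Zlt_le_succ 0); apply/Z.abs_pos; apply/Z.neq_mul_0.
  apply: Z.le_trans le _.
  have := form_bound family_form BF T x s T1 ltac:(lia) ltac:(lia) hBF.
  rewrite family_formE (_ : length family_form = 19%nat) // (pow_natS T 18) => hb.
  apply: Z.le_trans (_ : 19 * BF * T ^ Z.of_nat 18 <= _).
    by apply: (proj2 (Z.mul_le_mono_pos_l _ _ T ltac:(lia))); lia.
  by rewrite TE Z.pow_mul_l (pow_cube u 54 18) // Z.mul_assoc; lia.
have {}ll : Z.of_nat (length L) <= 32 * (13 * 13 ^ Z.of_nat k) * Z.of_nat (length l).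
  rewrite -(Z2Nat.id (32 * _)) -?Nat2Z.inj_mul; first exact: (proj1 (Nat2Z.inj_le _ _)).
  by have := Z.pow_nonneg 13 (Z.of_nat k); lia.
rewrite (_ : u ^ Z.of_nat 2 = u * u); last by rewrite !pow_natS pow_nat0; ring.
apply: (proj2 (Z.mul_le_mono_pos_l _ _ (u * u * u * u) ltac:(lia))).
have hk2 := proj2 hk.
have : 32 * (13 * 13 ^ Z.of_nat k) * Z.of_nat (length l) <= 32 * (13 * (13 * (C4 * (u * u * u * u)))) * Z.of_nat (length l).
  by apply: Z.mul_le_mono_nonneg_r; lia.
lia.
Qed.

End FamilyCount.

Lemma power_count (P : Z -> Prop) (C C' : Z) (U0 : nat) : 0 < C -> 0 < C' ->
  (forall U : nat, (U0 <= U)%nat -> exists l, NoDup l /\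
    (forall D, In D l -> P D /\ Z.abs D <= C * Z.of_nat U ^ Z.of_nat 54) /\
    Z.of_nat U ^ Z.of_nat 2 <= C' * Z.of_nat (length l)) ->
  exists c : R, (0 < c)%R /\ exists X0 : R, forall X : R, (X0 <= X)%R ->
    exists l : list Z, NoDup l /\ (forall D, In D l -> P D /\ (IZR (Z.abs D) < X)%R) /\
      (c * Rpower X (1 / 30) / ln X <= INR (length l))%R.
Proof.
move=> C0 C0' h; set c0 := IZR C; set c1 := IZR C'.
have c0p : (1 <= c0)%R by apply: IZR_le; lia.
have c1p : (1 <= c1)%R by apply: IZR_le; lia.
pose f (n : nat) := (c0 * INR n ^ 54)%R.
have mono a b : (a <= b)%nat -> (f a <= f b)%R.
  move=> ab; apply: Rmult_le_compat_l; first lra.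
  by apply: pow_incr; split; [exact: pos_INR|exact: le_INR].
have between (X : R) m : (f (S U0) < X)%R -> (X <= f (S m))%R ->
    exists U, (S U0 <= U)%nat /\ (f U < X)%R /\ (X <= f (S U))%R.
  move=> h0; elim: m => [|m IH] h1.
    by have := mono 1%nat (S U0) ltac:(lia); lra.
  have [h2|h2] := Rlt_le_dec (f (S m)) X; last exact: IH.
  have [h3|h3] := Compare_dec.le_lt_dec (S U0) (S m); first by exists (S m).
  by have := mono (S (S m)) (S U0) ltac:(lia); lra.
pose b := (c0 * 2 ^ 54)%R.
have bp : (1 <= b)%R.
  by have := pow_R1_Rle 2 54 ltac:(lra); rewrite /b; move: (2 ^ 54)%R => t; nra.
exists (/ (c1 * b))%R; split; first by apply: Rinv_0_lt_compat; nra.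
(* The summand 3 makes [ln X] at least 1, so division by it only weakens the bound. *)
exists (3 + f (S U0))%R => X hX.
have f0 n : (0 <= f n)%R by apply: Rmult_le_pos; [lra|apply: pow_le; exact: pos_INR].
have fS := f0 (S U0).
have [m hm] : exists m, (X <= f (S m))%R.
  have [m hm] := INR_unbounded X; exists m; rewrite /f S_INR; have m0 := pos_INR m.
  have : ((INR m + 1) ^ 1 <= (INR m + 1) ^ 54)%R by apply: Rle_pow; [lra|lia].
  by move: (_ ^ 54)%R => t; nra.
have [U [hU [h1 h2]]] := between X m ltac:(lra) hm.
have [l [nd [hl ll]]] := h U ltac:(lia).
have U1 : (1 <= INR U)%R by apply: (le_INR 1); lia.
exists l; split=> //; split.
  move=> D /hl [PD leD]; split=> //; apply: Rle_lt_trans h1.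
  by have := IZR_le _ _ leD; rewrite mult_IZR -pow_IZR -INR_IZR_INZ.
(* [U + 1 <= 2 U] accounts for [2 ^ 54] in [b]. Raising the exponent 54 to 60 is the loss from 1/27
   to 1/30. *)
have hp : (X <= (b * INR U ^ 2) ^ 30)%R.
  apply: Rle_trans h2 _; rewrite Rpow_mult_distr -pow_mult /f.
  apply: Rle_trans (_ : c0 * (2 ^ 54 * INR U ^ 54) <= _)%R.
    apply: Rmult_le_compat_l; first lra; rewrite -Rpow_mult_distr; apply: pow_incr.
    by rewrite S_INR; lra.
  rewrite -Rmult_assoc -/b; apply: Rmult_le_compat; [lra|apply: pow_le; lra| |].
    by rewrite -{1}(pow_1 b); apply: Rle_pow; [lra|lia].
  by apply: Rle_pow; [lra|lia].
have bu : (0 < b * INR U ^ 2)%R by apply: Rmult_lt_0_compat; [lra|apply: pow_lt; lra].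
have root : (Rpower X (1 / 30) <= b * INR U ^ 2)%R.
  apply: Rle_trans (Rle_Rpower_l _ _ (1 / 30) _ (conj _ hp)) _; try lra.
  rewrite -(Rpower_pow 30) // Rpower_mult (_ : (INR 30 * (1 / 30) = 1)%R) ?Rpower_1 //; first lra.
  by rewrite (INR_IZR_INZ 30); change (Z.of_nat 30) with 30; field.
have lnX : (1 <= ln X)%R.
  rewrite -(ln_exp 1); have := exp_le_3; have := exp_pos 1 => e0 e3.
  have [h3|h3] : (exp 1 < X)%R \/ exp 1 = X by lra.
    by apply: Rlt_le; exact: ln_increasing.
  by rewrite h3; exact: Rle_refl.
have lenU : (INR U ^ 2 <= c1 * INR (length l))%R.
  by have := IZR_le _ _ ll; rewrite mult_IZR -pow_IZR -!INR_IZR_INZ.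
have r0 : (0 < Rpower X (1 / 30))%R by exact: exp_pos.
have cb : (0 < c1 * b)%R by nra.
apply: (Rmult_le_reg_l (c1 * b)) => //.
have -> : (c1 * b * (/ (c1 * b) * Rpower X (1 / 30) / ln X) = Rpower X (1 / 30) / ln X)%R by field; lra.
apply: Rle_trans (_ : Rpower X (1 / 30) <= _)%R.
  apply: (Rmult_le_reg_r (ln X)); first lra.
  by rewrite /Rdiv Rmult_assoc Rinv_l; [move: (Rpower _ _) r0 => r r0; nra|lra].
apply: Rle_trans root _; rewrite (_ : c1 * b * _ = b * (c1 * INR (length l)))%R; last by ring.
by apply: Rmult_le_compat_l; lra.
Qed.

Theorem theorem1p1 :
  (exists c : R, (0 < c)%R /\ exists X0 : R, forall X : R, (X0 <= X)%R ->
     exists l : list Z, NoDup l /\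
       (forall D, In D l ->
          fundamental_disc D /\ (D < 0)%Z /\ (IZR (Z.abs D) < X)%R /\ rk3_cl_ge D 5) /\
       (c * Rpower X (1 / 30) / ln X <= INR (length l))%R)
  /\
  (exists c : R, (0 < c)%R /\ exists X0 : R, forall X : R, (X0 <= X)%R ->
     exists l : list Z, NoDup l /\
       (forall D, In D l ->
          fundamental_disc D /\ (0 < D)%Z /\ (IZR (Z.abs D) < X)%R /\ rk3_cl_ge D 4) /\
       (c * Rpower X (1 / 30) / ln X <= INR (length l))%R).
Proof.
have Q9 : 9 <= Qmod by [].
(* The largest coefficient is just below 2 * 10^25, and 19 times this bound stays below the square
   of 2 * 10^13. *)
have hBF : Forall (fun c => Z.abs c <= 20000000000000000000000000) family_form.
  by repeat constructor.
have hCY : 0 <= 20000000000000 /\ 19 * 20000000000000000000000000 <= 20000000000000 * 20000000000000 by [].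
have cx A n i : congr_mod Qmod (9 + Qmod * (A * n + i)) 9 by exists (A * n + i); ring.
have cs B n j : congr_mod Qmod (7 + Qmod * (B * n + j)) 7 by exists (B * n + j); ring.
split.
  (* Shifting only [s], by a full side of the square, ensures [x <= s], where K is negative. *)
  have [|C [C' [U0 [C0 [C0' h]]]]] := family_count _ _ 0 1 (fun D => fundamental_disc D /\ D < 0 /\ rk3_cl_ge D 5) hBF hCY (Z.le_refl 0) Z.le_0_1.
    move=> n i j hi hj rp; have [D [fd [sq [hneg _]]]] := family_field _ _ (cx 0 n i) (cs 1 n j) rp.
    have [|D0 rk] := hneg.
      by apply: Kform_neg; move: (Qmod) Q9 => Q Q9; nia.
    by exists D; split=> //; split=> //; lia.
  have [c [c0 [X0 hX]]] := power_count _ C C' U0 C0 C0' h.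
  exists c; split=> //; exists X0 => X /hX [l [nd [hl ll]]]; exists l; split=> //; split=> // D /hl [[? [? ?]] ?].
  by [].
(* Shifting only [x], by 26 sides, ensures [26 * s <= x], where K is positive. *)
have [|C [C' [U0 [C0 [C0' h]]]]] := family_count _ _ 26 0 (fun D => fundamental_disc D /\ 0 < D /\ rk3_cl_ge D 4) hBF hCY ltac:(lia) (Z.le_refl 0).
  move=> n i j hi hj rp; have [D [fd [sq [_ hpos]]]] := family_field _ _ (cx 26 n i) (cs 0 n j) rp.
  have [|D0 rk] := hpos.
    by apply: Kform_pos; move: (Qmod) Q9 => Q Q9; nia.
  by exists D; split=> //; split=> //; lia.
have [c [c0 [X0 hX]]] := power_count _ C C' U0 C0 C0' h.
exists c; split=> //; exists X0 => X /hX [l [nd [hl ll]]]; exists l; split=> //; split=> // D /hl [[? [? ?]] ?].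
by [].
Qed.
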